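(* Let $\phi=\tilde p/p$ be a degree $(n,1)$ rational inner function as in the context and let $\alpha\in\mathbb{T}$. Then there are constants $c_1^\alpha,\dots,c_m^\alpha\ge 0$ such that for every $f\in L^1(\sigma_\alpha)$, $$\int_{\mathbb{T}^2}f\,d\sigma_\alpha=\int_{\mathbb{T}}f(\zeta,\overline{B_\alpha(\zeta)})\,W_\alpha(\zeta)\,dm(\zeta)+\sum_{k=1}^m c_k^\alpha\int_{\mathbb{T}}f(\tau_k,\zeta)\,dm(\zeta),$$ and $c_k^\alpha>0$ if and only if $\phi^*(\tau_k,\lambda_k)=\alpha$ (otherwise $c_k^\alpha=0$). Moreover, if $\phi^*(\tau_k,\lambda_k)=\alpha$, then $z_2\mapsto \frac{\partial\phi}{\partial z_1}(\tau_k,z_2)$ is a nonzero constant $C_k$ on $\overline{\mathbb{D}}\setminus\{\lambda_k\}$ and $c_k^\alpha=1/|C_k|$.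
   Context: $\mathbb{D}$ is the open unit disk, $\mathbb{T}$ the unit circle, $m$ normalized Lebesgue measure on $\mathbb{T}$. Fix $n\ge1$. Let $p\in\mathbb{C}[z_1,z_2]$ have no zeros on $\mathbb{D}^2$, degree at most $n$ in $z_1$ and at most $1$ in $z_2$; write $p(z)=p_1(z_1)+z_2p_2(z_1)$. Set $\tilde p(z)=z_1^nz_2\overline{p(1/\bar z_1,1/\bar z_2)}=z_2\tilde p_1(z_1)+\tilde p_2(z_1)$ with $\tilde p_i(z)=z^n\overline{p_i(1/\bar z)}$. Assume $\tilde p$ has degree exactly $n$ in $z_1$ and $1$ in $z_2$, and $p,\tilde p$ have no common factor; then $\phi=\tilde p/p$ is a rational inner function of degree $(n,1)$. The zeros of $p$ on $\mathbb{T}^2$ are finitely many distinct points $(\tau_1,\lambda_1),\dots,(\tau_m,\lambda_m)$, $0\le m\le n$. At each $\zeta\in\mathbb{T}^2$ the non-tangential limit $\phi^*(\zeta)$ exists and is unimodular. For $\alpha\in\mathbb{T}$: $B_\alpha$ is the rational function $\frac{\tilde p_1(z)-\alpha p_2(z)}{\alpha p_1(z)-\tilde p_2(z)}$ with common factors of numerator and denominator cancelled; $W_\alpha(\zeta)=\frac{|p_1(\zeta)|^2-|p_2(\zeta)|^2}{|\tilde p_1(\zeta)-\alpha p_2(\zeta)|^2}$ for $\zeta\in\mathbb{T}$ (defined off finitely many points). The Poisson kernel is $P_z(\zeta)=\frac{(1-|z_1|^2)(1-|z_2|^2)}{|\zeta_1-z_1|^2|\zeta_2-z_2|^2}$, and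 the Clark measure $\sigma_\alpha$ is the unique positive Borel measure on $\mathbb{T}^2$ with $\frac{1-|\phi(z)|^2}{|\alpha-\phi(z)|^2}=\int_{\mathbb{T}^2}P_z\,d\sigma_\alpha$ for all $z\in\mathbb{D}^2$. *)

(* Defs.v *)
From HB Require Import structures.
From mathcomp Require Import all_boot all_order all_algebra.
From mathcomp Require Import complex.
From mathcomp Require Import all_classical all_reals all_analysis.
Set Implicit Arguments. Unset Strict Implicit. Unset Printing Implicit Defensive.
Import Order.TTheory GRing.Theory Num.Theory ComplexField.
Import numFieldNormedType.Exports.
Local Open Scope ring_scope.
Local Open Scope complex_scope.

Section Defs.
Variable R : realType.
Local Notation C := R[i].

Definition cmod (z : C) : R := Num.sqrt (complex.Re z ^+ 2 + complex.Im z ^+ 2).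

(* parametrisation of the unit circle T by [0,1): t |-> e^{2 pi i t};
   normalized Lebesgue measure m on T is the push-forward of Lebesgue measure
   on [0,1) and the torus T^2 is parametrised by [0,1)^2 *)
Definition expi (t : R) : C := (cos (2 * pi * t)) +i* (sin (2 * pi * t)).
Definition unit_int : set R := [set t : R | 0 <= t < 1].
Definition unit_sq : set (R * R) := [set x | (0 <= x.1 < 1) && (0 <= x.2 < 1)].

Definition cintegrable d (T : measurableType d) (mu : {measure set T -> \bar R})
  (D : set T) (g : T -> C) : Prop :=
  mu.-integrable D (fun x => (complex.Re (g x))%:E) /\ mu.-integrable D (fun x => (complex.Im (g x))%:E).
Definition cint d (T : measurableType d) (mu : {measure set T -> \bar R})
  (D : set T) (g : T -> C) : C :=
  (Rintegral mu D (fun x => complex.Re (g x))) +i* (Rintegral mu D (fun x => complex.Im (g x))).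

(* reflection of a one-variable polynomial of degree <= n:
   refl n q (z) = z^n * conj(q(1/conj z)) *)
Definition refl (n : nat) (q : {poly C}) : {poly C} := \poly_(j < n.+1) (q`_(n - j))^*.

Definition peval (q1 q2 : {poly C}) (z1 z2 : C) : C := q1.[z1] + z2 * q2.[z1].
(* the same polynomial as an element of C[z1][z2] *)
Definition poly2 (q1 q2 : {poly C}) : {poly {poly C}} := q1%:P + 'X * q2%:P.

Definition no_common_factor (P Q : {poly {poly C}}) : Prop :=
  forall q r s : {poly {poly C}}, P = q * r -> Q = q * s -> exists c : C, q = c%:P%:P.

Definition ptilde (n : nat) (p1 p2 : {poly C}) (z1 z2 : C) : C :=
  peval (refl n p2) (refl n p1) z1 z2.
Definition phi (n : nat) (p1 p2 : {poly C}) (z1 z2 : C) : C :=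
  ptilde n p1 p2 z1 z2 / peval p1 p2 z1 z2.

Definition nt_limit (F : C -> C -> C) (zeta1 zeta2 L : C) : Prop :=
  forall a : R, 1 < a -> forall eps : R, 0 < eps -> exists delta : R, 0 < delta /\
    forall z1 z2 : C, cmod z1 < 1 -> cmod z2 < 1 ->
      Num.max (cmod (z1 - zeta1)) (cmod (z2 - zeta2))
        < a * (1 - Num.max (cmod z1) (cmod z2)) ->
      Num.max (cmod (z1 - zeta1)) (cmod (z2 - zeta2)) < delta ->
      cmod (F z1 z2 - L) < eps.

Definition Bnum (n : nat) (p1 p2 : {poly C}) (alpha : C) : {poly C} :=
  let N := refl n p1 - alpha *: p2 in let D := alpha *: p1 - refl n p2 in
  N %/ gcdp N D.
Definition Bden (n : nat) (p1 p2 : {poly C}) (alpha : C) : {poly C} :=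
  let N := refl n p1 - alpha *: p2 in let D := alpha *: p1 - refl n p2 in
  D %/ gcdp N D.
Definition Balpha (n : nat) (p1 p2 : {poly C}) (alpha z : C) : C :=
  (Bnum n p1 p2 alpha).[z] / (Bden n p1 p2 alpha).[z].

Definition Walpha (n : nat) (p1 p2 : {poly C}) (alpha z : C) : R :=
  (cmod p1.[z] ^+ 2 - cmod p2.[z] ^+ 2) / cmod ((refl n p1).[z] - alpha * p2.[z]) ^+ 2.

Definition poisson (z1 z2 w1 w2 : C) : R :=
  (1 - cmod z1 ^+ 2) * (1 - cmod z2 ^+ 2) / (cmod (w1 - z1) ^+ 2 * cmod (w2 - z2) ^+ 2).

End Defs.

(* Main.v *)
(** Fix [z2] in the disc. With [N = p~1 - alpha p2] and [D = alpha p1 - p~2], the density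
    [(1 - |phi|^2) / |alpha - phi|^2] is the real part of [(alpha p + p~) / (alpha p - p~)], a rational
    function of [z1] with denominator [D - z2 N].  On the circle [|N| = |D|], so the boundary zeros of
    this denominator are exactly the common zeros of [N] and [D]; they do not depend on [z2], they are
    first coordinates of zeros of [p] on the torus, and Hopf's lemma makes them simple.  Subtracting the
    corresponding multiples of [(tau + z1) / (tau - z1)] leaves a function without poles on the closed
    disc, to which the Poisson formula applies: its boundary values give the density [W] on the graph of
    the conjugate of [B], and the subtracted poles give the line masses, which turn out not to depend on
    [z2].  The measure obtained this way has the same Poisson integral as the Clark measure, and a finite
    measure on the torus is determined by its Poisson integral.  The non-tangential statement uses that
    [alpha p - p~] vanishes to second order at a zero of [p] where [phi] has limit [alpha], while [|p|]
    is bounded below by a multiple of [1 - |z2|]. *)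

Require Import Defs.
From HB Require Import structures.
From mathcomp Require Import all_boot all_order all_algebra.
From mathcomp Require Import complex.
From mathcomp Require Import all_classical all_reals all_analysis.
From mathcomp Require Import measurable_realfun.
From mathcomp Require Import ring lra.
Import Order.TTheory GRing.Theory Num.Theory ComplexField.
Import numFieldNormedType.Exports.
Local Open Scope classical_set_scope.
Local Open Scope ring_scope.
Local Open Scope complex_scope.

Set Implicit Arguments.
Unset Strict Implicit.
Unset Printing Implicit Defensive.

(** * Complex numbers and polynomials *)

(** That [|phi| <= 1] and that [phi] avoids [alpha] in the bidisc are both read off the Clark
    identity, whose right side integrates a positive kernel. Since quotients by zero are zero, a
    point with [phi = alpha] would make the Poisson integral vanish there; this is excluded by first
    showing that the measure is not zero.

    The line masses do not depend on [z2] because at a boundary zero [tau] both [alpha p + p~] and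
    the derivative of [D - z2 N] carry the factor [lambda - z2], where
    [lambda = - p1(tau) / p2(tau)]. This rests on [D'(tau) = lambda N'(tau)], that is, on
    [|p1|^2 - |p2|^2 >= 0] touching zero to second order on the circle.

    The analysis is elementary: uniform polynomial approximation on the closed disc replaces
    Cauchy's theory, bounds on polynomial remainders replace compactness, and inequalities affine in
    a parameter [r] replace limits at the boundary. For uniqueness, Poisson kernels averaged over
    arcs converge at every point of the square to indicators of quadrants, which generate the Borel
    sets. *)

Section ComplexModulus.
Variable R : realType.
Local Notation Re := complex.Re.
Local Notation Im := complex.Im.
Implicit Types (z w : R[i]) (x y : R).

Lemma cmodE z : cmod z = Normc.normc z.
Proof. by case: z. Qed.

Lemma cmodM z w : cmod (z * w) = cmod z * cmod w.
Proof. by rewrite !cmodE Normc.normcM. Qed.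

Lemma cmodV z : cmod z^-1 = (cmod z)^-1.
Proof. by rewrite !cmodE Normc.normcV. Qed.

Lemma cmod_div z w : cmod (z / w) = cmod z / cmod w.
Proof. by rewrite cmodM cmodV. Qed.

Lemma cmod_norm z : (cmod z)%:C = `|z|.
Proof. by rewrite cmodE; case: z. Qed.

Lemma cmod_ge0 z : 0 <= cmod z.
Proof. exact: sqrtr_ge0. Qed.

Lemma cmod_eq0 z : (cmod z == 0) = (z == 0).
Proof. by rewrite -(inj_eq (@complexI R)) cmod_norm normr_eq0. Qed.

Lemma cmod_gt0 z : (0 < cmod z) = (z != 0).
Proof. by rewrite lt_def cmod_ge0 andbT cmod_eq0. Qed.

Lemma cmod0 : cmod (0 : R[i]) = 0.
Proof. by apply/eqP; rewrite cmod_eq0. Qed.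

Lemma cmod1 : cmod (1 : R[i]) = 1.
Proof. by rewrite cmodE Normc.normc1. Qed.

Lemma cmodD z w : cmod (z + w) <= cmod z + cmod w.
Proof. by rewrite -lecR rmorphD /= !cmod_norm ler_normD. Qed.

Lemma cmodN z : cmod (- z) = cmod z.
Proof. by apply: complexI; rewrite !cmod_norm normrN. Qed.

Lemma cmodBC z w : cmod (z - w) = cmod (w - z).
Proof. by rewrite -cmodN opprB. Qed.

Lemma cmodB z w : cmod (z - w) <= cmod z + cmod w.
Proof. by rewrite -(cmodN w) cmodD. Qed.

Lemma cmod_sub_ge z w : cmod z - cmod w <= cmod (z - w).
Proof. by rewrite lerBlDr -{1}(subrK w z) cmodD. Qed.

Lemma cmodX z k : cmod (z ^+ k) = cmod z ^+ k.
Proof. by elim: k => [|k IH]; rewrite ?expr0 ?cmod1// !exprS cmodM IH. Qed.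

Lemma cmod_real x : cmod x%:C = `|x|.
Proof. by rewrite /cmod /= expr0n /= addr0 sqrtr_sqr. Qed.

Lemma cmod_conj z : cmod z^*%C = cmod z.
Proof. by case: z => a b; rewrite /cmod /= sqrrN. Qed.

Lemma cmod_sqr z : cmod z ^+ 2 = Re z ^+ 2 + Im z ^+ 2.
Proof. by rewrite sqr_sqrtr // addr_ge0 // sqr_ge0. Qed.

Lemma mul_conjc z : z * z^*%C = (cmod z ^+ 2)%:C.
Proof.
by case: z => a b; rewrite cmod_sqr; simpc; rewrite /= !expr2 (mulrC b a) addNr.
Qed.

Lemma Re_le_cmod z : `|Re z| <= cmod z.
Proof.
by rewrite -(ler_pXn2r (ltn0Sn 1)) ?nnegrE ?cmod_ge0// real_normK ?num_real//
   cmod_sqr lerDl sqr_ge0.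
Qed.

Lemma Re_le z : Re z <= cmod z.
Proof. exact: le_trans (ler_norm _) (Re_le_cmod z). Qed.

Lemma conjc_unit z : cmod z = 1 -> z^*%C = z^-1.
Proof.
move=> z1; have z0 : z != 0 by rewrite -cmod_gt0 z1.
by apply: (mulfI z0); rewrite mul_conjc z1 expr1n mulfV.
Qed.

Lemma ReD z w : Re (z + w) = Re z + Re w.
Proof. by case: z w => [a b] [c d]. Qed.

Lemma ImD z w : Im (z + w) = Im z + Im w.
Proof. by case: z w => [a b] [c d]. Qed.

Lemma ReN z : Re (- z) = - Re z.
Proof. by case: z. Qed.

Lemma ReMr z x : Re (z * x%:C) = Re z * x.
Proof. by case: z => a b; simpc. Qed.

Lemma ImMr z x : Im (z * x%:C) = Im z * x.
Proof. by case: z => a b; simpc. Qed.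

Lemma ReMl x z : Re (x%:C * z) = x * Re z.
Proof. by case: z => a b; simpc. Qed.

Lemma ReM z w : Re (z * w) = Re z * Re w - Im z * Im w.
Proof. by case: z w => [a b] [c d]. Qed.

Lemma Re_conjc z : Re z^*%C = Re z.
Proof. by case: z. Qed.

Lemma Re_sum I (s : seq I) (F : I -> R[i]) :
  Re (\sum_(i <- s) F i) = \sum_(i <- s) Re (F i).
Proof. by elim: s => [|i s IH]; rewrite ?big_nil// !big_cons ReD IH. Qed.

Lemma Im_sum I (s : seq I) (F : I -> R[i]) :
  Im (\sum_(i <- s) F i) = \sum_(i <- s) Im (F i).
Proof. by elim: s => [|i s IH]; rewrite ?big_nil// !big_cons ImD IH. Qed.

Lemma Re_divE z w : Re (z / w) = Re (z * w^*%C) / cmod w ^+ 2.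
Proof.
have [->|w0] := eqVneq w 0; first by rewrite invr0 mulr0 cmod0 expr0n /= invr0 mulr0.
have -> : w^-1 = w^*%C * ((cmod w ^+ 2)^-1)%:C.
  apply: (mulfI w0); rewrite mulfV// mulrA mul_conjc -[RHS]rmorphM /= mulfV//.
  by rewrite expf_eq0 /= cmod_eq0.
by rewrite mulrA ReMr.
Qed.

(* The Cayley transform carries the modulus of [w / z] to a real part. *)
Lemma Re_cayley z w : Re ((z + w) / (z - w)) = (cmod z ^+ 2 - cmod w ^+ 2) / cmod (z - w) ^+ 2.
Proof.
rewrite Re_divE; congr (_ / _).
by case: z w => [a b] [c d]; rewrite !cmod_sqr /=; ring.
Qed.

(** Stands in for the limit [r -> 0+] in the boundary estimates, whose error terms are all linear in
    [r]. *)
Lemma ge0_of_affine (a b d : R) : 0 < d ->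
  (forall r, 0 < r < d -> 0 <= a + b * r) -> 0 <= a.
Proof.
move=> d0 h; rewrite leNgt; apply/negP => a0.
have [b0|b0] := leP b 0.
  have := h (d / 2) _; rewrite divr_gt0//= ltr_pdivrMr// ltr_pMr// ltr1n => /(_ isT).
  by apply/negP; rewrite -ltNge ltr_wnDr// mulr_le0_ge0// divr_ge0// ltW.
(* The second entry gives [b * r <= - a / 2], so the affine function is at most [a / 2 < 0] at
   [r]. *)
pose r := Num.min (d / 2) (- a / (2 * b)).
have r0 : 0 < r by rewrite lt_min !divr_gt0 ?oppr_gt0 ?mulr_gt0.
have rd : r < d by rewrite gt_min ltr_pdivrMr// ltr_pMr// ltr1n.
have := h r _; rewrite r0 rd => /(_ isT); apply/negP; rewrite -ltNge.
have : b * r <= - a / 2.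
  rewrite -ler_pdivlMl//; rewrite /r ge_min; apply/orP; right.
  by rewrite le_eqVlt; apply/orP; left; apply/eqP; field; rewrite gt_eqF.
lra.
Qed.

Lemma cmod_poly_le (M : R) (q : {poly R[i]}) :
  exists2 B : R, 0 <= B & forall z, cmod z <= M -> cmod q.[z] <= B.
Proof.
elim/poly_ind: q => [|q c [B B0 IH]].
  by exists 0 => // z _; rewrite horner0 cmod0.
have [M0|M0] := leP 0 M.
  exists (B * M + cmod c); first by rewrite addr_ge0 ?mulr_ge0 ?cmod_ge0.
  move=> z zM; rewrite hornerMXaddC (le_trans (cmodD _ _))// lerD2r cmodM.
  by rewrite ler_pM ?cmod_ge0 ?IH.
exists 0 => // z zM; have := le_lt_trans zM M0.
by rewrite ltNge cmod_ge0.
Qed.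

(** Taylor expansion with a polynomial remainder; [cmod_poly_le] then bounds the remainder on the
    whole disc. *)
Lemma poly_expand1 (q : {poly R[i]}) (w : R[i]) :
  exists q1 : {poly R[i]}, q = q.[w]%:P + ('X - w%:P) * q1.
Proof.
have /factor_theorem [q1 h] : root (q - q.[w]%:P) w by rewrite rootE !hornerE subrr.
by exists q1; rewrite mulrC -h addrC subrK.
Qed.

Lemma poly_expand2 (q : {poly R[i]}) (w : R[i]) :
  exists q2 : {poly R[i]}, q = q.[w]%:P + ('X - w%:P) * (q^`().[w]%:P + ('X - w%:P) * q2).
Proof.
have [q1 h1] := poly_expand1 q w; have [q2 h2] := poly_expand1 q1 w.
suff -> : q^`().[w] = q1.[w] by exists q2; rewrite -h2.
by rewrite {1}h1 derivD derivC derivM derivXsubC !hornerE subrr mul0r addr0.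
Qed.

(** On the circle [1 / conj z = z], so reflection is conjugation up to the unimodular factor
    [z ^+ n]. *)
Lemma horner_refl n (q : {poly R[i]}) z : (size q <= n.+1)%N -> cmod z = 1 ->
  (refl n q).[z] = z ^+ n * (q.[z])^*%C.
Proof.
move=> sq z1; have z0 : z != 0 by rewrite -cmod_gt0 z1.
rewrite /refl horner_poly (horner_coef_wide _ sq) rmorph_sum /= mulr_sumr.
rewrite (reindex_inj rev_ord_inj) /=; apply: eq_bigr => i _.
have le_in : (i <= n)%N by rewrite -ltnS.
have -> : (q`_i * z ^+ i)^*%C = (q`_i)^*%C * z^-1 ^+ i.
  by rewrite -(conjc_unit z1) rmorphM rmorphXn.
rewrite subSS subKn// mulrCA; congr (_ * _).
by rewrite -[X in _ = z ^+ X * _](subnK le_in) exprD -mulrA exprVn mulfV ?mulr1// expf_neq0.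
Qed.

End ComplexModulus.

(** * Mean values and the Poisson formula on the circle *)

Section ComplexMeasurability.
Variable R : realType.
Local Notation Re := complex.Re.
Local Notation Im := complex.Im.

Definition cmeasurable d (T : measurableType d) (f : T -> R[i]) : Prop :=
  measurable_fun setT (fun x => Re (f x)) /\ measurable_fun setT (fun x => Im (f x)).

(** With the value 0 at 0 inversion is measurable on the whole line, so rational functions are
    measurable without removing their poles. *)
Lemma measurable_invr : measurable_fun setT (fun x : R => x^-1).
Proof.
rewrite -(setvU [set 0 : R]); apply/measurable_funU.
- exact: measurableC.
- by [].
split; last exact: measurable_fun_set1.
apply: subspace_continuous_measurable_fun; first exact: measurableC.
by apply: continuous_in_subspaceT => x /[!inE] /= /eqP x0; exact: inv_continuous.
Qed.

Section Closure.
Context d (T : measurableType d).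
Implicit Types f g : T -> R[i].

Lemma cmeasurable_cst c : cmeasurable (fun _ : T => c).
Proof. by split; exact: measurable_cst. Qed.

Lemma cmeasurableD f g : cmeasurable f -> cmeasurable g -> cmeasurable (fun x => f x + g x).
Proof.
move=> [fr fi] [gr gi]; split.
  by under eq_fun do rewrite ReD; exact: measurable_funD.
by under eq_fun do rewrite ImD; exact: measurable_funD.
Qed.

Lemma cmeasurableM f g : cmeasurable f -> cmeasurable g -> cmeasurable (fun x => f x * g x).
Proof.
move=> [fr fi] [gr gi]; split.
  rewrite (_ : (fun _ => _) = fun x => Re (f x) * Re (g x) - Im (f x) * Im (g x)).
    by apply: measurable_funB; apply: measurable_funM.
  by apply/funext => x; case: (f x) (g x) => [a b] [c e].
rewrite (_ : (fun _ => _) = fun x => Re (f x) * Im (g x) + Im (f x) * Re (g x)).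
  by apply: measurable_funD; apply: measurable_funM.
by apply/funext => x; case: (f x) (g x) => [a b] [c e].
Qed.

Lemma cmeasurableN f : cmeasurable f -> cmeasurable (fun x => - f x).
Proof.
move=> mf; under eq_fun do rewrite -mulN1r.
by apply: cmeasurableM => //; exact: cmeasurable_cst.
Qed.

Lemma cmeasurableB f g : cmeasurable f -> cmeasurable g -> cmeasurable (fun x => f x - g x).
Proof. by move=> mf mg; apply: cmeasurableD => //; exact: cmeasurableN. Qed.

Lemma measurable_cmod_sqr f : cmeasurable f -> measurable_fun setT (fun x => cmod (f x) ^+ 2).
Proof.
move=> [fr fi]; under eq_fun do rewrite cmod_sqr.
by apply: measurable_funD; exact: measurable_funX.
Qed.

Lemma measurable_fun_div (f g : T -> R) : measurable_fun setT f -> measurable_fun setT g ->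
  measurable_fun setT (fun x => f x / g x).
Proof.
by move=> mf mg; apply: measurable_funM => //; exact: (measurableT_comp measurable_invr).
Qed.

Lemma cmeasurableV f : cmeasurable f -> cmeasurable (fun x => (f x)^-1).
Proof.
move=> mf; have [fr fi] := mf; have mc := measurable_cmod_sqr mf; split.
  rewrite (_ : (fun _ => _) = fun x => Re (f x) / cmod (f x) ^+ 2).
    exact: measurable_fun_div.
  by apply/funext => x; rewrite cmod_sqr; case: (f x).
rewrite (_ : (fun _ => _) = fun x => - Im (f x) / cmod (f x) ^+ 2).
  by apply: measurable_fun_div => //; exact: measurableT_comp.
by apply/funext => x; rewrite cmod_sqr; case: (f x) => a b /=; rewrite mulNr.
Qed.

Lemma cmeasurable_conj f : cmeasurable f -> cmeasurable (fun x => conjc (f x)).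
Proof.
move=> [fr fi]; split.
  by under eq_fun do rewrite Re_conjc.
rewrite (_ : (fun _ => _) = fun x => - Im (f x)); first exact: measurableT_comp.
by apply/funext => x; case: (f x).
Qed.

Lemma cmeasurable_horner f (q : {poly R[i]}) : cmeasurable f -> cmeasurable (fun x => q.[f x]).
Proof.
move=> mf; elim/poly_ind: q => [|q c IH].
  by under eq_fun do rewrite horner0; exact: cmeasurable_cst.
under eq_fun do rewrite hornerMXaddC.
by apply: cmeasurableD; [exact: cmeasurableM|exact: cmeasurable_cst].
Qed.

Lemma cmeasurable_expi (g : T -> R) : measurable_fun setT g -> cmeasurable (fun x => expi (g x)).
Proof.
move=> mg; split => /=.
  apply: (measurableT_comp (f := cos)); first exact: continuous_measurable_fun (@continuous_cos R).
  exact: measurable_funM.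
apply: (measurableT_comp (f := sin)); first exact: continuous_measurable_fun (@continuous_sin R).
exact: measurable_funM.
Qed.

End Closure.
End ComplexMeasurability.

Section MeanValue.
Variable R : realType.
Local Notation Re := complex.Re.
Local Notation Im := complex.Im.
Local Notation leb := (@lebesgue_measure R).
Local Notation I01 := (@unit_int R).

Lemma cmod_expi (t : R) : cmod (expi t) = 1.
Proof. by rewrite /cmod /= cos2Dsin2 sqrtr1. Qed.

Lemma expiX (t : R) k : expi t ^+ k = expi (t * k%:R).
Proof.
elim: k => [|k IH].
  by rewrite expr0 /expi mulr0 mulr0 cos0 sin0.
rewrite exprS IH /expi; simpc.
have -> : 2 * pi * (t * k.+1%:R) = 2 * pi * t + 2 * pi * (t * k%:R) :> R.
  by rewrite -[k.+1]add1n natrD; ring.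
by rewrite cosD sinD; congr (_ +i* _); rewrite addrC.
Qed.

Lemma unit_intE : I01 = `[0, 1[%classic.
Proof. by apply/seteqP; split => x /=; rewrite in_itv. Qed.

Lemma measurable_unit_int : measurable (I01 : set (measurableTypeR R)).
Proof. by rewrite unit_intE. Qed.

Lemma lebesgue_unit_int : leb I01 = 1%E.
Proof. by rewrite unit_intE lebesgue_measure_itv /= lte_fin ltr01 oppr0 adde0. Qed.

Lemma eq_int01 (f g : R -> R) : f =1 g ->
  \int[leb]_(t in I01) f t = \int[leb]_(t in I01) g t.
Proof. by move=> fg; apply: eq_Rintegral => t _. Qed.

Lemma integrable_unit_int (f : R -> R) (B : R) : measurable_fun setT f ->
  (forall t, `|f t| <= B) -> leb.-integrable I01 (EFin \o f).
Proof.
move=> mf fB; apply: measurable_bounded_integrable => //.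
- exact: measurable_unit_int.
- by rewrite [X in (X < _)%E](_ : _ = 1%E) ?ltry//; exact: lebesgue_unit_int.
- exact: measurable_funTS.
- by exists B; split; [exact: num_real|move=> x Bx t _; apply: le_trans (fB t) (ltW Bx)].
Qed.

Lemma integrable_poly_circle (q : {poly R[i]}) : leb.-integrable I01 (EFin \o (fun t => Re q.[expi t])).
Proof.
have [B B0 hB] := cmod_poly_le 1 q.
apply: (@integrable_unit_int _ B) => [|t].
  by have [] := cmeasurable_horner q (cmeasurable_expi (@measurable_id _ R setT)).
by rewrite (le_trans (Re_le_cmod _))// hB// cmod_expi.
Qed.

Lemma Rintegral_expX (c : R[i]) k :
  (\int[leb]_(t in I01) Re (c * expi t ^+ k.+1) = 0)%R.
Proof.
pose K : R := 2 * pi * k.+1%:R.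
have K0 : K != 0 by rewrite !mulf_neq0 ?pnatr_eq0// gt_eqF ?pi_gt0.
(* A primitive of the integrand; it agrees at 0 and 1 because [K] is an integer multiple of
   [2 * pi]. *)
pose F (t : R) := (Re c * sin (K * t) + Im c * cos (K * t)) / K.
pose f (t : R) := Re c * cos (K * t) - Im c * sin (K * t).
have fE t : Re (c * expi t ^+ k.+1) = f t.
  rewrite expiX ReM /= /f /K; congr (_ * cos _ - _ * sin _); ring.
have dF (t : R) : is_derive t 1 F (f t).
  have -> : f t = (Re c *: (K *: cos (K * t)) + Im c *: (K *: - sin (K * t))) * K^-1.
    by rewrite /f /GRing.scale /=; field.
  have dK : is_derive t 1 (fun s : R => K * s) K.
    by apply: is_derive_eq; rewrite /GRing.scale /= mulr1.
  rewrite /F.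
  apply: is_derive_eq.
    by rewrite /GRing.scale /=; field.
have cf : continuous f.
  move=> t; apply: cvgB; apply: cvgM; try exact: cvg_cst.
    apply: (@continuous_comp _ _ _ ( *%R K) cos); [exact: mulrl_continuous|exact: continuous_cos].
  apply: (@continuous_comp _ _ _ ( *%R K) sin); [exact: mulrl_continuous|exact: continuous_sin].
rewrite (eq_int01 (g := f)); last by move=> t; exact: fE.
have h := @continuous_FTC2 R f F 0 1 ltr01 (continuous_subspaceT cf).
rewrite /Rintegral unit_intE integral_itv_bndo_bndc; last first.
  by apply/measurable_EFinP/measurable_funTS; exact: continuous_measurable_fun.
rewrite h.
- rewrite /= /F !mulr0 mulr1 sin0 cos0.
  have -> : K = 0 + (pi *+ 2) *+ k.+1 by rewrite /K add0r -mulr_natl -[pi *+ 2]mulr_natl; ring.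
  by rewrite (periodicn (@sinD2pi R)) (periodicn (@cosD2pi R)) sin0 cos0 subrr.
- split; first by move=> x _; have [] := dF x.
  + by apply: cvg_at_right_filter; apply: differentiable_continuous; apply/derivable1_diffP; have [] := dF 0.
  + by apply: cvg_at_left_filter; apply: differentiable_continuous; apply/derivable1_diffP; have [] := dF 1.
- by move=> x _; rewrite derive1E; have [_ ->] := dF x.
Qed.

Lemma mean_value_poly (q : {poly R[i]}) :
  \int[leb]_(t in I01) Re q.[expi t] = Re q.[0].
Proof.
(* The extra power makes the induction on [q] go through: a factor ['X] of the polynomial is
   absorbed into [k]. *)
suff h k : \int[leb]_(t in I01) Re (q.[expi t] * expi t ^+ k) = (if k == 0%N then Re q.[0] else 0).
  by rewrite -[RHS](h 0%N); apply: eq_int01 => t; rewrite expr0 mulr1.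
elim/poly_ind: q k => [|q c IH] k.
  rewrite horner0 /= if_same (eq_int01 (g := cst 0)); last first.
    by move=> t; rewrite horner0 mul0r.
  by rewrite Rintegral_cst ?mul0r//; exact: measurable_unit_int.
rewrite (eq_int01 (g := fun t => Re (q.[expi t] * expi t ^+ k.+1) + Re (c * expi t ^+ k))); last first.
  by move=> t; rewrite hornerMXaddC mulrDl ReD -mulrA -exprS.
have ip (r : {poly R[i]}) j :
    leb.-integrable I01 (EFin \o (fun t => Re (r.[expi t] * expi t ^+ j))).
  have := integrable_poly_circle (r * 'X^j); congr (integrable _ _ _).
  by apply/funext => t /=; rewrite hornerM hornerXn.
have ic j : leb.-integrable I01 (EFin \o (fun t => Re (c * expi t ^+ j))).
  by have := ip c%:P j; congr (integrable _ _ _); apply/funext => t /=; rewrite hornerC.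
rewrite RintegralD//; [|exact: measurable_unit_int].
rewrite IH /= add0r; case: k => [|k] /=; last exact: Rintegral_expX.
rewrite (eq_int01 (g := cst (Re c))); last by move=> t; rewrite expr0 mulr1.
rewrite Rintegral_cst; last exact: measurable_unit_int.
rewrite [X in fine X](_ : _ = 1%E) /=; last by rewrite lebesgue_unit_int.
by rewrite mulr1 hornerMXaddC mulr0 add0r.
Qed.

(** Membership in the disc algebra. The mean value property of polynomials passes to such uniform
    limits. *)
Definition disc_approx (f : R[i] -> R[i]) : Prop := forall e : R, 0 < e ->
  exists q : {poly R[i]}, forall z, cmod z <= 1 -> cmod (f z - q.[z]) <= e.

(** Partial sums of the geometric series in [z / a]; after [m] terms the error is
    [(z / a) ^+ m / (z - a)], at most [A^-1 ^+ m / (A - 1)] in modulus. *)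
Lemma disc_approx_inv (a : R[i]) : 1 < cmod a -> disc_approx (fun z => (z - a)^-1).
Proof.
move=> a1 e e0; pose A := cmod a.
have A0 : 0 < A by apply: lt_trans a1.
have a0 : a != 0 by rewrite -cmod_gt0.
have [m hm] : exists m, (A^-1) ^+ m < e * (A - 1).
  have /cvgr0Pnorm_lt : ((fun m => A^-1 ^+ m) @ \oo --> (0 : R))%classic.
    by apply: cvg_expr; rewrite ger0_norm ?invr_ge0 ?(ltW A0)// invf_lt1.
  move=> /(_ (e * (A - 1))); rewrite mulr_gt0 ?subr_gt0// => /(_ isT) [m _ h].
  by exists m; have := h m (leqnn m); rewrite /= ger0_norm// exprn_ge0// invr_ge0 ltW.
exists (- a^-1 *: \sum_(i < m) (a^-1 *: 'X) ^+ i) => z z1.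
have za : A - 1 <= cmod (z - a).
  by rewrite cmodBC (le_trans _ (cmod_sub_ge _ _))// lerB.
have za0 : z - a != 0 by rewrite -cmod_gt0 (lt_le_trans _ za)// subr_gt0.
have -> : (z - a)^-1 - (- a^-1 *: \sum_(i < m) (a^-1 *: 'X) ^+ i).[z] = (z / a) ^+ m / (z - a).
  rewrite hornerZ horner_sum.
  under eq_bigr do rewrite horner_exp hornerZ hornerX mulrC.
  apply: (mulIf za0); rewrite mulrBl divfK// mulVf//.
  have -> : - a^-1 * (\sum_(i < m) (z / a) ^+ i) * (z - a) = - ((z / a - 1) * \sum_(i < m) (z / a) ^+ i).
    by field.
  by rewrite -subrX1; ring.
rewrite cmod_div cmodX cmod_div -/A ler_pdivrMr; last by rewrite (lt_le_trans _ za)// subr_gt0.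
have h1 : (cmod z / A) ^+ m <= A^-1 ^+ m.
  by rewrite lerXn2r ?nnegrE ?divr_ge0 ?invr_ge0 ?cmod_ge0 ?(ltW A0)// ler_piMl// invr_ge0 ltW.
apply: le_trans h1 _; apply: le_trans (ltW hm) _.
by rewrite ler_wpM2l// ltW.
Qed.

Lemma disc_approxM_inv (f : R[i] -> R[i]) (a : R[i]) : 1 < cmod a -> disc_approx f ->
  disc_approx (fun z => f z / (z - a)).
Proof.
move=> a1 hf e e0; set M := cmod a - 1; have M0 : 0 < M by rewrite subr_gt0.
(* [q1] is fixed first, so that its bound [B] on the disc is known when the accuracy of [q2] is
   chosen. Each of the two errors is then at most [e / 2]. *)
have [q1 h1] := hf (e * M / 2) (divr_gt0 (mulr_gt0 e0 M0) (ltr0Sn _ _)).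
have [B B0 hB] := cmod_poly_le 1 q1.
have B1 : 0 < B + 1 by rewrite ltr_wpDl.
have [q2 h2] := disc_approx_inv a1 (e := e / (2 * (B + 1))) (divr_gt0 e0 (mulr_gt0 (ltr0Sn _ _) B1)).
exists (q1 * q2) => z z1.
have za : M <= cmod (z - a).
  by rewrite cmodBC (le_trans _ (cmod_sub_ge _ _))// lerB.
have -> : f z / (z - a) - (q1 * q2).[z] = (f z - q1.[z]) / (z - a) + q1.[z] * ((z - a)^-1 - q2.[z]).
  by rewrite hornerM; ring.
apply: le_trans (cmodD _ _) _; rewrite cmod_div cmodM.
have -> : e = e / 2 + e / 2 by field.
apply: lerD.
  rewrite ler_pdivrMr; last exact: lt_le_trans za.
  rewrite (le_trans (h1 _ z1))// mulrAC ler_wpM2l// ltW// divr_gt0//.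
apply: (@le_trans _ _ (B * (e / (2 * (B + 1))))).
  by rewrite ler_pM ?cmod_ge0 ?hB ?h2.
rewrite mulrA invfM mulrACA [B / _]mulrC mulrC -[leRHS]mulr1.
rewrite mulrC -!mulrA mulrC -!mulrA.
have : B / (B + 1) <= 1 by rewrite ler_pdivrMr// mul1r lerDl.
have : 0 < e / 2 by rewrite divr_gt0.
by nra.
Qed.

(** All roots of [E] lie outside the closed disc; its linear factors are divided out one at a
    time. *)
Lemma disc_approx_rat (Q E : {poly R[i]}) :
  (forall z, cmod z <= 1 -> E.[z] != 0) -> disc_approx (fun z => Q.[z] / E.[z]).
Proof.
have [rs rsE] := closed_field_poly_normal E.
move: (lead_coef E) rsE => c -> hE.
have hrs : forall a, a \in rs -> 1 < cmod a.
  move=> a ars; rewrite ltNge; apply/negP => /hE /negP; apply; apply/eqP.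
  rewrite hornerZ horner_prod (big_rem a ars) /= hornerXsubC subrr mul0r mulr0//.
have {hE}-> : (fun z => Q.[z] / (c *: \prod_(a <- rs) ('X - a%:P)).[z]) =
   (fun z => (c^-1 *: Q).[z] / (\prod_(a <- rs) ('X - a%:P)).[z]).
  by apply/funext => z; rewrite !hornerZ invfM mulrA [Q.[z] / c]mulrC.
elim: rs hrs => [|a rs IH] hrs e e0.
  by exists (c^-1 *: Q) => z _; rewrite big_nil hornerC divr1 subrr cmod0 ltW.
have := disc_approxM_inv (hrs a (mem_head _ _)) (IH _) e0.
case=> [b brs|q hq]; first by rewrite hrs// in_cons brs orbT.
exists q => z /hq; rewrite big_cons hornerM hornerXsubC invfM.
by rewrite mulrCA [X in _ -> cmod (X - _) <= _]mulrC.
Qed.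

Lemma mean_value_rat (Q E : {poly R[i]}) :
  (forall z, cmod z <= 1 -> E.[z] != 0) ->
  leb.-integrable I01 (EFin \o (fun t => Re (Q.[expi t] / E.[expi t]))) /\
  \int[leb]_(t in I01) Re (Q.[expi t] / E.[expi t]) = Re (Q.[0] / E.[0]).
Proof.
move=> hE; have ap := disc_approx_rat Q hE.
have int_f : leb.-integrable I01 (EFin \o (fun t => Re (Q.[expi t] / E.[expi t]))).
  have [q hq] := ap 1 ltr01; have [B B0 hB] := cmod_poly_le 1 q.
  apply: (@integrable_unit_int _ (1 + B)) => [|t].
    have me := cmeasurable_expi (@measurable_id _ R setT).
    by have [] := cmeasurableM (cmeasurable_horner Q me) (cmeasurableV (cmeasurable_horner E me)).
  apply: le_trans (Re_le_cmod _) _; rewrite -[X in cmod X](subrK q.[expi t]).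
  by apply: le_trans (cmodD _ _) _; rewrite lerD ?hq ?hB ?cmod_expi.
split => //; apply/eqP; rewrite -subr_eq0 -normr_eq0 eq_le normr_ge0 andbT.
apply/ler_addgt0Pr => e e0; rewrite add0r.
have [q hq] := ap (e / 2) (divr_gt0 e0 (ltr0Sn _ _)).
have intB : leb.-integrable I01 (EFin \o (fun t => Re (Q.[expi t] / E.[expi t]) - Re q.[expi t])).
  have := integrableB measurable_unit_int int_f (integrable_poly_circle q).
  by congr (integrable _ _ _); apply/funext => t /=.
have h1 : `|\int[leb]_(t in I01) Re (Q.[expi t] / E.[expi t]) - Re q.[0]| <= e / 2.
  rewrite -mean_value_poly -RintegralB//;
    [|exact: measurable_unit_int|exact: integrable_poly_circle].
  apply: le_trans (le_normr_Rintegral measurable_unit_int intB) _.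
  have -> : e / 2 = \int[leb]_(t in I01) (cst (e / 2)) t.
    rewrite Rintegral_cst; last exact: measurable_unit_int.
    by rewrite [X in fine X](_ : _ = 1%E) /= ?mulr1//; exact: lebesgue_unit_int.
  apply: le_Rintegral.
  - exact: measurable_unit_int.
  - exact: integrable_norm intB.
  - by apply: (@integrable_unit_int _ (e / 2)) => // t; rewrite ger0_norm// divr_ge0// ltW.
  - move=> t _ /=; rewrite -ReN -ReD (le_trans (Re_le_cmod _))// hq// cmod_expi//.
have h2 : `|Re q.[0] - Re (Q.[0] / E.[0])| <= e / 2.
  by rewrite distrC -ReN -ReD (le_trans (Re_le_cmod _))// hq// cmod0.
have -> : e = e / 2 + e / 2 by field.
rewrite -[X in `|X|](subrKA (Re q.[0])).
by apply: le_trans (ler_normD _ _) _; rewrite lerD.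
Qed.
End MeanValue.

Section PoissonFormula.
Variable R : realType.
Local Notation Re := complex.Re.
Local Notation leb := (@lebesgue_measure R).
Local Notation I01 := (@unit_int R).
Implicit Types z w : R[i].

Definition pk z w : R := (1 - cmod z ^+ 2) / cmod (w - z) ^+ 2.

Lemma poisson_pk z1 z2 w1 w2 : poisson z1 z2 w1 w2 = pk z1 w1 * pk z2 w2.
Proof. by rewrite /poisson /pk invfM mulrACA. Qed.

Lemma sub_circle_neq0 z w : cmod z < 1 -> cmod w = 1 -> w - z != 0.
Proof. by move=> z1 w1; rewrite subr_eq0; apply/eqP => e; move: z1; rewrite -e w1 ltxx. Qed.

Lemma one_sub_conj_neq0 z w : cmod z < 1 -> cmod w <= 1 -> 1 - z^*%C * w != 0.
Proof.
move=> z1 w1; rewrite subr_eq0; apply/eqP => e.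
have : cmod (z^*%C * w) < 1 by rewrite cmodM cmod_conj (le_lt_trans _ z1)// ler_piMr ?cmod_ge0.
by rewrite -e cmod1 ltxx.
Qed.

Lemma pk_ge0 z w : cmod z <= 1 -> 0 <= pk z w.
Proof.
by move=> z1; rewrite divr_ge0 ?sqr_ge0// subr_ge0 exprn_ile1 ?cmod_ge0.
Qed.

(** Harnack's lower bound, from [|w - z| <= 1 + |z|]. *)
Lemma pk_ge z w : cmod z < 1 -> cmod w = 1 -> (1 - cmod z) / (1 + cmod z) <= pk z w.
Proof.
move=> z1 w1; have z0 := cmod_ge0 z.
have h1 : cmod (w - z) <= 1 + cmod z by rewrite -w1 cmodB.
have h0 : 0 < cmod (w - z) by rewrite cmod_gt0 sub_circle_neq0.
rewrite /pk ler_pdivlMr ?exprn_gt0// mulrAC ler_pdivrMr ?ltr_wpDr//.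
rewrite (_ : 1 - cmod z ^+ 2 = (1 - cmod z) * (1 + cmod z)); last by ring.
rewrite -mulrA ler_wpM2l ?subr_ge0 ?(ltW z1)// -expr2 lerXn2r// nnegrE// ?(ltW h0)//.
exact: addr_ge0.
Qed.

(** On the circle [|w - z|^2 = (w - z) (1 - conj z * w) / w]. The factor [w - z] cancels and leaves
    a function of [w] that is holomorphic on the closed disc and zero at 0. *)
Lemma pk_circleE z w : cmod z < 1 -> cmod w = 1 -> (pk z w)%:C * (w - z) = (1 - cmod z ^+ 2)%:C * w / (1 - z^*%C * w).
Proof.
move=> z1 w1; have w0 : w != 0 by rewrite -cmod_gt0 w1.
have wz0 := sub_circle_neq0 z1 w1.
have e : (cmod (w - z) ^+ 2)%:C = (w - z) * ((1 - z^*%C * w) / w).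
  rewrite -mul_conjc rmorphB /=; congr (_ * _).
  by rewrite mulrBl mul1r mulfK// -conjc_unit.
have n0 : 1 - z^*%C * w != 0 by apply: one_sub_conj_neq0; rewrite ?w1.
rewrite /pk rmorphM /= fmorphV /= e.
by field; rewrite w0 n0 wz0.
Qed.

Lemma pk_cayley z w : cmod w = 1 -> pk z w = Re ((1 + z^*%C * w) / (1 - z^*%C * w)).
Proof.
move=> w1; have w0 : w != 0 by rewrite -cmod_gt0 w1.
rewrite Re_cayley cmod1 expr1n cmodM cmod_conj w1 mulr1 /pk; congr (_ / _ ^+ 2).
have -> : 1 - z^*%C * w = (w - z)^*%C * w by rewrite rmorphB /= mulrBl (conjc_unit w1) mulVf.
by rewrite cmodM w1 mulr1 cmod_conj.
Qed.

(** The kernel times [Re f] coincides on the circle with the real part of another rational function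
    without poles in the closed disc, so the mean value property applies to the latter. *)
Lemma poisson_rat (Q E : {poly R[i]}) z : cmod z < 1 ->
  (forall w, cmod w <= 1 -> E.[w] != 0) ->
  leb.-integrable I01 (EFin \o (fun t => pk z (expi t) * Re (Q.[expi t] / E.[expi t]))) /\
  \int[leb]_(t in I01) (pk z (expi t) * Re (Q.[expi t] / E.[expi t])) = Re (Q.[z] / E.[z]).
Proof.
move=> z1 hE; set fz := Q.[z] / E.[z].
have Ez : E.[z] != 0 by apply: hE; exact: ltW.
have [K hK] : exists K, Q - fz *: E = ('X - z%:P) * K.
  have /factor_theorem [K h] : root (Q - fz *: E) z by rewrite rootE !hornerE divfK// subrr.
  by exists K; rewrite mulrC.
(* Split [f(w) = f(z) + (w - z) K(w) / E(w)]. The constant is multiplied by the kernel through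
   [pk_cayley], the rest through [pk_circleE]. At [w = 0] only [Re fz] survives. *)
pose Q' : {poly R[i]} := (Re fz)%:C *: ((1%:P + z^*%C *: 'X) * E) + (1 - cmod z ^+ 2)%:C *: ('X * K).
pose E' : {poly R[i]} := (1%:P - z^*%C *: 'X) * E.
have hE' w : cmod w <= 1 -> E'.[w] != 0.
  by move=> w1; rewrite !hornerE mulf_neq0 ?hE// one_sub_conj_neq0.
have [i1 i2] := mean_value_rat Q' hE'.
have eqf t : pk z (expi t) * Re (Q.[expi t] / E.[expi t]) = Re (Q'.[expi t] / E'.[expi t]).
  set w := expi t; have w1 : cmod w = 1 by exact: cmod_expi.
  have Ew : E.[w] != 0 by apply: hE; rewrite w1.
  have nw : 1 - z^*%C * w != 0 by rewrite one_sub_conj_neq0 ?w1.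
  have -> : Q.[w] / E.[w] = fz + (w - z) * (K.[w] / E.[w]).
    have h : Q.[w] = fz * E.[w] + (w - z) * K.[w].
      by have := congr1 (horner^~ w) hK; rewrite !hornerE => <-; rewrite addrC subrK.
    by rewrite h; field.
  have h1 : pk z w * Re fz = Re ((Re fz)%:C * ((1 + z^*%C * w) / (1 - z^*%C * w))).
    by rewrite ReMl -pk_cayley// mulrC.
  have h2 : pk z w * Re ((w - z) * (K.[w] / E.[w])) =
      Re ((1 - cmod z ^+ 2)%:C * w / (1 - z^*%C * w) * (K.[w] / E.[w])).
    by rewrite -ReMl mulrA pk_circleE.
  rewrite ReD mulrDr h1 h2 -ReD; congr Re.
  rewrite /Q' /E' !(hornerM, hornerD, hornerN, hornerZ, hornerC, hornerX).
  by field; rewrite Ew nw.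
split.
  by move: i1; congr (integrable _ _ _); apply/funext => t /=; rewrite eqf.
have E0 : E.[0] != 0 by apply: hE; rewrite cmod0.
rewrite (eq_int01 eqf) i2 /Q' /E' !(hornerM, hornerD, hornerN, hornerZ, hornerC, hornerX).
by rewrite !(mulr0, mul0r, addr0, subr0, mul1r) mulfK.
Qed.

Lemma pk_mass z : cmod z < 1 ->
  (\int[leb]_(t in I01) (pk z (expi t))%:E = 1)%E.
Proof.
move=> z1; have h w : cmod w <= 1 -> (1 : {poly R[i]}).[w] != 0 by rewrite hornerC oner_neq0.
have [i1] := poisson_rat 1 z1 h; rewrite !hornerC divr1 /= => i2.
have e t : pk z (expi t) * Re ((1 : {poly R[i]}).[expi t] / (1 : {poly R[i]}).[expi t]) = pk z (expi t).
  by rewrite !hornerC divr1 mulr1.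
rewrite (eq_int01 e) /Rintegral in i2.
rewrite -[LHS]fineK ?i2//; apply: integrable_fin_num; first exact: measurable_unit_int.
by move: i1; congr (integrable _ _ _); apply/funext => t /=; rewrite e.
Qed.

Lemma measurable_pk d (T : measurableType d) (f g : T -> R[i]) :
  cmeasurable f -> cmeasurable g -> measurable_fun setT (fun x => pk (f x) (g x)).
Proof.
move=> mf mg; apply: measurable_fun_div.
  by apply: measurable_funB => //; exact: measurable_cmod_sqr.
by apply: measurable_cmod_sqr; exact: cmeasurableB.
Qed.

End PoissonFormula.

(** * A measurable inverse of the parametrisation of the circle *)

Section Angle.
Variable R : realType.
Local Notation Re := complex.Re.
Local Notation Im := complex.Im.
Local Notation leb := (@lebesgue_measure R).
Local Notation I01 := (@unit_int R).

(* Outside [-1, 1] the value of [acos] is a junk choice, hence the truncation. *)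
Definition tacos (x : R) : R :=
  if (-1 < x) && (x < 1) then acos x else if x < 1 then pi else 0.

Lemma tacosE x : -1 <= x <= 1 -> tacos x = acos x.
Proof.
case/andP; rewrite /tacos !le_eqVlt => /orP[/eqP <- _|->].
  by rewrite ltxx /= -subr_gt0 opprK addr_gt0// acosN1.
by case/orP => [/eqP ->|-> //]; rewrite ltxx /= acos1.
Qed.

Lemma measurable_tacos : measurable_fun setT tacos.
Proof.
have ml (a : R) : measurable_fun setT (fun x : R => x < a).
  exact: measurable_fun_ltr.
have mg (a : R) : measurable_fun setT (fun x : R => a < x).
  exact: measurable_fun_ltr.
apply: measurable_fun_if => //.
- exact: measurable_and.
- rewrite setTI (_ : _ @^-1` _ = `]-1, 1[%classic); last first.
    by apply/seteqP; split => x /=; rewrite in_itv.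
  apply: subspace_continuous_measurable_fun => //.
  apply: continuous_in_subspaceT => x /[!inE] /=; rewrite in_itv /= => h.
  exact: continuous_acos.
- apply: measurable_funTS; apply: measurable_fun_ifT => //; exact: measurable_cst.
Qed.

(** The inverse of [expi] with values in [[0, 1)]. Real points belong to the first branch, so that
    the point 1 gets the angle 0 and not 1. *)
Definition ang (w : R[i]) : R :=
  if 0 <= Im w then tacos (Re w) / (2 * pi) else 1 - tacos (Re w) / (2 * pi).

Let pi2 : 0 < 2 * pi :> R. Proof. by rewrite mulr_gt0// pi_gt0. Qed.

Lemma Re_circle (w : R[i]) : cmod w = 1 -> -1 <= Re w <= 1.
Proof. by move=> w1; rewrite -ler_norml -w1 Re_le_cmod. Qed.

Lemma expi_ang (w : R[i]) : cmod w = 1 -> expi (ang w) = w.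
Proof.
move=> w1; have rw := Re_circle w1.
have c : cos (acos (Re w)) = Re w by rewrite acosK ?in_itv.
have s : sin (acos (Re w)) = `|Im w|.
  rewrite sin_acos// -sqrtr_sqr; congr Num.sqrt.
  by rewrite -(expr1n _ 2) -w1 cmod_sqr; ring.
rewrite /ang tacosE//; case: ifPn => [i0|]; last rewrite -ltNge => i0.
  rewrite /expi mulrCA divff ?gt_eqF// mulr1 c s ger0_norm//; by case: (w).
rewrite /expi mulrBr mulr1 mulrCA divff ?gt_eqF// mulr1 addrC mulr_natl.
by rewrite sinD2pi cosD2pi sinN cosN c s ltr0_norm// opprK; case: (w).
Qed.

Lemma ang_unit_int (w : R[i]) : cmod w = 1 -> I01 (ang w).
Proof.
move=> w1; have rw := Re_circle w1; rewrite /unit_int /= /ang tacosE//.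
have a0 := acos_ge0 rw; have ap := acos_lepi rw.
case: ifPn => [i0|]; last rewrite -ltNge => i0.
  rewrite divr_ge0 ?(ltW pi2)//= ltr_pdivrMr// mul1r.
  by rewrite (le_lt_trans ap)// ltr_pMl ?pi_gt0// ltr1n.
(* Strictness keeps the angle below 1: in the open lower half plane [Re w] cannot be 1. *)
have a1 : 0 < acos (Re w).
  apply: acos_gt0; case/andP: rw => -> r1 /=; rewrite lt_neqAle r1 andbT.
  apply/eqP => r2; move: i0; have := cmod_sqr w; rewrite w1 r2 expr1n => /eqP.
  by rewrite -subr_eq0 opprD addrA subrr sub0r oppr_eq0 sqrf_eq0 => /eqP ->; rewrite ltxx.
rewrite subr_ge0 ler_pdivrMr// mul1r ltrBlDr ltrDl divr_gt0// andbT.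
by rewrite (le_trans ap)// ler_pMl ?pi_gt0// ler1n.
Qed.

Lemma ang_expi (t : R) : I01 t -> ang (expi t) = t.
Proof.
move=> /andP[t0 t1]; have pg := pi_gt0 R; rewrite /ang tacosE ?Re_circle ?cmod_expi//=.
have [th|th] := leP t (1 / 2).
  have h : 0 <= 2 * pi * t <= pi.
    by rewrite mulr_ge0 ?(ltW pi2)//=; nra.
  rewrite sin_ge0_pi// (cosK (x := 2 * pi * t)) ?in_itv//.
  by rewrite mulrAC divff ?mul1r// gt_eqF.
have e : 2 * pi * t = - (2 * pi * (1 - t)) + pi *+ 2 by rewrite -mulr_natl; ring.
have h : 0 < 2 * pi * (1 - t) < pi by apply/andP; split; nra.
rewrite e sinD2pi cosD2pi sinN cosN oppr_ge0 leNgt sin_gt0_pi//= cosK; last first.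
  by rewrite in_itv /=; case/andP: h => h1 h2; rewrite !ltW.
by rewrite mulrAC divff ?gt_eqF// mul1r opprB addrC subrK.
Qed.

Lemma measurable_ang d (T : measurableType d) (f : T -> R[i]) : cmeasurable f ->
  measurable_fun setT (fun x => ang (f x)).
Proof.
move=> [fr fi].
have mt : measurable_fun setT (fun x => tacos (Re (f x)) / (2 * pi)).
  by apply: measurable_funM => //; exact: (measurableT_comp measurable_tacos).
apply: measurable_fun_ifT => //.
  exact: measurable_fun_ler.
exact: measurable_funB.
Qed.

Lemma circle_roots_negligible (q : {poly R[i]}) : q != 0 ->
  exists2 N : set R, measurable N /\ leb N = 0%E & forall t, I01 t -> q.[expi t] = 0 -> N t.
Proof.
move=> q0; have [rs rsE] := closed_field_poly_normal q.
exists [set` [seq ang a | a <- rs]].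
  have fs : finite_set [set` [seq ang a | a <- rs]] by exact: finite_seq.
  split; first by apply: countable_measurable => //; exact: finite_set_countable.
  by apply: countable_lebesgue_measure0; exact: finite_set_countable.
move=> t tI qt; apply/mapP; exists (expi t); last by rewrite ang_expi.
have : root q (expi t) by apply/eqP.
by rewrite rsE rootZ ?lead_coef_eq0// root_prod_XsubC.
Qed.

End Angle.

(** * Boundary zeros of rational functions *)

Section PolynomialEstimates.
Variable R : realType.
Local Notation Re := complex.Re.
Local Notation Im := complex.Im.
Implicit Types (q : {poly R[i]}) (z w tau omega : R[i]).

Lemma horner_lipschitz q w : exists2 L : R, 0 <= L &
  forall z, cmod z <= 1 -> cmod (q.[z] - q.[w]) <= L * cmod (z - w).
Proof.
have [q1 h] := poly_expand1 q w; have [L L0 hL] := cmod_poly_le 1 q1.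
exists L => // z z1.
have -> : q.[z] - q.[w] = (z - w) * q1.[z].
  by rewrite {1}h !hornerE addrC addKr.
by rewrite cmodM mulrC ler_wpM2r ?cmod_ge0// hL.
Qed.

(** The point [z] is approached by [(1 - r) z]; Lipschitz bounds make the loss linear in [r]. *)
Lemma disc_le_closure q1 q2 : (forall z, cmod z < 1 -> cmod q1.[z] <= cmod q2.[z]) ->
  forall z, cmod z <= 1 -> cmod q1.[z] <= cmod q2.[z].
Proof.
move=> h z z1.
have [L1 L10 h1] := horner_lipschitz q1 z; have [L2 L20 h2] := horner_lipschitz q2 z.
rewrite -subr_ge0; apply: (@ge0_of_affine _ _ (L1 + L2) 1) => // r /andP[r0 r1].
pose w := (1 - r)%:C * z.
have wE : cmod (w - z) = r * cmod z.
  have -> : w - z = (- r)%:C * z by rewrite /w rmorphB rmorphN /= rmorph1; ring.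
  by rewrite cmodM cmod_real normrN ger0_norm// ltW.
have wr : cmod (w - z) <= r by rewrite wE ler_piMr// ltW.
have w1 : cmod w < 1.
  rewrite cmodM cmod_real ger0_norm ?subr_ge0 ?(ltW r1)//.
  by rewrite (@le_lt_trans _ _ (1 - r))// ?ler_piMr ?subr_ge0 ?(ltW r1)// ltrBlDr ltrDl.
have := h1 w (ltW w1); have := h2 w (ltW w1); have := h w w1.
have t1 : cmod q1.[z] - cmod q1.[w] <= cmod (q1.[w] - q1.[z]) by rewrite cmodBC cmod_sub_ge.
have t2 := cmod_sub_ge q2.[w] q2.[z].
have : L1 * cmod (w - z) <= L1 * r by rewrite ler_wpM2l.
have : L2 * cmod (w - z) <= L2 * r by rewrite ler_wpM2l.
by rewrite mulrDl; lra.
Qed.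

(** In place of compactness, [1 / q] is compared with a polynomial within distance 1 of it on the
    disc. *)
Lemma inv_poly_bound q : (forall z, cmod z <= 1 -> q.[z] != 0) ->
  exists2 B : R, 0 <= B & forall z, cmod z <= 1 -> cmod q.[z]^-1 <= B.
Proof.
move=> hq; have [r hr] := disc_approx_rat 1 hq (e := 1) ltr01.
have [B B0 hB] := cmod_poly_le 1 r.
exists (1 + B); first by rewrite addr_ge0.
move=> z z1; have := hr z z1; rewrite hornerC mul1r => h.
by rewrite -[X in cmod X](subrK r.[z]) (le_trans (cmodD _ _))// lerD// hB.
Qed.

(* Approaching [tau] from inside the disc along the direction [- tau * omega]. *)
Lemma directional_ge (G S : R[i] -> R[i]) tau g (B c : R) omega :
  cmod tau = 1 -> 0 < Re omega ->
  (forall z, cmod z <= 1 -> G z = (z - tau) * (g + (z - tau) * S z)) ->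
  (forall z, cmod z <= 1 -> cmod (S z) <= B) ->
  (forall r : R, 0 < r -> r < 1 -> cmod (tau * (1 - r%:C * omega)) < 1 ->
     c * r <= Re (G (tau * (1 - r%:C * omega)))) ->
  c <= Re (- tau * omega * g).
Proof.
move=> t1 o0 hG hS hc; rewrite -subr_ge0.
have on : 0 < cmod omega by apply: lt_le_trans o0 (Re_le omega).
(* The slope bounds the second-order remainder. The point [tau * (1 - r * omega)] lies in the disc
   exactly when [0 < r < 2 * Re omega / |omega|^2], which gives the range of [r]. *)
apply: (@ge0_of_affine _ _ (cmod omega ^+ 2 * B)
  (Num.min 1 (2 * Re omega / cmod omega ^+ 2))).
  by rewrite lt_min ltr01 divr_gt0 ?mulr_gt0 ?exprn_gt0.
move=> r /andP[r0]; rewrite lt_min => /andP[r1 rd].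
pose z := tau * (1 - r%:C * omega).
have z1 : cmod z < 1.
  rewrite cmodM t1 mul1r -(@ltr_pXn2r _ 2)// ?nnegrE ?cmod_ge0//.
  rewrite expr1n cmod_sqr; move: rd; rewrite ltr_pdivlMr ?exprn_gt0// cmod_sqr.
  case: (omega) => a b /=; rewrite !mul0r !addr0 ?subr0 sub0r => rd.
  have : r * (r * (a ^+ 2 + b ^+ 2)) < r * (2 * a) by rewrite ltr_pM2l.
  by nra.
have := hc r r0 r1 z1; rewrite -/z (hG _ (ltW z1)).
have zt : z - tau = - tau * omega * r%:C by rewrite /z; ring.
have -> : (z - tau) * (g + (z - tau) * S z) =
    r%:C * (- tau * omega * g) + (r ^+ 2)%:C * ((tau * omega) ^+ 2 * S z).
  by rewrite zt rmorphXn /=; ring.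
rewrite ReD !ReMl => h.
have hS' : Re ((tau * omega) ^+ 2 * S z) <= cmod omega ^+ 2 * B.
  rewrite (le_trans (Re_le _))// cmodM cmodX cmodM t1 mul1r ler_wpM2l ?sqr_ge0//.
  by rewrite hS// ltW.
rewrite -(pmulr_rge0 _ r0).
have : r ^+ 2 * Re ((tau * omega) ^+ 2 * S z) <= r ^+ 2 * (cmod omega ^+ 2 * B).
  by rewrite ler_wpM2l ?sqr_ge0.
by lra.
Qed.

Lemma real_of_halfplane (x : R[i]) : (forall omega, 0 < Re omega -> 0 <= Re (omega * x)) ->
  Im x = 0.
Proof.
case: x => a b h /=; apply/eqP; apply/negPn/negP => b0.
(* The imaginary part is chosen so that the product with [x] has real part [a - (a + 1) = -1]. *)
have := h (1 +i* ((a + 1) / b)) ltr01; rewrite /= mul1r divfK// opprD addrA subrr sub0r.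
by rewrite oppr_ge0 ler10.
Qed.


(* The lower bound is Hopf's lemma, obtained from Harnack's inequality for [A / P]. *)
Lemma boundary_zero_derivative (A P : {poly R[i]}) tau : cmod tau = 1 ->
  (forall z, cmod z <= 1 -> P.[z] != 0) -> A.[tau] = 0 ->
  (forall z, cmod z <= 1 -> 0 <= Re (A.[z] / P.[z])) ->
  Im (- tau * (A^`().[tau] / P.[tau])) = 0 /\
  Re (A.[0] / P.[0]) / 2 <= Re (- tau * (A^`().[tau] / P.[tau])).
Proof.
move=> t1 hP At hA.
have [A2 eA] := poly_expand2 A tau; have [P1 eP] := poly_expand1 P tau.
have Pt : P.[tau] != 0 by apply: hP; rewrite t1.
(* The remainder after the linear term in the expansion of the quotient [A / P] at [tau]. *)
pose S z := (A2 * P.[tau]%:P - A^`().[tau] *: P1).[z] / (P.[z] * P.[tau]).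
have [B1 B10 hB1] := cmod_poly_le 1 (A2 * P.[tau]%:P - A^`().[tau] *: P1).
have [B2 B20 hB2] := inv_poly_bound hP.
have hS z : cmod z <= 1 -> cmod (S z) <= B1 * (B2 * cmod P.[tau]^-1).
  move=> z1; rewrite cmodM ler_pM ?cmod_ge0 ?hB1//.
  by rewrite invfM cmodM ler_wpM2r ?cmod_ge0// hB2.
have hG z : cmod z <= 1 -> A.[z] / P.[z] = (z - tau) * (A^`().[tau] / P.[tau] + (z - tau) * S z).
  move=> z1; have Pz := hP z z1.
  have hAz : A.[z] = (z - tau) * (A^`().[tau] + (z - tau) * A2.[z]).
    by rewrite {1}eA At !(hornerM, hornerD, hornerN, hornerC, hornerX) add0r.
  have hPz : P.[z] = P.[tau] + (z - tau) * P1.[z].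
    by rewrite {1}eP !(hornerM, hornerD, hornerN, hornerC, hornerX).
  rewrite hAz /S !(hornerM, hornerD, hornerN, hornerZ, hornerC).
  apply: (mulIf Pz); rewrite divfK//.
  have -> : (z - tau) * (A^`().[tau] / P.[tau] + (z - tau) *
     ((A2.[z] * P.[tau] - A^`().[tau] * P1.[z]) / (P.[z] * P.[tau]))) * P.[z] =
     (z - tau) * (A^`().[tau] * P.[z] + (z - tau) *
     (A2.[z] * P.[tau] - A^`().[tau] * P1.[z])) / P.[tau] by field; rewrite Pz Pt.
  by rewrite hPz; field.
split.
  apply: real_of_halfplane => omega o0.
  have -> : omega * (- tau * (A^`().[tau] / P.[tau])) = - tau * omega * (A^`().[tau] / P.[tau]).
    by ring.
  by apply: (directional_ge t1 o0 hG hS) => r r0 _ z1; rewrite mul0r hA// ltW.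
(* Radial approach: at distance [r] from [tau] the kernel is at least [r / (2 - r) >= r / 2], and
   the mean of [Re (A / P)] over the circle is its value at 0. *)
have := directional_ge (c := Re (A.[0] / P.[0]) / 2) (omega := 1) t1 ltr01 hG hS.
rewrite mulr1; apply => r r0 r1; rewrite mulr1.
set z := tau * _ => z1.
have [i1 <-] := poisson_rat A z1 hP.
have [i2 m2] := mean_value_rat A hP.
have zE : cmod z = 1 - r.
  by rewrite cmodM t1 mul1r -(rmorph1 (real_complex R)) -rmorphB cmod_real ger0_norm// subr_ge0 ltW.
have -> : Re (A.[0] / P.[0]) / 2 * r = r / 2 * Re (A.[0] / P.[0]) by ring.
rewrite -m2 -RintegralZl//; last exact: measurable_unit_int.
apply: le_Rintegral => //; first exact: measurable_unit_int.
  have := integrableZl (@measurable_unit_int R) (r / 2) i2.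
  by congr (integrable _ _ _); apply/funext => t /=.
move=> t _; apply: ler_wpM2r; first by rewrite hA// cmod_expi.
apply: le_trans (pk_ge z1 (cmod_expi t)); rewrite zE.
by rewrite ler_pdivlMr; [nra|lra].
Qed.

Section Reflection.
Variable n : nat.

(** The operator [z d/dz] multiplies the coefficient of index [k] by [k], and reflection exchanges
    [k] with [n - k]. *)
Lemma refl_deriv q : refl n ('X * q^`()) = n%:R *: refl n q - 'X * (refl n q)^`().
Proof.
apply/polyP => j.
rewrite /refl coefB coefZ coefXM coef_deriv !coef_poly coefXM coef_deriv.
case: j => [|j] /=.
  rewrite !subn0 subr0; case: n => [|m]; first by rewrite eqxx rmorph0 mul0r.
  by rewrite /= raddfMn /= mulr_natl.
case: ifP => jn; last by rewrite mul0rn mulr0 subrr.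
have [m hm] : exists m, n = (m + j.+1)%N by exists (n - j.+1)%N; rewrite subnK.
rewrite hm addnK; case: m hm => [|m] hm.
  by rewrite add0n eqxx rmorph0 mulr_natl subrr.
by rewrite /= raddfMn /= natrD mulrDl !mulr_natl addrK.
Qed.

Lemma horner_refl_deriv q tau : (size q <= n.+1)%N -> cmod tau = 1 ->
  tau * (refl n q)^`().[tau] = n%:R * (refl n q).[tau] - tau ^+ n * (tau * q^`().[tau])^*%C.
Proof.
move=> sq t1.
have sq' : (size ('X * q^`())%R <= n.+1)%N.
  have [->|q0] := eqVneq q^`() 0; first by rewrite mulr0 size_poly0.
  rewrite -commr_polyX size_mulX//; apply: leq_trans sq.
  rewrite lt_size_deriv//; apply: contra_neq q0 => ->; exact: deriv0.
have := horner_refl sq' t1; rewrite refl_deriv.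
rewrite !(hornerM, hornerD, hornerN, hornerZ, hornerX) => <-.
by rewrite opprB addrC subrK.
Qed.

End Reflection.
End PolynomialEstimates.

(** * Stable pairs of polynomials *)

Section StablePair.
Variables (R : realType) (n : nat) (p1 p2 : {poly R[i]}).
Local Notation Re := complex.Re.
Local Notation Im := complex.Im.
Local Notation q1 := (refl n p1).
Local Notation q2 := (refl n p2).
Implicit Types (z w tau alpha beta : R[i]).

Definition clark_num alpha : {poly R[i]} := q1 - alpha *: p2.
Definition clark_den alpha : {poly R[i]} := alpha *: p1 - q2.

Hypothesis size_p1 : (size p1 <= n.+1)%N.
Hypothesis size_p2 : (size p2 <= n.+1)%N.
Hypothesis stable : forall z1 z2, cmod z1 < 1 -> cmod z2 < 1 -> peval p1 p2 z1 z2 != 0.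
Hypothesis q1_neq0 : q1 != 0.
Hypothesis coprime_pq : no_common_factor (poly2 p1 p2) (poly2 q2 q1).

Lemma stable_p1_disc z : cmod z < 1 -> p1.[z] != 0.
Proof.
by move=> z1; have := stable z1 (z2 := 0); rewrite /peval mul0r addr0 cmod0; apply.
Qed.

(** If [|p2| > |p1|] at a point of the open disc, then [z2 = - p1 / p2] is a zero of [p] in the
    bidisc. *)
Lemma stable_le z : cmod z <= 1 -> cmod p2.[z] <= cmod p1.[z].
Proof.
move: z; apply: disc_le_closure => z z1; rewrite leNgt; apply/negP => lt12.
have p20 : p2.[z] != 0 by rewrite -cmod_gt0 (le_lt_trans (cmod_ge0 _) lt12).
have := stable z1 (z2 := - p1.[z] / p2.[z]).
rewrite /peval divfK// addrN eqxx cmod_div cmodN ltr_pdivrMr ?cmod_gt0// mul1r.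
by move=> /(_ lt12).
Qed.

(** A common zero on the circle is also a zero of both reflections, so [z1 - tau] would divide [p]
    and [p~]. *)
Lemma no_common_circle_zero tau : cmod tau = 1 -> p1.[tau] = 0 -> p2.[tau] != 0.
Proof.
move=> t1 z1; apply/eqP => z2.
have fac (r : {poly R[i]}) : r.[tau] = 0 -> exists s, r = ('X - tau%:P) * s.
    by move=> r0; have /factor_theorem [s ->] : root r tau by [apply/eqP]; exists s; rewrite mulrC.
have [a1 e1] := fac _ z1; have [a2 e2] := fac _ z2.
have [b1 f1] : exists s, q1 = ('X - tau%:P) * s.
  by apply: fac; rewrite horner_refl// z1 rmorph0 mulr0.
have [b2 f2] : exists s, q2 = ('X - tau%:P) * s.
  by apply: fac; rewrite horner_refl// z2 rmorph0 mulr0.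
have := @coprime_pq ('X - tau%:P)%:P (a1%:P + 'X * a2%:P) (b2%:P + 'X * b1%:P).
case.
- by rewrite /poly2 e1 e2 !polyCM; ring.
- by rewrite /poly2 f1 f2 !polyCM; ring.
move=> c /polyC_inj h; have := size_XsubC tau; rewrite h => hs.
by have := size_polyC_leq1 c; rewrite hs.
Qed.

Lemma stable_p1_neq0 z : cmod z <= 1 -> p1.[z] != 0.
Proof.
rewrite le_eqVlt => /orP[/eqP z1|]; last exact: stable_p1_disc.
apply/eqP => p10; have := no_common_circle_zero z1 p10.
have := stable_le (z := z); rewrite z1 lexx p10 cmod0 => /(_ isT) h.
by rewrite -cmod_gt0 ltNge h.
Qed.

(** Otherwise write [p1 = a g] and [p2 = b g] with [a], [b] coprime; then [q2 = k a] and [q1 = k b],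
    so [a + z2 b] divides both [p] and [p~]. It must be constant, hence [b = 0] and [q1 = 0]. *)
Lemma clark_det_neq0 : p1 * q1 - p2 * q2 != 0.
Proof.
apply/eqP => /eqP; rewrite subr_eq0 => /eqP e.
have p10 : p1 != 0.
  by apply/eqP => h; have := @stable_p1_disc 0; rewrite cmod0 ltr01 h horner0 eqxx => /(_ isT).
pose g := gcdp p1 p2.
have g0 : g != 0 by rewrite gcdp_eq0 negb_and p10.
pose a := p1 %/ g; pose b := p2 %/ g.
have ea : p1 = a * g by rewrite divpK// dvdp_gcdl.
have eb : p2 = b * g by rewrite divpK// dvdp_gcdr.
have a0 : a != 0 by apply: contra_neq p10 => h; rewrite ea h mul0r.
have cab : coprimep a b by apply: coprimep_div_gcd; rewrite p10.
have e' : a * q1 = b * q2.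
  by apply: (mulfI g0); rewrite !mulrA ![g * _]mulrC -ea -eb.
have [k ek] : exists k, q2 = k * a.
  apply/dvdpP; rewrite -(Gauss_dvdpr _ cab) -e'.
  exact: dvdp_mulr.
have ek1 : q1 = k * b by apply: (mulfI a0); rewrite e' ek; ring.
have := @coprime_pq (a%:P + 'X * b%:P) g%:P k%:P.
case.
- by rewrite /poly2 ea eb !polyCM; ring.
- by rewrite /poly2 ek ek1 !polyCM; ring.
move=> c /(congr1 (fun r : {poly {poly R[i]}} => r`_1)).
rewrite coefD coefXM !coefC /= add0r => b0.
by move: q1_neq0; rewrite ek1 b0 mulr0 eqxx.
Qed.

Lemma clark_num_circle alpha z : cmod alpha = 1 -> cmod z = 1 ->
  (clark_num alpha).[z] = alpha * z ^+ n * ((clark_den alpha).[z])^*%C.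
Proof.
move=> a1 z1; have a0 : alpha != 0 by rewrite -cmod_gt0 a1.
have z0 : z != 0 by rewrite -cmod_gt0 z1.
rewrite /clark_num /clark_den !(hornerD, hornerN, hornerZ) !horner_refl//.
rewrite rmorphB !rmorphM rmorphXn /= (conjc_unit a1) (conjc_unit z1).
have -> : (p2.[z])^*%C^*%C = p2.[z] by exact: conjcK.
by rewrite exprVn; field; rewrite a0 expf_neq0.
Qed.

Lemma cmod_clark_num alpha z : cmod alpha = 1 -> cmod z = 1 ->
  cmod (clark_num alpha).[z] = cmod (clark_den alpha).[z].
Proof.
by move=> a1 z1; rewrite clark_num_circle// !cmodM cmodX a1 z1 expr1n !mul1r cmod_conj.
Qed.

Lemma clark_detE alpha :
  p1 * q1 - p2 * q2 = p1 * clark_num alpha + p2 * clark_den alpha.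
Proof. by rewrite /clark_num /clark_den -!mul_polyC; ring. Qed.

Lemma clark_num_neq0 alpha : cmod alpha = 1 -> clark_num alpha != 0.
Proof.
move=> a1; apply/eqP => N0; move: clark_det_neq0; rewrite (clark_detE alpha) N0 mulr0 add0r.
suff -> : clark_den alpha = 0 by rewrite mulr0 eqxx.
(* From [|D| = |N| = 0] on the circle, a nonzero [D] would have a root set of full measure there. *)
apply/eqP; apply: contraT => D0; have [S [mS S0] hS] := circle_roots_negligible D0.
have : (lebesgue_measure (@unit_int R) <= lebesgue_measure S)%E.
  apply: le_measure; rewrite ?inE//; first exact: measurable_unit_int.
  move=> t tI; apply: hS => //; apply/eqP.
  by rewrite -cmod_eq0 -(cmod_clark_num a1 (cmod_expi t)) N0 horner0 cmod0.
by rewrite S0 lebesgue_unit_int lee_fin ler10.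
Qed.

Section BoundaryPoint.
Variables (beta tau : R[i]).
Hypothesis beta1 : cmod beta = 1.
Hypothesis tau1 : cmod tau = 1.
Hypothesis num0 : (clark_num beta).[tau] = 0.

Lemma boundary_den0 : (clark_den beta).[tau] = 0.
Proof. by apply/eqP; rewrite -cmod_eq0 -cmod_clark_num// num0 cmod0. Qed.

Lemma boundary_q1 : q1.[tau] = beta * p2.[tau].
Proof. by apply/eqP; rewrite -subr_eq0 -hornerZ -hornerN -hornerD; apply/eqP. Qed.

Lemma boundary_q2 : q2.[tau] = beta * p1.[tau].
Proof.
by apply/esym/eqP; rewrite -subr_eq0 -hornerZ -hornerN -hornerD; apply/eqP; exact: boundary_den0.
Qed.

Lemma boundary_cmod : cmod p1.[tau] = cmod p2.[tau].
Proof.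
have := congr1 (@cmod R) boundary_q1.
by rewrite horner_refl// !cmodM cmodX tau1 expr1n mul1r cmod_conj beta1 mul1r.
Qed.

Lemma boundary_p1_neq0 : p1.[tau] != 0.
Proof. by apply: stable_p1_neq0; rewrite tau1. Qed.

Lemma boundary_p2_neq0 : p2.[tau] != 0.
Proof. by rewrite -cmod_eq0 -boundary_cmod cmod_eq0 boundary_p1_neq0. Qed.

(* Equivalently, [p1 q1 - p2 q2 = z^n (|p1|^2 - |p2|^2)] has a double zero at [tau]. *)
Lemma boundary_deriv :
  p2.[tau] * (clark_den beta)^`().[tau] + p1.[tau] * (clark_num beta)^`().[tau] = 0.
Proof.
have t0 : tau != 0 by rewrite -cmod_gt0 tau1.
have u0 := boundary_p1_neq0; have v0 := boundary_p2_neq0.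
set u := p1.[tau] in u0 *; set v := p2.[tau] in v0 *.
set a := p1^`().[tau]; set b := p2^`().[tau].
have uv : u * u^*%C = v * v^*%C by rewrite !mul_conjc boundary_cmod.
have hu : beta * v = tau ^+ n * u^*%C by rewrite -boundary_q1 horner_refl.
have hv : beta * u = tau ^+ n * v^*%C by rewrite -boundary_q2 horner_refl.
(* [A / p1 = 1 - (u / v) (p2 / p1)] vanishes at [tau] and has nonnegative real part, because
   [|u / v| = 1] and [|p2| <= |p1|]. *)
pose A := p1 - (u / v) *: p2.
have [y0 _] : Im (- tau * (A^`().[tau] / p1.[tau])) = 0 /\
    Re (A.[0] / p1.[0]) / 2 <= Re (- tau * (A^`().[tau] / p1.[tau])).
  apply: boundary_zero_derivative => // [z||z z1].
  - exact: stable_p1_neq0.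
  - by rewrite !hornerE divfK// subrr.
  have Pz := stable_p1_neq0 z1.
  have -> : A.[z] / p1.[z] = 1 - u / v * (p2.[z] / p1.[z]).
    by rewrite hornerD hornerN hornerZ; field; rewrite Pz v0.
  rewrite ReD ReN subr_ge0 (le_trans (Re_le _))// cmodM !cmod_div boundary_cmod divff ?cmod_eq0// mul1r.
  by rewrite ler_pdivrMr ?cmod_gt0// mul1r stable_le.
have hy : (- tau * (A^`().[tau] / u))^*%C = - tau * (A^`().[tau] / u).
  by move: y0; rewrite -/u; case: (_ * _) => x y /= ->; rewrite oppr0.
have eA : A^`().[tau] = a - u / v * b.
  by rewrite derivB derivZ hornerD hornerN hornerZ.
(* Exhibits the left side as a product of real numbers. Its invariance under conjugation is what
   cancels the conjugates produced by the derivatives of the reflections. *)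
have key : tau * a * u^*%C - tau * b * v^*%C = - (- tau * (A^`().[tau] / u)) * (u * u^*%C).
  rewrite eA; have -> : - (- tau * ((a - u / v * b) / u)) * (u * u^*%C) =
    tau * a * u^*%C - tau * b * (u * u^*%C) / v by field; rewrite u0 v0.
  by rewrite uv; field.
have key2 : (tau * a * u^*%C - tau * b * v^*%C)^*%C = tau * a * u^*%C - tau * b * v^*%C.
  by rewrite key rmorphM rmorphN /= hy rmorphM /= conjcK [u^*%C * u]mulrC.
move: key2; rewrite rmorphB !rmorphM /= !conjcK => key2.
have d1 := horner_refl_deriv size_p1 tau1; have d2 := horner_refl_deriv size_p2 tau1.
rewrite -/a -/b boundary_q1 boundary_q2 !rmorphM /= -/u -/v in d1 d2.
apply: (mulfI t0); rewrite mulr0.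
rewrite /clark_num /clark_den !derivB !derivZ !hornerD !hornerN !hornerZ -/a -/b.
have -> : tau * (v * (beta * a - q2^`().[tau]) + u * (q1^`().[tau] - beta * b)) =
   tau * a * (beta * v) - v * (tau * q2^`().[tau]) + u * (tau * q1^`().[tau]) - tau * b * (beta * u).
  by ring.
rewrite d1 d2.
have -> : tau * a * (beta * v) - v * (n%:R * (beta * u) - tau ^+ n * (tau^*%C * b^*%C)) +
   u * (n%:R * (beta * v) - tau ^+ n * (tau^*%C * a^*%C)) - tau * b * (beta * u) =
   tau * a * (beta * v) - tau * b * (beta * u) - tau ^+ n * (tau^*%C * a^*%C * u - tau^*%C * b^*%C * v).
  by ring.
by rewrite key2 hu hv; ring.
Qed.

Lemma boundary_den_deriv :
  (clark_den beta)^`().[tau] = - p1.[tau] / p2.[tau] * (clark_num beta)^`().[tau].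
Proof.
have v0 := boundary_p2_neq0; apply: (mulfI v0).
have := boundary_deriv; move/eqP; rewrite addr_eq0 => /eqP ->.
by field.
Qed.

Hypothesis inner0 : forall z, cmod z < 1 -> cmod q2.[z] <= cmod p1.[z].
Hypothesis origin : q2.[0] != beta * p1.[0].

(** Here [x = - tau A'(tau) / p1(tau)] for [A = D / beta]. As [A / p1 = 1 - phi(., 0) / beta] has
    nonnegative real part, positive at the origin, the boundary lemma gives [x > 0]. *)
Lemma boundary_residue : exists2 x : R, 0 < x &
  (clark_num beta)^`().[tau] / p2.[tau] = x%:C * beta / tau.
Proof.
have t0 : tau != 0 by rewrite -cmod_gt0 tau1.
have b0 : beta != 0 by rewrite -cmod_gt0 beta1.
have u0 := boundary_p1_neq0; have v0 := boundary_p2_neq0.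
pose A := beta^-1 *: clark_den beta.
have eA z : cmod z <= 1 -> A.[z] / p1.[z] = 1 - beta^-1 * (q2.[z] / p1.[z]).
  move=> z1; rewrite /A /clark_den !(hornerZ, hornerD, hornerN).
  by field; rewrite b0 stable_p1_neq0.
have le1 z : cmod z <= 1 -> cmod (beta^-1 * (q2.[z] / p1.[z])) <= 1.
  move=> z1; rewrite cmodM cmodV beta1 invr1 mul1r cmod_div.
  by rewrite ler_pdivrMr ?cmod_gt0 ?stable_p1_neq0// mul1r (disc_le_closure inner0).
have [y0 yge] : Im (- tau * (A^`().[tau] / p1.[tau])) = 0 /\
    Re (A.[0] / p1.[0]) / 2 <= Re (- tau * (A^`().[tau] / p1.[tau])).
  apply: boundary_zero_derivative => // [z||z z1].
  - exact: stable_p1_neq0.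
  - by rewrite hornerZ boundary_den0 mulr0.
  by rewrite eA// ReD ReN subr_ge0 (le_trans (Re_le _))// le1.
have v_gt0 : 0 < Re (A.[0] / p1.[0]).
  have c0 : cmod (0 : R[i]) <= 1 by rewrite cmod0.
  rewrite eA// ReD ReN subr_gt0 lt_neqAle (le_trans (Re_le _) (le1 _ c0)) andbT.
  (* A point of the closed disc with real part 1 equals 1, which here would mean
     [q2(0) = beta p1(0)]. *)
  apply: contra origin => /eqP e1; have := le1 _ c0.
  set w := beta^-1 * _ in e1 *; move=> w1.
  have w2 : w = 1.
    have : cmod w ^+ 2 <= 1 by rewrite exprn_ile1 ?cmod_ge0.
    rewrite cmod_sqr; move: e1; rewrite /=; case: (w) => a b /= ->.
    rewrite expr1n gerDl => hb; congr (_ +i* _); apply/eqP.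
    by rewrite -sqrf_eq0 eq_le hb sqr_ge0.
  have p10 := stable_p1_neq0 c0.
  have := congr1 (fun x => x * (beta * p1.[0])) w2; rewrite /w mul1r => <-.
  by apply/eqP; field; rewrite b0 p10.
exists (Re (- tau * (A^`().[tau] / p1.[tau]))).
  by apply: lt_le_trans yge; rewrite divr_gt0.
have -> : (Re (- tau * (A^`().[tau] / p1.[tau])))%:C = - tau * (A^`().[tau] / p1.[tau]).
  by move: y0; case: (_ * _) => x y /= ->.
rewrite derivZ hornerZ boundary_den_deriv.
by field; rewrite t0 b0 u0 v0.
Qed.

End BoundaryPoint.
End StablePair.

(** * Nontangential limits and complex derivatives *)

Section NontangentialLimit.
Variable R : realType.

(** Both limits are tested at one point [((1 - r) zeta1, (1 - r) zeta2)]: its distance from the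
    boundary point and from the torus is [r], so aperture 2 suffices. *)
Lemma nt_limit_unique (F : R[i] -> R[i] -> R[i]) zeta1 zeta2 L L' :
  cmod zeta1 = 1 -> cmod zeta2 = 1 ->
  nt_limit F zeta1 zeta2 L -> nt_limit F zeta1 zeta2 L' -> L = L'.
Proof.
move=> u1 u2 h h'; apply/eqP; rewrite -subr_eq0 -cmod_eq0; apply: contraT => L0.
have Lp : 0 < cmod (L - L') / 2 by rewrite divr_gt0// lt_def L0 cmod_ge0.
have [d [d0 hd]] := h 2 ltac:(by rewrite ltr1n) _ Lp.
have [d' [d'0 hd']] := h' 2 ltac:(by rewrite ltr1n) _ Lp.
pose r := Num.min 1 (Num.min d d') / 2.
have m0 : 0 < Num.min 1 (Num.min d d') by rewrite !lt_min ltr01 d0.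
have r0 : 0 < r by rewrite divr_gt0.
have rm : r < Num.min 1 (Num.min d d') by rewrite /r ltr_pdivrMr// ltr_pMr// ltr1n.
move: rm; rewrite !lt_min => /and3P[r1 rd rd'].
have c1 (zeta : R[i]) : cmod zeta = 1 -> cmod ((1 - r)%:C * zeta) = 1 - r.
  by move=> u; rewrite cmodM u mulr1 cmod_real ger0_norm// subr_ge0 ltW.
have c2 (zeta : R[i]) : cmod zeta = 1 -> cmod ((1 - r)%:C * zeta - zeta) = r.
  move=> u; have -> : (1 - r)%:C * zeta - zeta = (- r)%:C * zeta.
    by rewrite rmorphB rmorphN rmorph1; ring.
  by rewrite cmodM u mulr1 cmod_real normrN ger0_norm// ltW.
have lt1 : 1 - r < 1 by rewrite ltrBlDr ltrDl.
have A := hd ((1 - r)%:C * zeta1) ((1 - r)%:C * zeta2).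
have A' := hd' ((1 - r)%:C * zeta1) ((1 - r)%:C * zeta2).
rewrite !c1// !c2// !maxxx in A A'.
have r2 : r < 2 * (1 - (1 - r)) by rewrite opprB addrC subrK mulr_natl mulr2n ltrDl.
have B := A lt1 lt1 r2 rd; have B' := A' lt1 lt1 r2 rd'.
have : cmod (L - L') < cmod (L - L').
  rewrite {1}(_ : L - L' = - (F ((1 - r)%:C * zeta1) ((1 - r)%:C * zeta2) - L)
     + (F ((1 - r)%:C * zeta1) ((1 - r)%:C * zeta2) - L')); last by ring.
  apply: le_lt_trans (cmodD _ _) _; rewrite cmodN.
  by rewrite -[ltRHS](divfK (x := 2)) ?pnatr_eq0// mulr_natr mulr2n ltrD.
by rewrite ltxx.
Qed.

Lemma is_derive_expansion (f S : R[i] -> R[i]) (tau C : R[i]) (B d : R) : 0 < d -> 0 <= B ->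
  (forall h, cmod h < d -> f (tau + h) - f tau = h * (C + h * S h) /\ cmod (S h) <= B) ->
  is_derive (tau : R[i]^o) 1 (f : R[i]^o -> R[i]^o) C.
Proof.
move=> d0 B0 hf.
have cv : (fun h : R[i]^o => h^-1 *: ((f \o shift tau) (h *: (1 : R[i]^o)) - f tau) : R[i]^o)
    @ (0 : R[i]^o)^' --> (C : R[i]^o).
  apply/cvgrPdist_le => e e0; near=> h.
  have h0 : h != 0 by near: h; exact: nbhs_dnbhs_neq.
  have hd : `|h| < d%:C by near: h; apply: dnbhs0_lt; rewrite ltcR.
  have he : `|h| < e / (B + 1)%:C.
    by near: h; apply: dnbhs0_lt; rewrite divr_gt0// ltcR ltr_wpDl.
  have [] := hf h; first by rewrite -ltcR cmod_norm.
  move=> e1 SB; rewrite /= /shift /GRing.scale /= mulr1 [h + tau]addrC e1.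
  rewrite mulKf// opprD addrA subrr sub0r normrN normrM -(cmod_norm (S h)).
  apply: (@le_trans _ _ (e / (B + 1)%:C * B%:C)).
    by apply: ler_pM => //; [rewrite lecR cmod_ge0|exact: ltW|rewrite lecR].
  have B1 : 0 < (B + 1)%:C by rewrite ltcR ltr_wpDl.
  by rewrite mulrAC ler_pdivrMr// ler_pM2l// lecR lerDl.
by apply: DeriveDef; [apply/cvg_ex; exists C|exact: cvg_lim cv].
Unshelve. all: by end_near.
Qed.

Lemma is_derive_rat (P Q : {poly R[i]}) (tau : R[i]) : Q.[tau] != 0 ->
  is_derive (tau : R[i]^o) 1 ((fun w => P.[w] / Q.[w]) : R[i]^o -> R[i]^o)
    ((P^`().[tau] * Q.[tau] - P.[tau] * Q^`().[tau]) / Q.[tau] ^+ 2).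
Proof.
move=> Q0; set s := Q.[tau] in Q0 *; set p := P.[tau].
(* [P / Q - p / s = M / (s Q)] and [M] vanishes at [tau], so the derivative is [M'(tau) / s^2]. *)
pose M := s *: P - p *: Q.
have [M2 eM] := poly_expand2 M tau; have [Q1 eQ] := poly_expand1 Q tau.
have Mt : M.[tau] = 0 by rewrite /M hornerD hornerN !hornerZ -/s -/p mulrC subrr.
have M't : M^`().[tau] = P^`().[tau] * s - p * Q^`().[tau].
  by rewrite /M derivB !derivZ hornerD hornerN !hornerZ mulrC.
rewrite -M't; set m := M^`().[tau] in eM *.
pose T := s *: M2 - m *: Q1.
have [B1 B10 hB1] := cmod_poly_le (cmod tau + 1) T.
have [B2 B20 hB2] := cmod_poly_le (cmod tau + 1) Q1.
have s0 : 0 < cmod s by rewrite cmod_gt0.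
(* Within this radius [|Q| >= |s| / 2]. *)
pose d := Num.min 1 (cmod s / (2 * (B2 + 1))).
have B21 : 0 < B2 + 1 by rewrite ltr_wpDl.
apply: (@is_derive_expansion _ (fun h => T.[tau + h] / (Q.[tau + h] * s ^+ 2)) tau (m / s ^+ 2)
    (B1 * (2 / cmod s ^+ 3)) d).
- by rewrite lt_min ltr01 divr_gt0// mulr_gt0.
- by rewrite mulr_ge0// divr_ge0// exprn_ge0// cmod_ge0.
move=> h; rewrite lt_min => /andP[h1 h2].
have th : cmod (tau + h) <= cmod tau + 1 by rewrite (le_trans (cmodD _ _))// lerD2l ltW.
have hQ : Q.[tau + h] = s + h * Q1.[tau + h].
  by rewrite {1}eQ !(hornerM, hornerD, hornerN, hornerC, hornerX) addrAC subrr add0r.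
have hM : M.[tau + h] = h * (m + h * M2.[tau + h]).
  by rewrite {1}eM Mt !(hornerM, hornerD, hornerN, hornerC, hornerX) add0r addrAC subrr add0r.
have sm : cmod s / 2 <= cmod Q.[tau + h].
  have : cmod (h * Q1.[tau + h]) <= cmod s / 2.
    rewrite cmodM; apply: (@le_trans _ _ (cmod s / (2 * (B2 + 1)) * (B2 + 1))).
      rewrite ler_pM ?cmod_ge0// ?(ltW h2)// (le_trans (hB2 _ th))// lerDl//.
    by rewrite invfM mulrA divfK// gt_eqF.
  have := cmod_sub_ge s (- (h * Q1.[tau + h])).
  by rewrite opprK -hQ cmodN; lra.
have Qp : 0 < cmod Q.[tau + h] by apply: lt_le_trans sm; rewrite divr_gt0.
have Qh0 : Q.[tau + h] != 0 by rewrite -cmod_gt0.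
split.
  have -> : P.[tau + h] = (M.[tau + h] + p * Q.[tau + h]) / s.
    by rewrite /M hornerD hornerN !hornerZ subrK mulrC mulKf.
  have -> : T.[tau + h] = s * M2.[tau + h] - m * Q1.[tau + h].
    by rewrite /T hornerD hornerN !hornerZ.
  rewrite -/p -/s; apply: (mulIf Qh0); apply: (mulIf Q0); apply: (mulIf Q0).
  have -> : ((M.[tau + h] + p * Q.[tau + h]) / s / Q.[tau + h] - p / s) * Q.[tau + h] * s * s
     = M.[tau + h] * s by field; rewrite Qh0 Q0.
  have -> : h * (m / s ^+ 2 + h * ((s * M2.[tau + h] - m * Q1.[tau + h]) / (Q.[tau + h] * s ^+ 2))) *
     Q.[tau + h] * s * s = h * (m * Q.[tau + h] + h * (s * M2.[tau + h] - m * Q1.[tau + h])).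
    by field; rewrite Qh0 Q0.
  by rewrite hM hQ; ring.
rewrite cmod_div ler_pM ?cmod_ge0 ?invr_ge0 ?cmod_ge0 ?hB1// cmodM cmodX.
rewrite -[leRHS]invf_div lef_pV2 ?posrE ?mulr_gt0 ?divr_gt0 ?exprn_gt0//.
have -> : cmod s ^+ 3 / 2 = cmod s / 2 * cmod s ^+ 2 by ring.
by rewrite ler_pM2r ?exprn_gt0.
Qed.

End NontangentialLimit.

Section BoundaryValues.
Variables (R : realType) (n : nat) (p1 p2 : {poly R[i]}).
Local Notation q1 := (refl n p1).
Local Notation q2 := (refl n p2).
Hypothesis size_p1 : (size p1 <= n.+1)%N.
Hypothesis size_p2 : (size p2 <= n.+1)%N.
Hypothesis stable : forall z1 z2, cmod z1 < 1 -> cmod z2 < 1 -> peval p1 p2 z1 z2 != 0.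
Hypothesis coprime_pq : no_common_factor (poly2 p1 p2) (poly2 q2 q1).
Variables (beta tau : R[i]).
Hypothesis beta1 : cmod beta = 1.
Hypothesis tau1 : cmod tau = 1.
Hypothesis num0 : (clark_num n p1 p2 beta).[tau] = 0.
Local Notation N := (clark_num n p1 p2 beta).
Local Notation D := (clark_den n p1 p2 beta).

(* [D - z2 N] vanishes to second order at the point while [|p| >= (1 - |z2|) |p2|]. *)
Lemma nt_limit_boundary : nt_limit (phi n p1 p2) tau (- p1.[tau] / p2.[tau]) beta.
Proof.
have v0 := boundary_p2_neq0 size_p1 size_p2 stable coprime_pq beta1 tau1 num0.
have D0 := boundary_den0 size_p1 size_p2 beta1 tau1 num0.
have eD := boundary_den_deriv size_p1 size_p2 stable coprime_pq beta1 tau1 num0.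
set lam := - p1.[tau] / p2.[tau] in eD *.
have [N2 eN] := poly_expand2 N tau; have [D2 eDD] := poly_expand2 D tau.
rewrite num0 add0r in eN; rewrite D0 add0r in eDD.
set N' := N^`().[tau] in eN eD.
have [BN BN0 hBN] := cmod_poly_le 1 N2; have [BD BD0 hBD] := cmod_poly_le 1 D2.
have [L L0 hL] := horner_lipschitz p2 tau.
have vp : 0 < cmod p2.[tau] by rewrite cmod_gt0.
pose K := cmod N' + (BD + BN).
have K0 : 0 <= K by rewrite addr_ge0 ?cmod_ge0 ?addr_ge0.
move=> a a1 eps eps0.
have a0 : 0 < a by apply: lt_trans a1.
(* Lower bound [|p| >= k * dl]: near [tau] one has [|p2| >= |p2(tau)| / 2], and the approach region
   gives [1 - |z2| >= dl / a]. *)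
pose k := cmod p2.[tau] / (2 * a).
have k0 : 0 < k by rewrite divr_gt0// mulr_gt0.
exists (Num.min (cmod p2.[tau] / (2 * (L + 1))) (eps * k / (K + 1))).
have L1 : 0 < L + 1 by rewrite ltr_wpDl.
have K1 : 0 < K + 1 by rewrite ltr_wpDl.
split; first by rewrite lt_min !(divr_gt0, mulr_gt0).
move=> z1 z2 c1 c2; set dl := Num.max (cmod (z1 - tau)) _ => ha.
rewrite lt_min => /andP[hd1 hd2].
have d1 : cmod (z1 - tau) <= dl by rewrite le_max lexx.
have d2 : cmod (z2 - lam) <= dl by rewrite le_max lexx orbT.
have dl0 : 0 < dl.
  by apply: lt_le_trans d1; rewrite cmod_gt0 -oppr_eq0 opprB sub_circle_neq0.
have pz : peval p1 p2 z1 z2 != 0 by exact: stable.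
(* The first-order terms combine into [(lam - z2) * N'] because [D'(tau) = lam * N'(tau)]. *)
have num : (phi n p1 p2 z1 z2 - beta) * peval p1 p2 z1 z2 =
    - ((z1 - tau) * ((lam - z2) * N' + (z1 - tau) * (D2.[z1] - z2 * N2.[z1]))).
  rewrite /phi mulrBl divfK//.
  have -> : ptilde n p1 p2 z1 z2 - beta * peval p1 p2 z1 z2 = - (D.[z1] - z2 * N.[z1]).
    by rewrite /ptilde /peval /clark_num /clark_den !(hornerD, hornerN, hornerZ); ring.
  rewrite {1}eDD {1}eN !(hornerM, hornerD, hornerN, hornerC, hornerX) eD; ring.
have up : cmod (phi n p1 p2 z1 z2 - beta) * cmod (peval p1 p2 z1 z2) <= dl * (dl * K).
  rewrite -cmodM num cmodN cmodM ler_pM ?cmod_ge0//.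
  apply: le_trans (cmodD _ _) _; rewrite !cmodM mulrDr lerD//.
    by rewrite ler_wpM2r ?cmod_ge0// cmodBC.
  rewrite ler_pM ?cmod_ge0//; apply: le_trans (cmodB _ _) _.
  rewrite lerD ?hBD ?(ltW c1)// cmodM -[BN]mul1r ler_pM ?cmod_ge0 ?(ltW c2)//.
  by rewrite hBN// ltW.
have lo : dl * k <= cmod (peval p1 p2 z1 z2).
  have g1 : cmod p2.[tau] / 2 <= cmod p2.[z1].
    have := hL z1 (ltW c1); have := cmod_sub_ge p2.[tau] (p2.[tau] - p2.[z1]).
    rewrite (_ : p2.[tau] - (p2.[tau] - p2.[z1]) = p2.[z1]); last by ring.
    rewrite (cmodBC p2.[tau] p2.[z1]).
    have : L * cmod (z1 - tau) <= cmod p2.[tau] / 2.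
      apply: (@le_trans _ _ ((L + 1) * (cmod p2.[tau] / (2 * (L + 1))))).
        rewrite ler_pM ?cmod_ge0 ?lerDl// (le_trans d1)// ltW//.
      by rewrite le_eqVlt; apply/orP; left; apply/eqP; field; rewrite gt_eqF.
    lra.
  have g2 : dl / a <= 1 - cmod z2.
    rewrite ler_pdivrMr// mulrC; apply: le_trans (ltW ha) _.
    by rewrite ler_pM2l// lerD2l lerN2 le_max lexx orbT.
  have g3 : (1 - cmod z2) * cmod p2.[z1] <= cmod (peval p1 p2 z1 z2).
    have := cmod_sub_ge p1.[z1] (- (z2 * p2.[z1])); rewrite opprK cmodN cmodM -/(peval p1 p2 z1 z2).
    have := stable_le stable (ltW c1).
    by rewrite mulrBl mul1r; lra.
  apply: le_trans g3.
  have -> : dl * k = dl / a * (cmod p2.[tau] / 2) by rewrite /k; field; rewrite gt_eqF.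
  rewrite ler_pM ?divr_ge0 ?(ltW dl0) ?(ltW a0) ?cmod_ge0//.
rewrite ltr_pdivlMr// in hd2.
have : cmod (phi n p1 p2 z1 z2 - beta) * (dl * k) <= dl * (dl * K).
  by apply: le_trans up; rewrite ler_wpM2l ?cmod_ge0.
have : dl * K < eps * k by apply: le_lt_trans hd2; rewrite ler_pM2l// lerDl.
move=> h1; rewrite mulrCA ler_pM2l// => h2.
by rewrite -(ltr_pM2r k0) (le_lt_trans h2).
Qed.

(** At [tau] one has [p~ = beta p], so the derivative is that of [p~ - beta p] divided by [p]. With
    [lam = - p1(tau) / p2(tau)] these are [(z2 - lam) N'(tau)] and [(z2 - lam) p2(tau)], and [z2]
    cancels. *)
Lemma is_derive_phi_boundary z2 : z2 != - p1.[tau] / p2.[tau] ->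
  is_derive (tau : R[i]^o) 1 (fun w : R[i]^o => (phi n p1 p2 w z2 : R[i]^o))
    (N^`().[tau] / p2.[tau]).
Proof.
move=> hz.
have v0 := boundary_p2_neq0 size_p1 size_p2 stable coprime_pq beta1 tau1 num0.
have eD := boundary_den_deriv size_p1 size_p2 stable coprime_pq beta1 tau1 num0.
have e1 := boundary_q1 num0.
have e2 := boundary_q2 size_p1 size_p2 beta1 tau1 num0.
have Q0 : (p1 + z2 *: p2).[tau] != 0.
  rewrite hornerD hornerZ; apply: contra hz; rewrite addrC addr_eq0 => /eqP h.
  by apply/eqP; apply: (mulIf v0); rewrite divfK.
have := is_derive_rat (q2 + z2 *: q1) Q0.
rewrite (_ : (fun w => _) = (fun w : R[i]^o => (phi n p1 p2 w z2 : R[i]^o))); last first.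
  by apply/funext => w; rewrite /phi /ptilde /peval !hornerD !hornerZ.
rewrite [X in is_derive _ _ _ X -> _](_ : _ = N^`().[tau] / p2.[tau])//.
have h1 : (q2 + z2 *: q1).[tau] = beta * p1.[tau] + z2 * (beta * p2.[tau]).
  by rewrite hornerD hornerZ e1 e2.
have h2 : (p1 + z2 *: p2).[tau] = p1.[tau] + z2 * p2.[tau] by rewrite hornerD hornerZ.
have h3 : (q2 + z2 *: q1)^`().[tau] = q2^`().[tau] + z2 * q1^`().[tau].
  by rewrite derivD derivZ hornerD hornerZ.
have h4 : (p1 + z2 *: p2)^`().[tau] = p1^`().[tau] + z2 * p2^`().[tau].
  by rewrite derivD derivZ hornerD hornerZ.
rewrite h2 in Q0; rewrite h1 h2 h3 h4.
have e3 : q2^`().[tau] = beta * p1^`().[tau] - - p1.[tau] / p2.[tau] * N^`().[tau].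
  by rewrite -eD /clark_den derivB derivZ hornerD hornerN hornerZ opprB addrC subrK.
have e4 : q1^`().[tau] = N^`().[tau] + beta * p2^`().[tau].
  by rewrite /clark_num derivB derivZ hornerD hornerN hornerZ subrK.
rewrite e3 e4; move: N^`().[tau] => N'.
by field; rewrite v0 Q0.
Qed.

End BoundaryValues.

(** * Slices of the Clark measure *)

Section ClarkPoisson.
Variables (R : realType) (n : nat) (p1 p2 : {poly R[i]}) (alpha : R[i]).
Local Notation Re := complex.Re.
Local Notation leb := (@lebesgue_measure R).
Local Notation I01 := (@unit_int R).
Local Notation q1 := (refl n p1).
Local Notation q2 := (refl n p2).
Local Notation N := (clark_num n p1 p2 alpha).
Local Notation D := (clark_den n p1 p2 alpha).

(** In the first case, the inverse modulus of the constant derivative found in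
    [is_derive_phi_boundary]. *)
Definition clark_mass tau : R :=
  if N.[tau] == 0 then cmod p2.[tau] / cmod N^`().[tau] else 0.

Lemma clark_mass_ge0 tau : 0 <= clark_mass tau.
Proof. by rewrite /clark_mass; case: ifP => // _; rewrite divr_ge0 ?cmod_ge0. Qed.

Hypothesis size_p1 : (size p1 <= n.+1)%N.
Hypothesis size_p2 : (size p2 <= n.+1)%N.
Hypothesis stable : forall z1 z2, cmod z1 < 1 -> cmod z2 < 1 -> peval p1 p2 z1 z2 != 0.
Hypothesis q1_neq0 : q1 != 0.
Hypothesis coprime_pq : no_common_factor (poly2 p1 p2) (poly2 q2 q1).
Hypothesis alpha1 : cmod alpha = 1.
Hypothesis inner0 : forall z, cmod z < 1 -> cmod q2.[z] <= cmod p1.[z].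
Hypothesis den_neq : forall z1 z2, cmod z1 < 1 -> cmod z2 < 1 -> D.[z1] != z2 * N.[z1].

Lemma clark_origin : q2.[0] != alpha * p1.[0].
Proof.
have := @den_neq 0 0; rewrite cmod0 ltr01 => /(_ isT isT).
by rewrite mul0r /clark_den hornerD hornerN hornerZ subr_eq0 eq_sym.
Qed.

(** By [boundary_residue] the argument of [N'(tau) / p2(tau)] is that of [alpha / tau], so the
    modulus in [clark_mass] can be replaced by an exact identity, as the residue computation
    requires. *)
Lemma clark_massE tau : cmod tau = 1 -> N.[tau] = 0 ->
  N^`().[tau] != 0 /\ (clark_mass tau)%:C * tau * N^`().[tau] = alpha * p2.[tau].
Proof.
move=> t1 N0.
have t0 : tau != 0 by rewrite -cmod_gt0 t1.
have a0 : alpha != 0 by rewrite -cmod_gt0 alpha1.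
have v0 := boundary_p2_neq0 size_p1 size_p2 stable coprime_pq alpha1 t1 N0.
have [x x0 hx] := boundary_residue size_p1 size_p2 stable coprime_pq alpha1 t1 N0 inner0 clark_origin.
have xC : x%:C != 0 :> R[i] by rewrite -cmod_gt0 cmod_real gtr0_norm.
have N'E : N^`().[tau] = x%:C * alpha / tau * p2.[tau] by rewrite -hx divfK.
split; first by rewrite N'E !mulf_neq0// invr_eq0.
rewrite /clark_mass N0 eqxx N'E !cmodM cmodV t1 alpha1 cmod_real gtr0_norm// invr1 !mulr1.
have -> : cmod p2.[tau] / (x * cmod p2.[tau]) = x^-1.
  by field; rewrite gt_eqF// cmod_eq0 v0.
by rewrite fmorphV /=; field; rewrite xC t0.
Qed.

Section Slice.
Variables (ts : seq R[i]) (z2 : R[i]).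
Hypothesis uniq_ts : uniq ts.
Hypothesis ts_circle : forall tau, tau \in ts -> cmod tau = 1 /\ N.[tau] = 0.
Hypothesis ts_all : forall tau, cmod tau = 1 -> N.[tau] = 0 -> tau \in ts.
Hypothesis z21 : cmod z2 < 1.

(** In the slice [z2], [E] is [alpha p - p~] and [H] is [alpha p + p~]. *)
Let E : {poly R[i]} := D - z2 *: N.
Let H : {poly R[i]} := (alpha *: p1 + q2) + z2 *: (alpha *: p2 + q1).

(** [D = z2 N] with [|D| = |N|] and [|z2| < 1] forces [N = 0]. *)
Lemma slice_root tau : cmod tau = 1 -> (E.[tau] == 0) = (N.[tau] == 0).
Proof.
move=> t1; rewrite /E hornerD hornerN hornerZ.
have e := cmod_clark_num size_p1 size_p2 alpha1 t1.
apply/eqP/eqP => [h|h]; last first.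
  by rewrite h mulr0 subr0; apply/eqP; rewrite -cmod_eq0 -e h cmod0.
apply/eqP; apply: contraT => N0; move/eqP: h; rewrite subr_eq0 => /eqP /(congr1 (@cmod R)).
rewrite -e cmodM => h; have : 0 < cmod N.[tau] by rewrite cmod_gt0.
by move=> Np; have := ltr_pM2r Np (cmod z2) 1; rewrite mul1r -h ltxx z21.
Qed.

(** The second clause says that [H / E] and [c (tau + w) / (tau - w)], with [c] the mass, have the
    same residue [-2 c tau] at [tau]. *)
Lemma slice_deriv tau : cmod tau = 1 -> N.[tau] = 0 ->
  E^`().[tau] != 0 /\ H.[tau] + (clark_mass tau)%:C * (tau + tau) * E^`().[tau] = 0.
Proof.
move=> t1 N0; have [N'0 ce] := clark_massE t1 N0.
have v0 := boundary_p2_neq0 size_p1 size_p2 stable coprime_pq alpha1 t1 N0.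
have eD := boundary_den_deriv size_p1 size_p2 stable coprime_pq alpha1 t1 N0.
have uv := boundary_cmod size_p1 alpha1 t1 N0.
have e1 := boundary_q1 N0; have e2 := boundary_q2 size_p1 size_p2 alpha1 t1 N0.
have E'E : E^`().[tau] = (- p1.[tau] / p2.[tau] - z2) * N^`().[tau].
  by rewrite /E derivB derivZ hornerD hornerN hornerZ eD mulrBl.
split.
  rewrite E'E mulf_neq0// subr_eq0; apply/eqP => h; move: z21.
  by rewrite -h cmod_div cmodN uv divff ?ltxx// cmod_eq0.
rewrite E'E /H !(hornerD, hornerZ) e1 e2.
have -> : (clark_mass tau)%:C * (tau + tau) * ((- p1.[tau] / p2.[tau] - z2) * N^`().[tau]) =
   2 * (- p1.[tau] / p2.[tau] - z2) * ((clark_mass tau)%:C * tau * N^`().[tau]) by ring.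
by rewrite ce; field.
Qed.

(* The simple poles on the circle are removed by subtracting multiples of [(tau + z) / (tau - z)]. *)
Lemma slice_decomposition : exists Q E0 : {poly R[i]},
  (forall w, cmod w <= 1 -> E0.[w] != 0) /\
  (forall w, E.[w] != 0 -> Q.[w] / E0.[w] =
     H.[w] / E.[w] - \sum_(tau <- ts) (clark_mass tau)%:C * ((tau + w) / (tau - w))).
Proof.
have E_ts tau : tau \in ts -> E.[tau] = 0.
  by case/ts_circle => t1 N0; apply/eqP; rewrite slice_root// N0.
have [E0 eE] : exists E0, E = E0 * \prod_(tau <- ts) ('X - tau%:P).
  apply: uniq_roots_prod_XsubC; last by rewrite uniq_rootsE.
  by apply/allP => tau /E_ts h; apply/eqP.
pose F tau := E0 * \prod_(s <- rem tau ts) ('X - s%:P).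
have eF tau : tau \in ts -> E = F tau * ('X - tau%:P).
  by move=> tin; rewrite eE (big_rem tau tin) /= /F; ring.
have F_other s tau : s \in ts -> tau \in ts -> s != tau -> (F tau).[s] = 0.
  move=> sin tin st; rewrite /F hornerM horner_prod (big_rem s) /=.
    by rewrite hornerXsubC subrr mul0r mulr0.
  by rewrite mem_rem_uniq// inE st.
have F_self tau : tau \in ts -> (F tau).[tau] = E^`().[tau].
  move=> tin; rewrite (eF _ tin) derivM derivXsubC hornerD !hornerM.
  by rewrite hornerXsubC subrr mulr0 add0r hornerC mulr1.
(* The numerator over [E] of the difference; the sign is plus because [F tau] is [E] divided by
   [w - tau]. By the residue identity [M] vanishes at every boundary zero. *)
pose M := H + \sum_(tau <- ts) (clark_mass tau)%:C *: ((tau%:P + 'X) * F tau).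
have M_ts s : s \in ts -> M.[s] = 0.
  move=> sin; rewrite /M hornerD horner_sum (big_rem s sin) /= big1_seq; last first.
    move=> tau /andP[_]; rewrite mem_rem_uniq// inE => /andP[ts' tin].
    by rewrite hornerZ hornerM F_other ?mulr0// eq_sym.
  have -> : ((clark_mass s)%:C *: ((s%:P + 'X) * F s)).[s] = (clark_mass s)%:C * ((s + s) * (F s).[s]).
    by rewrite hornerZ hornerM hornerD hornerC hornerX.
  rewrite F_self// addr0 mulrA.
  by have [t1 N0] := ts_circle sin; have [_] := slice_deriv t1 N0.
have [Q eQ] : exists Q, M = Q * \prod_(tau <- ts) ('X - tau%:P).
  apply: uniq_roots_prod_XsubC; last by rewrite uniq_rootsE.
  by apply/allP => tau /M_ts h; apply/eqP.
exists Q, E0; split.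
  (* Inside, [E] has no zero at all; on the circle a further zero would contradict the simplicity of
     the roots of [E]. *)
  move=> w; rewrite le_eqVlt => /orP[/eqP w1|w1]; apply/eqP => E00; last first.
    have := den_neq w1 z21; rewrite -subr_eq0 -hornerZ -hornerN -hornerD -/E.
    by rewrite eE hornerM E00 mul0r eqxx.
  have Ew : E.[w] = 0 by rewrite eE hornerM E00 mul0r.
  have N0 : N.[w] = 0 by apply/eqP; rewrite -slice_root// Ew.
  have [E'0 _] := slice_deriv w1 N0; have win := ts_all w1 N0.
  by move: E'0; rewrite -F_self// /F hornerM E00 mul0r eqxx.
move=> w Ew.
have Pw : (\prod_(tau <- ts) ('X - tau%:P)).[w] != 0.
  by apply: contra Ew => /eqP h; rewrite eE hornerM h mulr0.
have E0w : E0.[w] != 0 by apply: contra Ew => /eqP h; rewrite eE hornerM h mul0r.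
have -> : Q.[w] / E0.[w] = M.[w] / E.[w].
  by rewrite eE eQ !hornerM; field; rewrite Pw E0w.
rewrite /M hornerD mulrDl; congr (_ + _).
rewrite horner_sum mulr_suml -sumrN; apply: eq_big_seq => tau tin.
have tw : w - tau != 0.
  by apply: contra Ew; rewrite subr_eq0 => /eqP ->; rewrite E_ts.
have Fw : (F tau).[w] != 0.
  by apply: contra Ew => /eqP h; rewrite (eF _ tin) hornerM h mul0r.
rewrite [E.[w]](_ : _ = (F tau).[w] * (w - tau)); last by rewrite (eF _ tin) hornerM hornerXsubC.
have -> : ((clark_mass tau)%:C *: ((tau%:P + 'X) * F tau)).[w] = (clark_mass tau)%:C * ((tau + w) * (F tau).[w]).
  by rewrite hornerZ hornerM hornerD hornerC hornerX.
have -> : tau - w = - (w - tau) by rewrite opprB.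
by field; rewrite tw Fw.
Qed.

Lemma slice_Re w : Re (H.[w] / E.[w]) =
  (cmod (peval p1 p2 w z2) ^+ 2 - cmod (ptilde n p1 p2 w z2) ^+ 2) / cmod E.[w] ^+ 2.
Proof.
have -> : H.[w] = alpha * peval p1 p2 w z2 + ptilde n p1 p2 w z2.
  by rewrite /H /peval /ptilde !(hornerD, hornerZ) /peval; ring.
have -> : E.[w] = alpha * peval p1 p2 w z2 - ptilde n p1 p2 w z2.
  by rewrite /E /clark_num /clark_den /peval /ptilde !(hornerD, hornerN, hornerZ) /peval; ring.
by rewrite Re_cayley cmodM alpha1 mul1r.
Qed.

Lemma slice_disc z1 : cmod z1 < 1 -> E.[z1] != 0 /\ Re (H.[z1] / E.[z1]) =
  (1 - cmod (phi n p1 p2 z1 z2) ^+ 2) / cmod (alpha - phi n p1 p2 z1 z2) ^+ 2.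
Proof.
move=> z11; have pz := stable z11 z21.
have E0 : E.[z1] != 0.
  by rewrite /E hornerD hornerN hornerZ subr_eq0; exact: den_neq.
split=> //; rewrite slice_Re.
have Ew : E.[z1] = (alpha - phi n p1 p2 z1 z2) * peval p1 p2 z1 z2.
  rewrite mulrBl /phi divfK// /E /clark_num /clark_den /peval /ptilde.
  by rewrite !(hornerD, hornerN, hornerZ) /peval; ring.
have -> : ptilde n p1 p2 z1 z2 = phi n p1 p2 z1 z2 * peval p1 p2 z1 z2 by rewrite /phi divfK.
move: E0; rewrite Ew mulf_eq0 negb_or -!cmod_eq0 !cmodM => /andP[h1 h2].
by field; rewrite h1 h2.
Qed.

(** Off the zeros of [N] the cancelled gcd does not vanish, so [B = N / D]; this is unimodular, and
    conjugation is inversion. *)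
Lemma Balpha_conj w : cmod w = 1 -> N.[w] != 0 ->
  cmod (Balpha n p1 p2 alpha w)^*%C = 1 /\ (Balpha n p1 p2 alpha w)^*%C = D.[w] / N.[w].
Proof.
move=> w1 N0.
have e := cmod_clark_num size_p1 size_p2 alpha1 w1.
have D0 : D.[w] != 0 by rewrite -cmod_eq0 -e cmod_eq0.
have BE : Balpha n p1 p2 alpha w = N.[w] / D.[w].
  rewrite /Balpha /Bnum /Bden -/N -/D; set g := gcdp _ _.
  have eN : N = (N %/ g) * g by rewrite divpK// dvdp_gcdl.
  have eD : D = (D %/ g) * g by rewrite divpK// dvdp_gcdr.
  have g0 : g.[w] != 0 by apply: contra N0 => /eqP h; rewrite eN hornerM h mulr0.
  have D'0 : (D %/ g).[w] != 0 by apply: contra D0 => /eqP h; rewrite eD hornerM h mul0r.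
  by rewrite [in RHS]eN [in RHS]eD !hornerM; field; rewrite g0 D'0.
have B1 : cmod (Balpha n p1 p2 alpha w) = 1 by rewrite BE cmod_div e divff// cmod_eq0.
by rewrite cmod_conj B1 conjc_unit// BE invf_div.
Qed.

(** Two factorisations on the circle: [E = N (conj B - z2)], and [|p|^2 - |p~|^2 = (|p1|^2 - |p2|^2)
    (1 - |z2|^2)]. *)
Lemma slice_circle w : cmod w = 1 -> N.[w] != 0 -> E.[w] != 0 /\
  Re (H.[w] / E.[w]) = pk z2 (Balpha n p1 p2 alpha w)^*%C * Walpha n p1 p2 alpha w.
Proof.
move=> w1 N0; split; first by rewrite slice_root.
have [_ ->] := Balpha_conj w1 N0.
rewrite slice_Re /pk /Walpha.
have -> : (refl n p1).[w] - alpha * p2.[w] = N.[w].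
  by rewrite /clark_num hornerD hornerN hornerZ.
have -> : E.[w] = (D.[w] / N.[w] - z2) * N.[w].
  by rewrite mulrBl divfK// /E hornerD hornerN hornerZ.
have -> : cmod (ptilde n p1 p2 w z2) = cmod ((p2.[w])^*%C + z2 * (p1.[w])^*%C).
  rewrite /ptilde /peval !horner_refl//.
  have -> : w ^+ n * (p2.[w])^*%C + z2 * (w ^+ n * (p1.[w])^*%C) =
     w ^+ n * ((p2.[w])^*%C + z2 * (p1.[w])^*%C) by ring.
  by rewrite cmodM cmodX w1 expr1n mul1r.
have -> : cmod (peval p1 p2 w z2) ^+ 2 - cmod ((p2.[w])^*%C + z2 * (p1.[w])^*%C) ^+ 2 =
   (cmod p1.[w] ^+ 2 - cmod p2.[w] ^+ 2) * (1 - cmod z2 ^+ 2).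
  rewrite /peval; case: (p1.[w]) (p2.[w]) z2 => [a b] [c d] [x y].
  by rewrite !cmod_sqr /=; ring.
by rewrite cmodM exprMn invfM; ring.
Qed.

Lemma measurable_WB (T : R[i]) : measurable_fun setT (fun t : R =>
  pk T (expi t) * (pk z2 (Balpha n p1 p2 alpha (expi t))^*%C * Walpha n p1 p2 alpha (expi t))).
Proof.
have me := cmeasurable_expi (@measurable_id _ R setT).
apply: measurable_funM.
  by apply: measurable_pk => //; exact: cmeasurable_cst.
apply: measurable_funM.
  apply: measurable_pk; first exact: cmeasurable_cst.
  apply: cmeasurable_conj; apply: cmeasurableM; first exact: cmeasurable_horner.
  by apply: cmeasurableV; exact: cmeasurable_horner.
apply: measurable_fun_div.
  by apply: measurable_funB; apply: measurable_cmod_sqr; exact: cmeasurable_horner.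
apply: measurable_cmod_sqr; apply: cmeasurableB; first exact: cmeasurable_horner.
by apply: cmeasurableM; [exact: cmeasurable_cst|exact: cmeasurable_horner].
Qed.

Lemma slice_poisson z1 : cmod z1 < 1 ->
  (\int[leb]_(t in I01) (pk z1 (expi t) * (pk z2 (Balpha n p1 p2 alpha (expi t))^*%C *
       Walpha n p1 p2 alpha (expi t)))%:E =
   ((1 - cmod (phi n p1 p2 z1 z2) ^+ 2) / cmod (alpha - phi n p1 p2 z1 z2) ^+ 2
     - \sum_(tau <- ts) clark_mass tau * pk z1 tau)%:E)%E.
Proof.
move=> z11; have [Q [E0 [hE0 hQ]]] := slice_decomposition.
have [i1 i2] := poisson_rat Q z11 hE0.
have [Ez1 Rez1] := slice_disc z11.
have Re_poles w : Re (\sum_(tau <- ts) (clark_mass tau)%:C * ((tau + w) / (tau - w))) =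
    \sum_(tau <- ts) clark_mass tau * ((1 - cmod w ^+ 2) / cmod (tau - w) ^+ 2).
  rewrite Re_sum; apply: eq_big_seq => tau /ts_circle [t1 _].
  by rewrite ReMl Re_cayley t1 expr1n.
transitivity ((\int[leb]_(t in I01) (pk z1 (expi t) * Re (Q.[expi t] / E0.[expi t])))%:E); last first.
  by rewrite i2 hQ// ReD ReN Rez1 Re_poles.
rewrite /Rintegral fineK; last by apply: integrable_fin_num; [exact: measurable_unit_int|exact: i1].
have N0 := clark_num_neq0 size_p1 size_p2 stable q1_neq0 coprime_pq alpha1.
have [S [mS S0] hS] := circle_roots_negligible N0.
apply: ae_eq_integral.
- exact: measurable_unit_int.
- by apply: measurable_funTS; apply/measurable_EFinP; exact: measurable_WB.
- exact: measurable_int i1.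
exists S; split => //.
move=> t /= ht; apply: contrapT => nS; apply: ht => tI.
have Nt : N.[expi t] != 0 by apply/eqP => h; apply: nS; exact: hS.
have w1 := cmod_expi t.
have [Et ReE] := slice_circle w1 Nt.
(* The subtracted terms have zero real part on the circle, so they affect the value at [z1] but not
   the boundary integrand. *)
rewrite hQ// ReD ReN ReE Re_poles w1 expr1n subrr.
rewrite big1 ?subr0// => tau _.
by rewrite mul0r mulr0.
Qed.

End Slice.
End ClarkPoisson.

(** * Uniqueness of Poisson integrals on the torus *)

Section ArcIndicators.
Variable R : realType.
Local Notation leb := (@lebesgue_measure R).
Local Notation I01 := (@unit_int R).

Definition arc_gap (j : nat) : R := (j.+3%:R)^-1.
(** A lower bound for the denominator of the kernel at angular distance at least [arc_gap j]. *)
Definition arc_height (j : nat) : R := 1 - cos (2 * pi * arc_gap j).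
(** Makes [1 - r^2 <= 2 (1 - r) <= arc_gap j * arc_height j], whence [pk_small]. The entry [1 / 2]
    keeps [r >= 1 / 2]. *)
Definition arc_radius (j : nat) : R := 1 - Num.min (1 / 2) (arc_gap j * arc_height j / 2).
(** The gap at the upper end prevents the kernel from wrapping around the circle and giving mass to
    small angles. *)
Definition arc (b : R) (j : nat) : set R :=
  if b < 0 then I01 else [set` `]b + arc_gap j, 1 - arc_gap j[].

(* Poisson smoothing of the arc [arc b j]; it stays clear of the point 1 of the circle unless
   it is the whole circle. *)
Definition arc_test (b : R) (j : nat) (x : R) : \bar R :=
  (\int[leb]_(s in arc b j) (pk ((arc_radius j)%:C * expi s) (expi x))%:E)%E.

Lemma arc_gap_bounds j : 0 < arc_gap j < 1 / 2.
Proof.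
rewrite /arc_gap invr_gt0 ltr0n /= mul1r ltf_pV2 ?posrE ?ltr0n//.
by rewrite ltr_nat.
Qed.

Lemma cvg_arc_gap : arc_gap j @[j --> \oo] --> (0 : R).
Proof.
apply: (@squeeze_cvgr _ _ _ _ (cst 0) (@harmonic R)); last 2 first.
- exact: cvg_cst.
- exact: cvg_harmonic.
apply: nearW => j /=; rewrite /arc_gap invr_ge0 ler0n /= lef_pV2 ?posrE ?ltr0n//.
by rewrite ler_nat (leq_trans (leqnSn _) (leqnSn _)).
Qed.

Lemma cos_gap (d u : R) : 0 < d < 1 / 2 -> d <= u <= 1 - d -> cos (2 * pi * u) <= cos (2 * pi * d).
Proof.
move=> /andP[d0 d2] /andP[du u1]; have pg := pi_gt0 R.
have h (v : R) : d <= v -> v <= 1 / 2 -> cos (2 * pi * v) <= cos (2 * pi * d).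
  move=> dv v2; rewrite leNgt ltr_cos; first by rewrite -leNgt ler_pM2l// mulr_gt0.
    by rewrite in_itv /=; apply/andP; split; nra.
  by rewrite in_itv /=; apply/andP; split; nra.
have [u2|u2] := leP u (1 / 2); first exact: h.
have -> : 2 * pi * u = - (2 * pi * (1 - u)) + pi *+ 2 by rewrite -mulr_natl; ring.
by rewrite cosD2pi cosN; apply: h; lra.
Qed.

Lemma arc_height_gt0 j : 0 < arc_height j.
Proof.
have /andP[d0 d2] := arc_gap_bounds j; have pg := pi_gt0 R.
rewrite subr_gt0 -[ltRHS](@cos0 R) ltr_cos ?in_itv /=; first by rewrite !mulr_gt0.
  by rewrite lexx ltW.
by apply/andP; split; nra.
Qed.

Lemma arc_radius_bounds j : 1 / 2 <= arc_radius j < 1.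
Proof.
rewrite /arc_radius ltrBlDr ltrDl lt_min divr_gt0//= divr_gt0 ?mulr_gt0 ?arc_height_gt0//; last first.
  by have /andP[] := arc_gap_bounds j.
rewrite andbT lerBrDr -lerBrDl ge_min; apply/orP; left; lra.
Qed.

Lemma cmod_arc_radius j s : cmod ((arc_radius j)%:C * expi s) < 1.
Proof.
have /andP[r0 r1] := arc_radius_bounds j.
by rewrite cmodM cmod_expi mulr1 cmod_real ger0_norm//; lra.
Qed.

Lemma pk_expiE (r s x : R) : 0 <= r -> pk (r%:C * expi s) (expi x) =
  (1 - r ^+ 2) / (1 + r ^+ 2 - 2 * r * cos (2 * pi * (x - s))).
Proof.
move=> r0; rewrite /pk cmodM cmod_expi mulr1 cmod_real ger0_norm//; congr (_ / _).
rewrite mulrBr cosB cmod_sqr /expi /=.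
have h1 := cos2Dsin2 (2 * pi * x); have h2 := cos2Dsin2 (2 * pi * s).
set c := cos _ in h1 *; set s' := sin _ in h1 *.
set c' := cos _ in h2 *; set s'' := sin _ in h2 *.
rewrite mul0r subr0 mul0r addr0.
have -> : (c - r * c') ^+ 2 + (s' - r * s'') ^+ 2 =
  (c ^+ 2 + s' ^+ 2) + r ^+ 2 * (c' ^+ 2 + s'' ^+ 2) - 2 * r * (c * c' + s' * s'') by ring.
by rewrite h1 h2 mulr1.
Qed.

Lemma pk_expiC (r s x : R) : 0 <= r -> pk (r%:C * expi s) (expi x) = pk (r%:C * expi x) (expi s).
Proof.
by move=> r0; rewrite !pk_expiE// -[x - s]opprB mulrN cosN.
Qed.

Lemma pk_small j (s x : R) : arc_gap j <= `|x - s| <= 1 - arc_gap j ->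
  pk ((arc_radius j)%:C * expi s) (expi x) <= arc_gap j.
Proof.
move=> h; have /andP[r0 r1] := arc_radius_bounds j; have dj := arc_gap_bounds j.
have hc : cos (2 * pi * (x - s)) <= 1 - arc_height j.
  rewrite (_ : 1 - arc_height j = cos (2 * pi * arc_gap j)); last by rewrite /arc_height; ring.
  rewrite -cos_norm normrM ger0_norm ?mulr_ge0 ?pi_ge0//.
  exact: cos_gap.
have hg := arc_height_gt0 j.
have hr : 1 - arc_radius j <= arc_gap j * arc_height j / 2.
  rewrite (_ : 1 - arc_radius j = Num.min (1 / 2) (arc_gap j * arc_height j / 2)).
    by rewrite ge_min lexx orbT.
  by rewrite /arc_radius; ring.
case/andP: dj => d0 d1.
rewrite pk_expiE; last lra.
set r := arc_radius j in r0 r1 hr *; set c := cos _ in hc *; set y := arc_height j in hg hc hr *.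
have den : y <= 1 + r ^+ 2 - 2 * r * c.
  have : 2 * r * c <= 2 * r * (1 - y) by rewrite ler_pM2l//; lra.
  have : 0 <= (1 - r) ^+ 2 by exact: sqr_ge0.
  have : 0 <= (2 * r - 1) * y by rewrite mulr_ge0//; lra.
  by nra.
rewrite ler_pdivrMr; last by apply: lt_le_trans den.
have : arc_gap j * y <= arc_gap j * (1 + r ^+ 2 - 2 * r * c) by rewrite ler_pM2l.
by nra.
Qed.

Lemma measurable_arc b j : measurable (arc b j : set (measurableTypeR R)).
Proof. by rewrite /arc; case: ifP => _; [exact: measurable_unit_int|exact: measurable_itv]. Qed.

Lemma arc_sub b j : arc b j `<=` I01.
Proof.
have [b0|b0] := ltP b 0; first by rewrite /arc b0.
rewrite /arc ltNge b0 => x /=; rewrite in_itv /= /unit_int /= => /andP[h1 h2].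
have /andP[d0 d1] := arc_gap_bounds j.
by apply/andP; split; lra.
Qed.

Lemma measurable_pk_arc j : measurable_fun setT
  (fun p : (R * R)%type => pk ((arc_radius j)%:C * expi p.2) (expi p.1)).
Proof.
apply: measurable_pk; last exact: cmeasurable_expi.
by apply: cmeasurableM; [exact: cmeasurable_cst|exact: cmeasurable_expi].
Qed.

Lemma measurable_pk_arc1 j x : measurable_fun setT
  (fun s : R => pk ((arc_radius j)%:C * expi s) (expi x)).
Proof.
apply: measurable_pk; last exact: cmeasurable_cst.
by apply: cmeasurableM; [exact: cmeasurable_cst|exact: cmeasurable_expi].
Qed.

Lemma pk_arc_ge0 j s x : 0 <= pk ((arc_radius j)%:C * expi s) (expi x).
Proof. by apply: pk_ge0; apply: ltW; exact: cmod_arc_radius. Qed.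

Lemma arc_total j x :
  (\int[leb]_(s in I01) (pk ((arc_radius j)%:C * expi s) (expi x))%:E = 1)%E.
Proof.
rewrite -(pk_mass (cmod_arc_radius j x)); apply: eq_integral => s _.
by rewrite pk_expiC//; have /andP[] := arc_radius_bounds j; lra.
Qed.

Lemma arc_test_ge0 b j x : (0 <= arc_test b j x)%E.
Proof. by apply: integral_ge0 => s _; rewrite lee_fin pk_arc_ge0. Qed.

Lemma arc_test_le1 b j x : (arc_test b j x <= 1)%E.
Proof.
rewrite -(arc_total j x); apply: ge0_subset_integral => //.
- exact: measurable_arc.
- exact: measurable_unit_int.
- by apply: measurable_funTS; apply/measurable_EFinP; exact: measurable_pk_arc1.
- by move=> s _; rewrite lee_fin pk_arc_ge0.
- exact: arc_sub.
Qed.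

Lemma arc_test_fin b j x : arc_test b j x \is a fin_num.
Proof.
rewrite ge0_fin_numE ?arc_test_ge0//; apply: le_lt_trans (arc_test_le1 b j x) _.
exact: ltry.
Qed.

Lemma small_integral j x (A : set (measurableTypeR R)) : measurable A -> A `<=` I01 ->
  (forall s, A s -> arc_gap j <= `|x - s| <= 1 - arc_gap j) ->
  (\int[leb]_(s in A) (pk ((arc_radius j)%:C * expi s) (expi x))%:E <= (arc_gap j)%:E)%E.
Proof.
move=> mA AI h; have /andP[d0 _] := arc_gap_bounds j.
apply: (@le_trans _ _ (\int[leb]_(s in A) (arc_gap j)%:E)%E).
  apply: ge0_le_integral => //.
  - by move=> s _; rewrite lee_fin pk_arc_ge0.
  - by apply: measurable_funTS; apply/measurable_EFinP; exact: measurable_pk_arc1.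
  - by move=> s As; rewrite lee_fin pk_small// h.
rewrite integral_cst// -[leRHS]mule1; apply: lee_wpmul2l; first by rewrite lee_fin ltW.
rewrite -lebesgue_unit_int; apply: le_measure => //; rewrite inE//.
exact: measurable_unit_int.
Qed.

(** Convergence holds at every point, also at [x = b]. Almost everywhere for Lebesgue measure would
    not do, since a Clark measure may charge lines. *)
Lemma cvg_arc_test b x : I01 x ->
  fine (arc_test b j x) @[j --> \oo] --> ((b < x)%R%:R : R).
Proof.
move=> /andP[x0 x1].
have fb j : 0 <= fine (arc_test b j x) <= 1.
  rewrite fine_ge0 ?arc_test_ge0//= -lee_fin fineK ?arc_test_fin//.
  exact: arc_test_le1.
have [b0|b0] := ltP b 0.
  rewrite (lt_le_trans b0 x0) (_ : (fun j => _) = cst 1); first exact: cvg_cst.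
  by apply/funext => j; rewrite /arc_test /arc b0 arc_total.
have [bx|xb] := ltP b x; last first.
  apply: (@squeeze_cvgr _ _ _ _ (cst 0) arc_gap); [|exact: cvg_cst|exact: cvg_arc_gap].
  apply: nearW => j /=; have /andP[-> _] := fb j => /=.
  rewrite -lee_fin fineK ?arc_test_fin// /arc_test; apply: small_integral.
  - exact: measurable_arc.
  - exact: arc_sub.
  move=> s; rewrite /arc ltNge b0 /= in_itv /= => /andP[s1 s2].
  have /andP[d0 d1] := arc_gap_bounds j.
  by rewrite ler0_norm; [apply/andP; split; lra|lra].
apply: (@squeeze_cvgr _ _ _ _ (fun j => 1 - arc_gap j) (cst 1)); last 2 first.
- by rewrite -[X in _ --> X]subr0; apply: cvgB; [exact: cvg_cst|exact: cvg_arc_gap].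
- exact: cvg_cst.
(* Once the gap is below this number, every angle outside the arc is at least one gap away from [x],
   so the complement contributes at most [arc_gap j]. *)
have e0 : 0 < Num.min ((x - b) / 2) ((1 - x) / 2).
  by rewrite lt_min !divr_gt0// subr_gt0.
near=> j; have /andP[_ ->] := fb j; rewrite andbT.
have : arc_gap j < Num.min ((x - b) / 2) ((1 - x) / 2).
  near: j; have /cvgr0Pnorm_lt/(_ _ e0) := cvg_arc_gap.
  apply: filterS => j; apply: le_lt_trans; exact: ler_norm.
rewrite lt_min => /andP[g1 g2]; have /andP[d0 d1] := arc_gap_bounds j.
have mS : measurable (I01 `\` arc b j : set (measurableTypeR R)).
  by apply: measurableD; [exact: measurable_unit_int|exact: measurable_arc].
have split : (arc_test b j x + \int[leb]_(s in I01 `\` arc b j)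
    (pk ((arc_radius j)%:C * expi s) (expi x))%:E = 1)%E.
  rewrite -(arc_total j x) -[in RHS](setDUK (@arc_sub b j)) ge0_integral_setU//.
  - exact: measurable_arc.
  - by apply: measurable_funTS; apply/measurable_EFinP; exact: measurable_pk_arc1.
  - by move=> s _; rewrite lee_fin pk_arc_ge0.
  - by apply/disj_setPS => s /= [As [_ nA]]; exact: nA.
have sm : (\int[leb]_(s in I01 `\` arc b j)
    (pk ((arc_radius j)%:C * expi s) (expi x))%:E <= (arc_gap j)%:E)%E.
  apply: small_integral; [exact: mS|by move=> s [? _]|].
  move=> s [/andP[s0 s1]]; rewrite /arc ltNge b0 /= in_itv /= => /negP.
  rewrite negb_and -!leNgt => /orP[h|h].
    by rewrite ger0_norm; [apply/andP; split; lra|lra].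
  by rewrite ler0_norm; [apply/andP; split; lra|lra].
rewrite lerBlDr -lee_fin EFinD fineK ?arc_test_fin// -split.
by apply: leeD2l.
Unshelve. all: by end_near.
Qed.

End ArcIndicators.


Section TorusUniqueness.
Variable R : realType.
Local Notation leb := (@lebesgue_measure R).
Local Notation I01 := (@unit_int R).
Local Notation sq := (@unit_sq R).
Local Notation T2 := (R * R)%type.

Lemma unit_sqE : sq = I01 `*` I01.
Proof. by apply/seteqP; split => x /=; rewrite /unit_sq /unit_int /= => /andP. Qed.

Lemma measurable_unit_sq : measurable (sq : set T2).
Proof. by rewrite unit_sqE; apply: measurableX; exact: measurable_unit_int. Qed.

Lemma integral_swap (m : {finite_measure set T2 -> \bar R}) (K : T2 * R -> \bar R)
    (A : set (measurableTypeR R)) : measurable A ->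
  measurable_fun setT K -> (forall x, 0 <= K x)%E ->
  (\int[m]_x \int[leb]_(s in A) K (x, s) = \int[leb]_(s in A) \int[m]_x K (x, s))%E /\
  measurable_fun setT (fun x => \int[leb]_(s in A) K (x, s))%E.
Proof.
move=> mA mK K0.
pose f : T2 * measurableTypeR R -> \bar R := K \_ (setT `*` A).
have f0 x : (0 <= f x)%E by rewrite /f patchE; case: ifP.
have mf : measurable_fun setT f.
  apply/(measurable_restrictT _ _).1; first by apply: measurableX.
  exact: measurable_funTS.
have e x : (\int[leb]_(s in A) K (x, s) = \int[leb]_s f (x, s))%E.
  rewrite integral_mkcond; apply: eq_integral => s _.
  rewrite /f !patchE; congr (if _ then _ else _).
  by apply/idP/idP; rewrite !inE => // -[].
split.
  under eq_integral do rewrite e.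
  rewrite (@fubini_tonelli _ _ _ _ _ m leb f mf f0) [RHS]integral_mkcond.
  apply: eq_integral => s _; rewrite patchE; case: ifPn => sA.
    apply: eq_integral => x _; rewrite /f patchE ifT// inE; split => //.
    by rewrite inE in sA.
  rewrite integral0_eq// => x _; rewrite /f patchE ifF//.
  by apply/negbTE; apply: contra sA; rewrite !inE => -[].
under eq_fun do rewrite e.
exact: (@measurable_fun_fubini_tonelli_F _ _ _ _ _ leb f mf f0).
Qed.

Section Agreement.
Variables m1 m2 : {finite_measure set T2 -> \bar R}.
Hypothesis m1_sq : m1 (~` sq) = 0%E.
Hypothesis m2_sq : m2 (~` sq) = 0%E.
Hypothesis same_poisson : forall z1 z2 : R[i], cmod z1 < 1 -> cmod z2 < 1 ->
  (\int[m1]_x (pk z1 (expi x.1) * pk z2 (expi x.2))%:E =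
   \int[m2]_x (pk z1 (expi x.1) * pk z2 (expi x.2))%:E)%E.

Let agree (h : T2 -> \bar R) : Prop := (\int[m1]_x h x = \int[m2]_x h x)%E.

Let agree_average (K : T2 * R -> \bar R) (A : set (measurableTypeR R)) : measurable A ->
  measurable_fun setT K -> (forall x, 0 <= K x)%E ->
  (forall s, agree (fun x => K (x, s))) ->
  agree (fun x => \int[leb]_(s in A) K (x, s))%E.
Proof.
move=> mA mK K0 h; rewrite /agree.
rewrite (integral_swap m1 mA mK K0).1 (integral_swap m2 mA mK K0).1.
by apply: eq_integral => s _; exact: h.
Qed.

Let agree_test1 b j (z2 : R[i]) : cmod z2 < 1 ->
  agree (fun x => arc_test b j x.1 * (pk z2 (expi x.2))%:E)%E.
Proof.
move=> z21.
have mk1 : measurable_fun setT (fun p : T2 * R => pk ((arc_radius R j)%:C * expi p.2) (expi p.1.1)).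
  apply: measurable_pk; last by apply: cmeasurable_expi; apply: measurableT_comp.
  by apply: cmeasurableM; [exact: cmeasurable_cst|exact: cmeasurable_expi].
have mk2 : measurable_fun setT (fun p : T2 * R => pk z2 (expi p.1.2)).
  apply: measurable_pk; first exact: cmeasurable_cst.
  by apply: cmeasurable_expi; apply: measurableT_comp.
pose K (p : T2 * R) := (pk ((arc_radius R j)%:C * expi p.2) (expi p.1.1) * pk z2 (expi p.1.2))%:E.
have K0 p : (0 <= K p)%E by rewrite /K lee_fin mulr_ge0 ?pk_arc_ge0// pk_ge0// ltW.
have mK : measurable_fun setT K by apply/measurable_EFinP; exact: measurable_funM.
have h s : agree (fun x => K (x, s)).
  exact: (same_poisson (cmod_arc_radius j s) z21).
have := agree_average (measurable_arc b j) mK K0 h.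
suff -> : (fun x => \int[leb]_(s in arc b j) K (x, s))%E =
    (fun x => arc_test b j x.1 * (pk z2 (expi x.2))%:E)%E by [].
apply/funext => x; rewrite /K /arc_test -ge0_integralZr//.
- exact: measurable_arc.
- by apply: measurable_funTS; apply/measurable_EFinP; exact: measurable_pk_arc1.
- by move=> s _; rewrite lee_fin pk_arc_ge0.
- by rewrite lee_fin pk_ge0// ltW.
Qed.

Let measurable_test b j : measurable_fun setT (fun x : R => arc_test b j x).
Proof.
pose f : R * measurableTypeR R -> \bar R :=
  (fun p => (pk ((arc_radius R j)%:C * expi p.2) (expi p.1))%:E) \_ (setT `*` arc b j).
have f0 x : (0 <= f x)%E by rewrite /f patchE; case: ifP => // _; rewrite lee_fin pk_arc_ge0.
have mf : measurable_fun setT f.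
  apply/(measurable_restrictT _ _).1; first by apply: measurableX => //; exact: measurable_arc.
  by apply: measurable_funTS; apply/measurable_EFinP; exact: measurable_pk_arc.
rewrite (_ : (fun x => _) = fun x => (\int[leb]_s f (x, s))%E).
  exact: (@measurable_fun_fubini_tonelli_F _ _ _ _ _ leb f mf f0).
apply/funext => x; rewrite /arc_test integral_mkcond; apply: eq_integral => s _.
rewrite /f !patchE; congr (if _ then _ else _).
by apply/idP/idP; rewrite !inE => // -[].
Qed.

Let agree_test2 b d j : agree (fun x => arc_test b j x.1 * arc_test d j x.2)%E.
Proof.
pose K (p : T2 * R) := (arc_test b j p.1.1 * (pk ((arc_radius R j)%:C * expi p.2) (expi p.1.2))%:E)%E.
have K0 p : (0 <= K p)%E by rewrite /K mule_ge0 ?arc_test_ge0// lee_fin pk_arc_ge0.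
have mk1 : measurable_fun setT (fun p : T2 * R => pk ((arc_radius R j)%:C * expi p.2) (expi p.1.2)).
  apply: measurable_pk; last by apply: cmeasurable_expi; apply: measurableT_comp.
  by apply: cmeasurableM; [exact: cmeasurable_cst|exact: cmeasurable_expi].
have mK : measurable_fun setT K.
  apply: emeasurable_funM; last exact/measurable_EFinP.
  by apply: (measurableT_comp (measurable_test b j)); apply: measurableT_comp.
have h s : agree (fun x => K (x, s)).
  exact: (agree_test1 b j (cmod_arc_radius j s)).
have := agree_average (measurable_arc d j) mK K0 h.
suff -> : (fun x => \int[leb]_(s in arc d j) K (x, s))%E =
    (fun x => arc_test b j x.1 * arc_test d j x.2)%E by [].
apply/funext => x; rewrite /K [in RHS]/arc_test -ge0_integralZl//.
- exact: measurable_arc.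
- by apply: measurable_funTS; apply/measurable_EFinP; exact: measurable_pk_arc1.
- by move=> s _; rewrite lee_fin pk_arc_ge0.
- exact: arc_test_ge0.
Qed.

Let cvg_rect (m : {finite_measure set T2 -> \bar R}) b d : m (~` sq) = 0%E ->
  (\int[m]_x (arc_test b j x.1 * arc_test d j x.2) @[j --> \oo] -->
   m (`]b, +oo[ `*` `]d, +oo[)%classic)%E.
Proof.
move=> msq.
have mrect : measurable (`]b, +oo[ `*` `]d, +oo[ : set T2) by apply: measurableX.
have -> : m (`]b, +oo[ `*` `]d, +oo[)%classic =
    (\int[m]_x (\1_(`]b, +oo[ `*` `]d, +oo[)%classic x)%:E)%E.
  by rewrite integral_indic// setIT.
have mt j : measurable_fun setT (fun x : T2 => arc_test b j x.1 * arc_test d j x.2)%E.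
  by apply: emeasurable_funM; apply: (measurableT_comp (measurable_test _ _)).
have [] := @dominated_convergence _ _ _ m setT measurableT
    (fun j x => arc_test b j x.1 * arc_test d j x.2)%E
    (fun x => (\1_(`]b, +oo[ `*` `]d, +oo[)%classic x)%:E) (cst 1%E).
- by move=> j; exact: mt.
- by apply/measurable_EFinP; exact: measurable_indic.
- exists (~` sq); split => //; first by apply: measurableC; exact: measurable_unit_sq.
  move=> x /= h hx; apply: h => _.
  have [x1 x2] : I01 x.1 /\ I01 x.2 by move: hx; rewrite unit_sqE.
  have -> : (\1_(`]b, +oo[ `*` `]d, +oo[) x)%:E = ((b < x.1)%R%:R * (d < x.2)%R%:R : R)%:E.
    rewrite indicE -natrM mulnb; congr ((nat_of_bool _)%:R)%:E.
    apply/idP/idP; first by rewrite inE /= !in_itv /= !andbT => -[-> ->].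
    by move=> /andP[h1 h2]; rewrite inE; split; rewrite /= in_itv /= andbT.
  rewrite (_ : (fun j => _) = (fun j => (fine (arc_test b j x.1) * fine (arc_test d j x.2))%:E)).
    by apply: cvg_EFin; [exact: nearW|apply: cvgM; exact: cvg_arc_test].
  by apply/funext => j; rewrite EFinM !fineK// arc_test_fin.
- by apply: finite_measure_integrable_cst.
- apply: aeW => x j _ /=; rewrite gee0_abs ?mule_ge0 ?arc_test_ge0//.
  by rewrite -[1%E]mule1 lee_pmul ?arc_test_ge0 ?arc_test_le1.
by [].
Qed.

Let agree_rect b d :
  m1 (`]b, +oo[ `*` `]d, +oo[)%classic = m2 (`]b, +oo[ `*` `]d, +oo[)%classic.
Proof.
have h1 := @cvg_rect m1 b d m1_sq; have h2 := @cvg_rect m2 b d m2_sq.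
apply: (cvg_unique _ h1) => //.
rewrite (_ : (fun j => _) = (fun j => \int[m2]_x (arc_test b j x.1 * arc_test d j x.2))%E)//.
by apply/funext => j; exact: agree_test2.
Qed.

Lemma poisson_unique (A : set T2) : measurable A -> m1 A = m2 A.
Proof.
pose G : set (set T2) := [set X | exists b d, X = (`]b, +oo[ `*` `]d, +oo[)%classic].
have itvI (a b : R) : `]a, +oo[ `&` `]b, +oo[ = `]Num.max a b, +oo[%classic.
  by apply/seteqP; split => x /=; rewrite !in_itv /= !andbT gt_max => /andP.
have cov (S : set R) : \bigcup_k (S `*` `](- k%:R : R), +oo[) = S `*` setT.
  apply/seteqP; split => [x [k _ [? _]]//|x [Sx _]].
  have [k hk] : exists k, - x.2 < k%:R.
    by exists (Num.trunc `|x.2|).+1; apply: le_lt_trans (truncnS_gt _); rewrite -normrN ler_norm.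
  by exists k => //; split => //=; rewrite in_itv /= andbT ltrNl.
have cov' (S : set R) : \bigcup_k (`](- k%:R : R), +oo[ `*` S) = setT `*` S.
  apply/seteqP; split => [x [k _ [_ ?]]//|x [_ Sx]].
  have [k hk] : exists k, - x.1 < k%:R.
    by exists (Num.trunc `|x.1|).+1; apply: le_lt_trans (truncnS_gt _); rewrite -normrN ler_norm.
  by exists k => //; split => //=; rewrite in_itv /= andbT ltrNl.
(* The preimage of a ray under a projection is a countable union of quadrants. *)
have mG : (@measurable _ T2) = <<s G >>.
  apply/seteqP; split; last first.
    apply: smallest_sub; first exact: sigma_algebra_measurable.
    by move=> _ [b [d ->]]; exact: measurableX.
  apply: smallest_sub; first exact: smallest_sigma_algebra.
  have gen (X : set R) : measurable X -> <<s [set A | exists x, A = `]x, +oo[%classic] >> X.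
    by move=> mX; have : (@RGenOInfty.G R).-sigma.-measurable X by rewrite -RGenOInfty.measurableE.
  move=> X [] [Y mY <-]; rewrite setTI.
  - suff : (preimage_set_system setT fst <<s [set A | exists x : R, A = `]x, +oo[%classic] >>
        : set (set T2)) `<=` <<s G >>.
      by apply; exists Y; [exact: gen|rewrite setTI].
    rewrite -g_sigma_preimageE; apply: smallest_sub; first exact: smallest_sigma_algebra.
    move=> _ [_ [x ->] <-]; rewrite setTI.
    have -> : fst @^-1` `]x, +oo[ = `]x, +oo[ `*` setT :> set T2.
      by apply/seteqP; split => y //= [].
    rewrite -cov; apply: sigma_algebra_bigcup => k.
    by apply: sub_sigma_algebra; exists x, (- k%:R).
  - suff : (preimage_set_system setT snd <<s [set A | exists x : R, A = `]x, +oo[%classic] >>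
        : set (set T2)) `<=` <<s G >>.
      by apply; exists Y; [exact: gen|rewrite setTI].
    rewrite -g_sigma_preimageE; apply: smallest_sub; first exact: smallest_sigma_algebra.
    move=> _ [_ [x ->] <-]; rewrite setTI.
    have -> : snd @^-1` `]x, +oo[ = setT `*` `]x, +oo[ :> set T2.
      by apply/seteqP; split => y //= [].
    rewrite -cov'; apply: sigma_algebra_bigcup => k.
    by apply: sub_sigma_algebra; exists (- k%:R), x.
apply: (measure_unique G (fun k => (`](- k%:R : R), +oo[ `*` `](- k%:R : R), +oo[)%classic)) => //.
- move=> _ _ [b [d ->]] [b' [d' ->]]; exists (Num.max b b'), (Num.max d d').
  by rewrite -!itvI setXI.
- by move=> k; exists (- k%:R), (- k%:R).
- apply/seteqP; split => // x _.
  have [k hk] : exists k, Num.max (- x.1) (- x.2) < k%:R.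
    by exists (Num.trunc `|Num.max (- x.1) (- x.2)|).+1; apply: le_lt_trans (truncnS_gt _); rewrite ler_norm.
  move: hk; rewrite gt_max => /andP[h1 h2].
  by exists k => //; split => /=; rewrite in_itv /= andbT ltrNl.
- by move=> _ [b [d ->]]; exact: agree_rect.
- by move=> k; rewrite ltey_eq fin_num_measure//; exact: measurableX.
Qed.

End Agreement.
End TorusUniqueness.

(** * Identification of the Clark measure *)

Section Density.
Local Open Scope ereal_scope.
Context d (T : measurableType d) (R : realType).
Variables (mu : {measure set T -> \bar R}) (w : T -> \bar R).
Hypothesis mw : measurable_fun setT w.
Hypothesis w0 : forall x, 0 <= w x.
Hypothesis w_fin : forall x, w x \is a fin_num.

Definition density (A : set T) : \bar R := \int[mu]_(x in A) w x.

Let density0 : density set0 = 0.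
Proof. exact: integral_set0. Qed.

Let density_ge0 A : 0 <= density A.
Proof. exact: integral_ge0. Qed.

Let density_sigma_additive : semi_sigma_additive density.
Proof.
move=> F mF tF mUF; rewrite /density ge0_integral_bigcup//; last exact: measurable_funTS.
by apply: is_cvg_ereal_nneg_natsum_cond => n _ _; exact: integral_ge0.
Qed.

HB.instance Definition _ := isMeasure.Build _ _ _ density
  density0 density_ge0 density_sigma_additive.

Definition density_measure : {measure set T -> \bar R} := density.

Import HBNNSimple.

(** Monotone approximation by simple functions. It is stated for any measure that agrees with the
    density on measurable sets, so that it also covers restrictions. *)
Lemma ge0_integral_density (nu : {measure set T -> \bar R}) (f : T -> \bar R) :
  (forall A, measurable A -> nu A = density A) ->
  measurable_fun setT f -> (forall x, 0 <= f x) ->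
  \int[nu]_x f x = \int[mu]_x (f x * w x).
Proof.
move=> nuE mf f0; pose f_ := nnsfun_approx measurableT mf.
have mf_ n : measurable_fun setT (EFin \o f_ n) by apply/measurable_EFinP.
have nd x : {homo (fun n => (f_ n x)%:E) : a b / (a <= b)%N >-> a <= b}.
  by move=> a b ab; rewrite lee_fin; exact/lefP/nd_nnsfun_approx.
transitivity (limn (fun n => \int[nu]_x (f_ n x)%:E)).
  rewrite -monotone_convergence//; last by move=> n x _; rewrite lee_fin.
  by apply: eq_integral => x _; apply/esym/cvg_lim => //; exact: cvg_nnsfun_approx.
rewrite [X in limn X](_ : _ = (fun n => \int[mu]_x ((f_ n x)%:E * w x))); last first.
  apply/funext => n; under eq_integral do rewrite fimfunE -fsumEFin//.
  rewrite ge0_integral_fsum//; last 2 first.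
  - by move=> r /=; apply: measurableT_comp => //; exact: measurableT_comp.
  - by move=> r t _; rewrite EFinM nnfun_muleindic_ge0.
  transitivity (\int[mu]_x ((\sum_(k \in range (f_ n)) (k * \1_(f_ n @^-1` [set k]) x)%:E) * w x)); last first.
    by apply: eq_integral => x _; rewrite fsumEFin// -fimfunE.
  under [RHS]eq_integral => x _.
    rewrite ge0_mule_fsuml; last by move=> k; rewrite EFinM nnfun_muleindic_ge0.
    over.
  rewrite ge0_integral_fsum//; last 2 first.
  - move=> r; apply: emeasurable_funM => //.
    by apply: measurableT_comp => //; exact: measurableT_comp.
  - by move=> r t _; rewrite mule_ge0// EFinM nnfun_muleindic_ge0.
  apply: eq_fsbigr => k _; rewrite integralZl_indic_nnsfun// integral_indic// setIT nuE//.
  under [RHS]eq_integral do rewrite EFinM -muleA.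
  have [k0|k0] := ltP k 0%R.
    rewrite preimage_nnfun0// /density integral_set0 mule0 integral0_eq// => x _.
    by rewrite indic0 mul0e mule0.
  rewrite ge0_integralZl//.
  - congr (_ * _); rewrite /density [LHS]integral_mkcond; apply: eq_integral => x _.
    by rewrite patchE indicE; case: ifPn => _; rewrite ?mul1e ?mul0e.
  - apply: emeasurable_funM => //.
    exact/measurable_EFinP/measurable_indic.
  - by move=> x _; rewrite mule_ge0.
rewrite -monotone_convergence//.
- apply: eq_integral => x _; apply/cvg_lim => //.
  by apply: cvgeZr => //; exact: cvg_nnsfun_approx.
- by move=> n; apply: emeasurable_funM; [exact: mf_|exact: mw].
- by move=> n x _; rewrite mule_ge0// lee_fin.
- by move=> x _ a b ab; apply: lee_wpmul2r => //; exact: nd.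
Qed.

End Density.

Section Restriction.
Local Open Scope ereal_scope.
Context d (T : measurableType d) (R : realType).

Lemma ge0_integral_mrestr (mu nu : {measure set T -> \bar R}) (D : set T) (f : T -> \bar R) :
  measurable D -> (forall A, measurable A -> nu A = mu (A `&` D)) ->
  measurable_fun setT f -> (forall x, 0 <= f x) ->
  \int[nu]_x f x = \int[mu]_(x in D) f x.
Proof.
move=> mD nuE mf f0.
have m1 : measurable_fun setT (fun x => (\1_D x)%:E : \bar R).
  exact/measurable_EFinP/measurable_indic.
have h0 x : 0 <= (\1_D x)%:E :> \bar R by rewrite lee_fin.
rewrite (@ge0_integral_density _ _ _ mu _ m1 h0 _ nu f)//.
  rewrite [RHS]integral_mkcond; apply: eq_integral => x _.
  by rewrite patchE indicE; case: ifPn => _; rewrite ?mule1 ?mule0.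
by move=> A mA; rewrite nuE// /density integral_indic// setIC.
Qed.

Lemma pushforward_measure_exists d' (Y : measurableType d') (mu : {measure set T -> \bar R})
    (phi : T -> Y) : measurable_fun setT phi ->
  exists nu : {measure set Y -> \bar R}, forall g : Y -> \bar R,
    measurable_fun setT g -> (forall y, 0 <= g y) -> \int[nu]_y g y = \int[mu]_x g (phi x).
Proof.
move=> mphi; unshelve refine (ex_intro _ (pushforward mu phi : {measure set Y -> \bar R}) _) => //.
by move=> g mg g0; rewrite /= ge0_integral_pushforward// preimage_setT.
Qed.

End Restriction.

Section GraphMeasure.
Local Open Scope ereal_scope.
Variable R : realType.
Local Notation leb := (@lebesgue_measure R).
Local Notation I01 := (@unit_int R).
Local Notation T2 := (R * R)%type.

(** The candidate for the Clark measure: the image of [W dm] on a graph, to which one weighted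
    vertical line is added per element of [zs]. *)
Lemma graph_measure_exists (I : Type) (zs : seq I) (c x : I -> R) (W beta : R -> R) :
  (forall i, (0 <= c i)%R) -> (forall t, (0 <= W t)%R) ->
  measurable_fun setT W -> measurable_fun setT beta ->
  exists mu : {measure set T2 -> \bar R}, forall g : T2 -> \bar R,
    measurable_fun setT g -> (forall y, 0 <= g y) ->
    \int[mu]_y g y = \int[leb]_(t in I01) (g (t, beta t) * (W t)%:E)
      + \sum_(i <- zs) (c i)%:E * \int[leb]_(s in I01) g (x i, s).
Proof.
move=> c0 W0 mW mbeta; have mI := @measurable_unit_int R.
elim: zs => [|i zs [mu IH]].
  pose w (t : measurableTypeR R) : \bar R := (W t * \1_I01 t)%:E.
  have mw : measurable_fun setT w.
    by apply/measurable_EFinP; apply: measurable_funM => //; exact: measurable_indic.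
  have w0 t : 0 <= w t by rewrite lee_fin mulr_ge0.
  have mgr : measurable_fun setT ((fun t => (t, beta t)) : measurableTypeR R -> T2).
    exact: measurable_fun_pair.
  have [nu nuE] := pushforward_measure_exists (density_measure leb mw w0) mgr.
  exists nu => g mg g0; rewrite big_nil adde0 nuE//.
  have mgc : measurable_fun setT (fun t : measurableTypeR R => g (t, beta t)).
    exact: (measurableT_comp mg mgr).
  rewrite (@ge0_integral_density _ _ _ leb w mw w0 _ (density_measure leb mw w0) (fun t => g (t, beta t)))//.
  rewrite [RHS]integral_mkcond; apply: eq_integral => t _.
  by rewrite patchE /w indicE; case: ifPn => _; rewrite ?mulr1 ?mulr0 ?mule0.
have mpr : measurable_fun setT ((fun s => (x i, s)) : measurableTypeR R -> T2).
  exact: measurable_fun_pair.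
have [nu nuE] := pushforward_measure_exists (mrestr leb mI) mpr.
pose k : {nonneg R} := NngNum (c0 i).
exists (measure_add mu (mscale k nu)) => g mg g0.
rewrite ge0_integral_measure_add// IH// ge0_integral_mscale// nuE//.
have mgc : measurable_fun setT (fun s : measurableTypeR R => g (x i, s)).
  exact: (measurableT_comp mg mpr).
rewrite (@ge0_integral_mrestr _ _ _ leb (mrestr leb mI) I01 (fun s => g (x i, s)))//.
by rewrite big_cons [RHS]addeCA addeC.
Qed.

End GraphMeasure.

(** * From nonnegative to integrable functions *)

Section Transfer.
Variables (R : realType) (I : eqType) (zs : seq I) (c x : I -> R) (W beta : R -> R).
Local Notation leb := (@lebesgue_measure R).
Local Notation I01 := (@unit_int R).
Local Notation sq := (@unit_sq R).
Local Notation T2 := (R * R)%type.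
Variable sigma : {measure set T2 -> \bar R}.
Hypothesis c0 : forall i, 0 <= c i.
Hypothesis W0 : forall t, 0 <= W t.
Hypothesis mW : measurable_fun setT W.
Hypothesis mbeta : measurable_fun setT beta.
Hypothesis x_unit : forall i, i \in zs -> I01 (x i).
Hypothesis beta_unit : forall t, W t = 0 \/ I01 (beta t).
Hypothesis sigmaE : forall g : T2 -> \bar R, measurable_fun setT g -> (forall y, 0 <= g y)%E ->
  (\int[sigma]_(y in sq) g y = \int[leb]_(t in I01) (g (t, beta t) * (W t)%:E)
      + \sum_(i <- zs) (c i)%:E * \int[leb]_(s in I01) g (x i, s))%E.

Let integrable_ge0 (f : R -> R) : measurable_fun setT f -> (forall t, 0 <= f t) ->
  (\int[leb]_(t in I01) (f t)%:E < +oo)%E -> leb.-integrable I01 (EFin \o f).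
Proof.
move=> mf f0 foo; apply/integrableP; split.
  by apply: measurable_funTS; apply/measurable_EFinP.
by under eq_integral do rewrite /= ger0_norm//.
Qed.

Let graph_fun (G : T2 -> R) : measurable_fun setT G -> measurable_fun setT (fun t => G (t, beta t) * W t).
Proof.
move=> mG; apply: measurable_funM => //.
by apply: (measurableT_comp mG); exact: measurable_fun_pair.
Qed.

Let fiber_fun (G : T2 -> R) i : measurable_fun setT G -> measurable_fun setT (fun s => G (x i, s)).
Proof. by move=> mG; apply: (measurableT_comp mG); exact: measurable_fun_pair. Qed.

Let transfer_ge0 (G : T2 -> R) : measurable_fun setT G -> (forall y, 0 <= G y) ->
  (\int[sigma]_(y in sq) (G y)%:E < +oo)%E ->
  [/\ leb.-integrable I01 (EFin \o (fun t => G (t, beta t) * W t)),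
      forall i, i \in zs -> c i != 0 -> leb.-integrable I01 (EFin \o (fun s => G (x i, s))) &
      \int[sigma]_(y in sq) G y = \int[leb]_(t in I01) (G (t, beta t) * W t)
        + \sum_(i <- zs) c i * \int[leb]_(s in I01) G (x i, s)].
Proof.
move=> mG G0 Goo.
have mGE : measurable_fun setT (EFin \o G) by apply/measurable_EFinP.
have GE0 y : (0 <= (EFin \o G) y)%E by rewrite lee_fin.
have := sigmaE mGE GE0; rewrite /= => e.
set A := (\int[leb]_(t in I01) (G (t, beta t) * W t)%:E)%E.
have eA : (\int[leb]_(t in I01) ((G (t, beta t))%:E * (W t)%:E) = A)%E.
  by apply: eq_integral => t _; rewrite EFinM.
rewrite eA in e.
pose B i := (\int[leb]_(s in I01) (G (x i, s))%:E)%E.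
have A0 : (0 <= A)%E by apply: integral_ge0 => t _; rewrite lee_fin mulr_ge0.
have B0 i : (0 <= B i)%E by apply: integral_ge0 => t _; rewrite lee_fin.
have cB0 i : (0 <= (c i)%:E * B i)%E by rewrite mule_ge0// lee_fin.
have S0 (s : seq I) : (0 <= \sum_(i <- s) (c i)%:E * B i)%E by apply: sume_ge0.
have Aoo : (A < +oo)%E.
  by apply: le_lt_trans Goo; rewrite e leeDl// S0.
have cBoo i : i \in zs -> ((c i)%:E * B i < +oo)%E.
  move=> iz; apply: le_lt_trans Goo; rewrite e.
  apply: (@le_trans _ _ (\sum_(i <- zs) (c i)%:E * B i)%E); last by rewrite leeDr.
  by rewrite (big_rem i iz) /= leeDl// S0.
have Boo i : i \in zs -> c i != 0 -> (B i < +oo)%E.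
  move=> iz ci; have := cBoo i iz; rewrite !ltey; apply: contra => /eqP ->.
  by rewrite gt0_muley// lte_fin lt_def ci c0.
split.
- by apply: integrable_ge0 => // [|t]; [exact: graph_fun|rewrite mulr_ge0].
- by move=> i iz ci; apply: integrable_ge0; [exact: fiber_fun|by []|exact: Boo].
rewrite /Rintegral e -/A.
have -> : (\sum_(i <- zs) (c i)%:E * B i = (\sum_(i <- zs) c i * fine (B i))%:E)%E.
  rewrite -sumEFin; apply: eq_big_seq => i iz.
  (* On a line of mass zero the integral [B i] may be infinite; the convention [0 * +oo = 0]
     discards it on both sides. *)
  have [->|ci] := eqVneq (c i) 0; first by rewrite mul0r mul0e.
  by rewrite EFinM fineK// ge0_fin_numE// Boo.
by rewrite fineD// ge0_fin_numE.
Qed.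

Lemma transfer (F : T2 -> R) : sigma.-integrable sq (EFin \o F) ->
  leb.-integrable I01 (EFin \o (fun t => F (t, beta t) * W t)) /\
  \int[sigma]_(y in sq) F y = \int[leb]_(t in I01) (F (t, beta t) * W t)
        + \sum_(i <- zs) c i * \int[leb]_(s in I01) F (x i, s).
Proof.
move=> iF.
have mI := @measurable_unit_int R; have mS := @measurable_unit_sq R.
(* [F] is measurable only on the square; extension by zero makes the formula for nonnegative
   functions applicable to its positive and negative parts. *)
pose F' := F \_ sq.
have mF' : measurable_fun setT F'.
  have mF : measurable_fun sq F by apply/measurable_EFinP; exact: measurable_int iF.
  exact: (measurable_restrictT F mS).1 mF.
pose P y := Num.max (F' y) 0; pose M y := Num.max (- F' y) 0.
have F'E y : F' y = P y - M y.
  by rewrite /P /M; case: (leP (F' y) 0) => h; [rewrite max_l ?oppr_ge0// sub0r opprK|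
     rewrite max_r ?oppr_le0 ?(ltW h)// subr0].
have P0 y : 0 <= P y by rewrite le_max lexx orbT.
have M0 y : 0 <= M y by rewrite le_max lexx orbT.
have mP : measurable_fun setT P by apply: measurable_maxr.
have mM : measurable_fun setT M by apply: measurable_maxr => //; exact: measurableT_comp.
have F'F y : sq y -> F' y = F y by move=> h; rewrite /F' patchE mem_set.
have le_int (Q : T2 -> R) : measurable_fun setT Q -> (forall y, 0 <= Q y) ->
    (forall y, sq y -> Q y <= `|F y|) ->
    sigma.-integrable sq (EFin \o Q) /\ (\int[sigma]_(y in sq) (Q y)%:E < +oo)%E.
  move=> mQ Q0 QF.
  have iQ : sigma.-integrable sq (EFin \o Q).
    apply: (le_integrable mS _ _ iF); first by apply: measurable_funTS; apply/measurable_EFinP.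
    by move=> y sy; rewrite /= lee_fin ger0_norm// QF.
  split => //; have /integrableP[_] := iQ.
  by under eq_integral do rewrite /= ger0_norm//.
have [iP Poo] : sigma.-integrable sq (EFin \o P) /\ (\int[sigma]_(y in sq) (P y)%:E < +oo)%E.
  by apply: le_int => // y sy; rewrite /P F'F// ge_max ler_norm normr_ge0.
have [iM Moo] : sigma.-integrable sq (EFin \o M) /\ (\int[sigma]_(y in sq) (M y)%:E < +oo)%E.
  by apply: le_int => // y sy; rewrite /M F'F// ge_max -normrN ler_norm normr_ge0.
have [iPW iPx eP] := transfer_ge0 mP P0 Poo.
have [iMW iMx eM] := transfer_ge0 mM M0 Moo.
have graphE t : I01 t -> F (t, beta t) * W t = P (t, beta t) * W t - M (t, beta t) * W t.
  move=> tI; rewrite -mulrBl -F'E; have [->|bI] := beta_unit t; first by rewrite !mulr0.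
  by rewrite F'F// unit_sqE.
split.
  have h := integrableB mI iPW iMW.
  apply: eq_integrable h; first exact: mI.
  by move=> t; rewrite inE => tI /=; rewrite graphE.
have -> : \int[sigma]_(y in sq) F y = \int[sigma]_(y in sq) (P y - M y).
  by apply: eq_Rintegral => y; rewrite inE => ys; rewrite -F'E F'F.
rewrite RintegralB// eP eM.
have -> : \int[leb]_(t in I01) (F (t, beta t) * W t) =
    \int[leb]_(t in I01) (P (t, beta t) * W t - M (t, beta t) * W t).
  by apply: eq_Rintegral => t; rewrite inE => tI; rewrite graphE.
rewrite RintegralB// opprD addrACA; congr (_ + _).
rewrite -sumrB; apply: eq_big_seq => i iz; rewrite -mulrBr.
have [->|ci] := eqVneq (c i) 0; first by rewrite !mul0r.
congr (_ * _); rewrite -RintegralB//; [|exact: iPx|exact: iMx].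
apply: eq_Rintegral => s; rewrite inE => sI; rewrite -F'E F'F// unit_sqE.
by split => //; exact: x_unit.
Qed.

End Transfer.

(** * The formula for the Clark measure and its boundary masses *)

Section ClarkMeasure.
Variables (R : realType) (n : nat) (p1 p2 : {poly R[i]}) (alpha : R[i]).
Variable zs : seq (R[i] * R[i]).
Variable sigma : {measure set (R * R)%type -> \bar R}.
Local Notation leb := (@lebesgue_measure R).
Local Notation I01 := (@unit_int R).
Local Notation sq := (@unit_sq R).
Local Notation T2 := (R * R)%type.
Local Notation q1 := (refl n p1).
Local Notation q2 := (refl n p2).
Local Notation N := (clark_num n p1 p2 alpha).
Local Notation D := (clark_den n p1 p2 alpha).
Local Notation phi := (phi n p1 p2).

Hypothesis size_p1 : (size p1 <= n.+1)%N.
Hypothesis size_p2 : (size p2 <= n.+1)%N.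
Hypothesis stable : forall z1 z2, cmod z1 < 1 -> cmod z2 < 1 -> peval p1 p2 z1 z2 != 0.
Hypothesis q1_neq0 : q1 != 0.
Hypothesis coprime_pq : no_common_factor (poly2 p1 p2) (poly2 q2 q1).
Hypothesis alpha1 : cmod alpha = 1.
Hypothesis uniq_zs : uniq zs.
Hypothesis mem_zs : forall z, z \in zs <->
  [/\ cmod z.1 = 1, cmod z.2 = 1 & peval p1 p2 z.1 z.2 = 0].
Hypothesis clark : forall z1 z2 : R[i], cmod z1 < 1 -> cmod z2 < 1 ->
  ((1 - cmod (phi z1 z2) ^+ 2) / cmod (alpha - phi z1 z2) ^+ 2)%:E
  = (\int[sigma]_(x in sq) (poisson z1 z2 (expi x.1) (expi x.2))%:E)%E.

Let c0 : cmod (0 : R[i]) < 1. Proof. by rewrite cmod0. Qed.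
Let mS : measurable (sq : set T2). Proof. exact: measurable_unit_sq. Qed.

Let poisson_ge0 (z1 z2 w1 w2 : R[i]) : cmod z1 < 1 -> cmod z2 < 1 -> 0 <= poisson z1 z2 w1 w2.
Proof. by move=> z11 z21; rewrite poisson_pk mulr_ge0// pk_ge0// ltW. Qed.

Let measurable_poisson (z1 z2 : R[i]) :
  measurable_fun setT (fun x : T2 => (poisson z1 z2 (expi x.1) (expi x.2))%:E).
Proof.
apply/measurable_EFinP; under eq_fun do rewrite poisson_pk.
apply: measurable_funM; apply: measurable_pk; try exact: cmeasurable_cst.
  by apply: cmeasurable_expi; exact: measurable_fst.
by apply: cmeasurable_expi; exact: measurable_snd.
Qed.

Lemma clark_le1 z1 z2 : cmod z1 < 1 -> cmod z2 < 1 -> cmod (phi z1 z2) <= 1.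
Proof.
move=> z11 z21; have [e|ne] := eqVneq (phi z1 z2) alpha; first by rewrite e alpha1.
have : 0 <= (1 - cmod (phi z1 z2) ^+ 2) / cmod (alpha - phi z1 z2) ^+ 2.
  rewrite -lee_fin clark//; apply: integral_ge0 => x _.
  by rewrite lee_fin poisson_ge0.
rewrite pmulr_lge0 ?invr_gt0 ?exprn_gt0 ?cmod_gt0 ?subr_eq0 1?eq_sym// subr_ge0.
by rewrite expr_le1// cmod_ge0.
Qed.

Lemma phi_z1_0 (z : R[i]) : phi z 0 = q2.[z] / p1.[z].
Proof. by rewrite /Defs.phi /ptilde /peval !mul0r !addr0. Qed.

Lemma clark_inner0 z : cmod z < 1 -> cmod q2.[z] <= cmod p1.[z].
Proof.
move=> z1; have := clark_le1 z1 c0; rewrite phi_z1_0 cmod_div.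
by rewrite ler_pdivrMr ?mul1r// cmod_gt0; exact: (stable_p1_disc stable).
Qed.

Let sq_poisson (m : {measure set T2 -> \bar R}) :
  (\int[m]_(x in sq) (poisson 0 0 (expi x.1) (expi x.2))%:E = m sq)%E.
Proof.
rewrite -[RHS]mul1e -integral_cst//; apply: eq_integral => x _.
rewrite poisson_pk /pk cmod0 !subr0 !cmod_expi expr0n /= subr0 !expr1n divr1.
by rewrite mulr1.
Qed.

Lemma clark_sq_fin : (sigma sq < +oo)%E.
Proof. by rewrite -sq_poisson -clark// ltry. Qed.

(** A zero measure would force [|phi| = 1] throughout the bidisc. At [z2 = 0] this gives
    [|p1| <= |q2|], hence [|p1| = |p2|] on the circle, and [p1 q1 - p2 q2] would vanish there. *)
Lemma clark_sq_neq0 : sigma sq != 0%E.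
Proof.
apply/eqP => s0.
have h z1 z2 : cmod z1 < 1 -> cmod z2 < 1 -> 1 <= cmod (phi z1 z2).
  move=> z11 z21; have [e|ne] := eqVneq (phi z1 z2) alpha; first by rewrite e alpha1.
  have := clark z11 z21.
  rewrite (null_set_integral mS _ s0); last by apply: measurable_funTS; exact: measurable_poisson.
  have ap : alpha - phi z1 z2 != 0 by rewrite subr_eq0 eq_sym.
  move=> [] /eqP; rewrite mulf_eq0 invr_eq0 expf_eq0 /= cmod_eq0 (negbTE ap) orbF subr_eq0 => /eqP e1.
  by rewrite -(@expr_ge1 _ 2)// ?cmod_ge0// -e1.
have le z : cmod z < 1 -> cmod p1.[z] <= cmod q2.[z].
  move=> z1; have := h z 0 z1 c0; rewrite phi_z1_0 cmod_div.
  by rewrite ler_pdivlMr ?mul1r// cmod_gt0; exact: (stable_p1_disc stable).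
have det0 := clark_det_neq0 stable q1_neq0 coprime_pq.
have [S [mS' S0] hS] := circle_roots_negligible det0.
have : (leb I01 <= leb S)%E.
  apply: le_measure; rewrite ?inE//; first exact: measurable_unit_int.
  move=> t tI; apply: hS => //; set w := expi t.
  have w1 : cmod w = 1 by exact: cmod_expi.
  have : cmod p1.[w] = cmod p2.[w].
    apply/eqP; rewrite eq_le (stable_le stable) ?w1// andbT.
    have := disc_le_closure le (z := w); rewrite w1 lexx => /(_ isT).
    by rewrite horner_refl// cmodM cmodX w1 expr1n mul1r cmod_conj.
  move=> uv; rewrite hornerD hornerN !hornerM !horner_refl//.
  have -> : p1.[w] * (w ^+ n * (p1.[w])^*%C) - p2.[w] * (w ^+ n * (p2.[w])^*%C) =
     w ^+ n * (p1.[w] * (p1.[w])^*%C - p2.[w] * (p2.[w])^*%C) by ring.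
  by rewrite !mul_conjc uv subrr mulr0.
by rewrite S0 lebesgue_unit_int lee_fin ler10.
Qed.

(** At such a point the quotient in the Clark identity is 0 by convention, while Harnack bounds the
    integral below by a positive multiple of the total mass. *)
Lemma clark_phi_neq z1 z2 : cmod z1 < 1 -> cmod z2 < 1 -> phi z1 z2 != alpha.
Proof.
move=> z11 z21; apply/eqP => e.
have := clark z11 z21; rewrite e subrr cmod0 expr0n /= invr0 mulr0 => h.
pose k := (1 - cmod z1) / (1 + cmod z1) * ((1 - cmod z2) / (1 + cmod z2)).
have k0 : 0 < k by rewrite !mulr_gt0 ?invr_gt0 ?subr_gt0// ltr_wpDr ?cmod_ge0.
have : (k%:E * sigma sq <= 0%:E)%E.
  rewrite h -integral_cst//; apply: ge0_le_integral => //.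
  - by move=> x _; rewrite lee_fin ltW.
  - by apply: measurable_funTS; exact: measurable_poisson.
  move=> x _; rewrite lee_fin poisson_pk.
  have d (z : R[i]) : cmod z < 1 -> 0 <= (1 - cmod z) / (1 + cmod z).
    by move=> z1'; rewrite divr_ge0 ?subr_ge0 ?addr_ge0 ?cmod_ge0// ltW.
  by rewrite ler_pM ?d ?pk_ge ?cmod_expi.
rewrite leNgt => /negP; apply; rewrite mule_gt0// ?lte_fin//.
by rewrite lt_def clark_sq_neq0 measure_ge0.
Qed.

Lemma clark_den_neq z1 z2 : cmod z1 < 1 -> cmod z2 < 1 -> D.[z1] != z2 * N.[z1].
Proof.
move=> z11 z21; have := clark_phi_neq z11 z21; apply: contra => /eqP e.
have pz := stable z11 z21; apply/eqP; apply: (mulIf pz); rewrite /Defs.phi divfK//.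
move/eqP: e; rewrite /ptilde /peval /clark_num /clark_den !(hornerD, hornerN, hornerZ) -subr_eq0.
move=> /eqP e; apply/eqP; rewrite -subr_eq0 -oppr_eq0; apply/eqP; rewrite -[RHS]e.
by rewrite /peval; ring.
Qed.

Let W t := Walpha n p1 p2 alpha (expi t).
Let beta t := ang ((Balpha n p1 p2 alpha (expi t))^*%C).
Let mass (z : R[i] * R[i]) := clark_mass n p1 p2 alpha z.1.
Let xs (z : R[i] * R[i]) := ang z.1.
Let ts := [seq z.1 | z <- zs & N.[z.1] == 0].

Let W_ge0 t : 0 <= W t.
Proof.
rewrite /W /Walpha divr_ge0 ?sqr_ge0// subr_ge0 lerXn2r ?nnegrE ?cmod_ge0//.
by apply: (stable_le stable); rewrite cmod_expi.
Qed.

Let W_num0 t : N.[expi t] = 0 -> W t = 0.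
Proof.
rewrite /W /Walpha /clark_num hornerD hornerN hornerZ => ->.
by rewrite cmod0 expr0n /= invr0 mulr0.
Qed.

Let me : cmeasurable (fun t : R => expi t).
Proof. exact: (cmeasurable_expi (@measurable_id _ R setT)). Qed.

Let mW : measurable_fun setT W.
Proof.
apply: measurable_fun_div.
  by apply: measurable_funB; apply: measurable_cmod_sqr; exact: cmeasurable_horner.
apply: measurable_cmod_sqr; apply: cmeasurableB; first exact: cmeasurable_horner.
by apply: cmeasurableM; [exact: cmeasurable_cst|exact: cmeasurable_horner].
Qed.

Let mbeta : measurable_fun setT beta.
Proof.
apply: measurable_ang; apply: cmeasurable_conj; apply: cmeasurableM; first exact: cmeasurable_horner.
by apply: cmeasurableV; exact: cmeasurable_horner.
Qed.

Let beta_spec t : W t = 0 \/ I01 (beta t) /\ expi (beta t) = (Balpha n p1 p2 alpha (expi t))^*%C.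
Proof.
have [N0|N0] := eqVneq N.[expi t] 0; first by left; exact: W_num0.
right; have [B1 _] := Balpha_conj size_p1 size_p2 alpha1 (cmod_expi t) N0.
by split; [exact: ang_unit_int|exact: expi_ang].
Qed.

Let zsP z : z \in zs -> [/\ cmod z.1 = 1, cmod z.2 = 1, p2.[z.1] != 0 & z.2 = - p1.[z.1] / p2.[z.1]].
Proof.
move=> /mem_zs[z1 z2 pz].
have v0 : p2.[z.1] != 0.
  have [p10|p10] := eqVneq p1.[z.1] 0.
    exact: (no_common_circle_zero size_p1 size_p2 coprime_pq z1 p10).
  by apply: contra p10 => /eqP h; move: pz; rewrite /peval h mulr0 addr0 => ->.
split => //; apply: (mulIf v0); rewrite divfK//.
by apply/eqP; rewrite -addr_eq0 addrC; apply/eqP.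
Qed.

(** On the torus a zero of [p] is determined by its first coordinate, through [z2 = - p1 / p2]. *)
Let uniq_ts : uniq ts.
Proof.
rewrite map_inj_in_uniq ?filter_uniq// => z z'.
rewrite !mem_filter => /andP[_ /zsP[_ _ _ e]] /andP[_ /zsP[_ _ _ e']] e1.
by rewrite [z]surjective_pairing [z']surjective_pairing e e' e1.
Qed.

Let ts_circle tau : tau \in ts -> cmod tau = 1 /\ N.[tau] = 0.
Proof. by case/mapP => z; rewrite mem_filter => /andP[/eqP N0 /zsP[z1 _ _ _]] ->. Qed.

Let ts_all tau : cmod tau = 1 -> N.[tau] = 0 -> tau \in ts.
Proof.
move=> t1 N0.
have v0 := boundary_p2_neq0 size_p1 size_p2 stable coprime_pq alpha1 t1 N0.
have uv := boundary_cmod size_p1 alpha1 t1 N0.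
apply/mapP; exists (tau, - p1.[tau] / p2.[tau]) => //.
rewrite mem_filter /= N0 eqxx /=; apply/mem_zs; split => //=.
  by rewrite cmod_div cmodN uv divff// cmod_eq0.
by rewrite /peval divfK// subrr.
Qed.

Let mass_sum (f : R[i] -> R) :
  \sum_(z <- zs) mass z * f z.1 = \sum_(tau <- ts) clark_mass n p1 p2 alpha tau * f tau.
Proof.
rewrite /ts big_map big_filter [RHS]big_mkcond /=; apply: eq_bigr => z _.
by rewrite /mass /clark_mass; case: ifP => // _; rewrite mul0r.
Qed.

Let xs_unit z : z \in zs -> I01 (xs z).
Proof. by move=> /zsP[z1 _ _ _]; exact: ang_unit_int. Qed.

Let expi_xs z : z \in zs -> expi (xs z) = z.1.
Proof. by move=> /zsP[z1 _ _ _]; exact: expi_ang. Qed.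

Section Representation.
Variable mu : {measure set T2 -> \bar R}.
Hypothesis muE : forall g : T2 -> \bar R, measurable_fun setT g -> (forall y, 0 <= g y)%E ->
  (\int[mu]_y g y = \int[leb]_(t in I01) (g (t, beta t) * (W t)%:E)
      + \sum_(z <- zs) (mass z)%:E * \int[leb]_(s in I01) g (xs z, s))%E.

Let mu_sqE (g : T2 -> \bar R) : measurable_fun setT g -> (forall y, 0 <= g y)%E ->
  (\int[mu]_(y in sq) g y = \int[leb]_(t in I01) (g (t, beta t) * (W t)%:E)
      + \sum_(z <- zs) (mass z)%:E * \int[leb]_(s in I01) g (xs z, s))%E.
Proof.
move=> mg g0; rewrite integral_mkcond muE; last 2 first.
- exact: (measurable_restrictT g mS).1 (measurable_funTS mg).
- by move=> y; rewrite patchE; case: ifP.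
congr (_ + _)%E.
  apply: eq_integral => t; rewrite inE => tI; rewrite patchE.
  have [->|[bI _]] := beta_spec t; first by rewrite !mule0.
  by rewrite mem_set// unit_sqE.
apply: eq_big_seq => z zin; congr (_ * _)%E; apply: eq_integral => s; rewrite inE => sI.
by rewrite patchE mem_set// unit_sqE; split => //; exact: xs_unit.
Qed.

Let mu_poisson z1 z2 : cmod z1 < 1 -> cmod z2 < 1 ->
  (\int[mu]_(x in sq) (poisson z1 z2 (expi x.1) (expi x.2))%:E =
   \int[sigma]_(x in sq) (poisson z1 z2 (expi x.1) (expi x.2))%:E)%E.
Proof.
move=> z11 z21; rewrite -clark// mu_sqE; [|exact: measurable_poisson|]; last first.
  by move=> y; rewrite lee_fin poisson_ge0.
have h := slice_poisson size_p1 size_p2 stable q1_neq0 coprime_pq alpha1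
  clark_inner0 clark_den_neq uniq_ts ts_circle ts_all z21 z11.
have -> : (\int[leb]_(t in I01) ((poisson z1 z2 (expi t) (expi (beta t)))%:E * (W t)%:E) =
   \int[leb]_(t in I01) (pk z1 (expi t) * (pk z2 (Balpha n p1 p2 alpha (expi t))^*%C *
       Walpha n p1 p2 alpha (expi t)))%:E)%E.
  apply: eq_integral => t _; rewrite poisson_pk -EFinM /= -/(W t).
  by have [->|[_ ->]] := beta_spec t; rewrite ?mulr0// mulrA.
rewrite h -mass_sum.
have -> : (\sum_(z <- zs) (mass z)%:E *
    \int[leb]_(s in I01) (poisson z1 z2 (expi (xs z)) (expi s))%:E =
    (\sum_(z <- zs) mass z * pk z1 z.1)%:E)%E.
  rewrite -sumEFin; apply: eq_big_seq => z zin; rewrite EFinM; congr (_ * _)%E.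
  under eq_integral do rewrite poisson_pk EFinM.
  rewrite ge0_integralZl//.
  - by rewrite pk_mass// mule1 expi_xs.
  - exact: measurable_unit_int.
  - apply: measurable_funTS; apply/measurable_EFinP.
    by apply: measurable_pk; [exact: cmeasurable_cst|exact: me].
  - by move=> s _; rewrite lee_fin pk_ge0// ltW.
  - by rewrite lee_fin pk_ge0// ltW.
by rewrite -EFinD subrK.
Qed.

Let mu_sq_fin : (mu sq < +oo)%E.
Proof. by rewrite -sq_poisson mu_poisson// -clark// ltry. Qed.

(** Only the traces on the square are known to be finite, so uniqueness is applied to the two
    restrictions. *)
Let same_measure (A : set T2) : measurable A -> sigma (A `&` sq) = mu (A `&` sq).
Proof.
pose m1 : {finite_measure set T2 -> \bar R} := mfrestr mS clark_sq_fin.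
pose m2 : {finite_measure set T2 -> \bar R} := mfrestr mS mu_sq_fin.
move=> mA; apply: (@poisson_unique _ m1 m2 _ _ _ A mA).
- by rewrite /m1 /= /mfrestr /mrestr setICl measure0.
- by rewrite /m2 /= /mfrestr /mrestr setICl measure0.
move=> z1 z2 z11 z21.
have e (m nu : {measure set T2 -> \bar R}) : (forall B, measurable B -> nu B = m (B `&` sq)) ->
    (\int[nu]_x (pk z1 (expi x.1) * pk z2 (expi x.2))%:E =
     \int[m]_(x in sq) (poisson z1 z2 (expi x.1) (expi x.2))%:E)%E.
  move=> nuE; under eq_integral do rewrite -poisson_pk.
  apply: (ge0_integral_mrestr mS nuE (measurable_poisson z1 z2)) => y.
  by rewrite lee_fin poisson_ge0.
by rewrite (e sigma m1)// (e mu m2)// mu_poisson.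
Qed.

Let sigma_sqE (g : T2 -> \bar R) : measurable_fun setT g -> (forall y, 0 <= g y)%E ->
  (\int[sigma]_(y in sq) g y = \int[leb]_(t in I01) (g (t, beta t) * (W t)%:E)
      + \sum_(z <- zs) (mass z)%:E * \int[leb]_(s in I01) g (xs z, s))%E.
Proof.
move=> mg g0; rewrite -mu_sqE//; apply: eq_measure_integral => A mA AS.
by rewrite -(setIidl AS) same_measure.
Qed.

Lemma clark_transfer_of (F : T2 -> R) : sigma.-integrable sq (EFin \o F) ->
  leb.-integrable I01 (EFin \o (fun t => F (t, beta t) * W t)) /\
  \int[sigma]_(y in sq) F y = \int[leb]_(t in I01) (F (t, beta t) * W t)
        + \sum_(z <- zs) mass z * \int[leb]_(s in I01) F (xs z, s).
Proof.
apply: transfer => //.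
- by move=> z; exact: clark_mass_ge0.
- by move=> t; have [->|[bI _]] := beta_spec t; [left|right].
Qed.

End Representation.

Lemma clark_formula (F : R[i] -> R[i] -> R) :
  sigma.-integrable sq (EFin \o (fun x : T2 => F (expi x.1) (expi x.2))) ->
  leb.-integrable I01 (EFin \o (fun t => F (expi t) (Balpha n p1 p2 alpha (expi t))^*%C *
     Walpha n p1 p2 alpha (expi t))) /\
  \int[sigma]_(x in sq) F (expi x.1) (expi x.2) =
    \int[leb]_(t in I01) (F (expi t) (Balpha n p1 p2 alpha (expi t))^*%C *
      Walpha n p1 p2 alpha (expi t))
    + \sum_(z <- zs) clark_mass n p1 p2 alpha z.1 * \int[leb]_(s in I01) F z.1 (expi s).
Proof.
have mass0 z : 0 <= mass z by exact: clark_mass_ge0.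
have [mu muE] := graph_measure_exists zs xs mass0 W_ge0 mW mbeta.
move=> /(clark_transfer_of muE) /=.
have e t : F (expi t) (expi (beta t)) * W t =
    F (expi t) (Balpha n p1 p2 alpha (expi t))^*%C * Walpha n p1 p2 alpha (expi t).
  by rewrite -/(W t); have [->|[_ ->]] := beta_spec t; rewrite ?mulr0.
move=> [i1 ->]; split.
  by move: i1; congr (integrable _ _ _); apply/funext => t /=; rewrite e.
congr (_ + _); first exact: eq_int01.
by apply: eq_big_seq => z zin; congr (_ * _); apply: eq_int01 => s; rewrite expi_xs.
Qed.

Lemma clark_boundary z : z \in zs ->
  (0 < clark_mass n p1 p2 alpha z.1 <-> nt_limit phi z.1 z.2 alpha) /\
  (nt_limit phi z.1 z.2 alpha -> exists Ck : R[i], Ck != 0 /\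
    (forall z2 : R[i], cmod z2 <= 1 -> z2 != z.2 ->
       is_derive (z.1 : R[i]^o) 1 (fun w : R[i]^o => (phi w z2 : R[i]^o)) Ck) /\
    clark_mass n p1 p2 alpha z.1 = 1 / cmod Ck).
Proof.
move=> zin; have [t1 z21 v0 z2E] := zsP zin; set tau := z.1 in t1 v0 z2E *.
(* The nontangential limit of [phi] at this zero: [b] is unimodular and [clark_num] for the
   parameter [b] vanishes at [tau]. Thus the limit is [alpha] exactly when [N] vanishes at [tau]. *)
pose b := q1.[tau] / p2.[tau].
have uv : cmod p1.[tau] = cmod p2.[tau].
  move: z21; rewrite z2E cmod_div cmodN => /divr1_eq; apply.
have b1 : cmod b = 1.
  by rewrite cmod_div horner_refl// cmodM cmodX t1 expr1n mul1r cmod_conj uv divff// cmod_eq0.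
have Nb : (clark_num n p1 p2 b).[tau] = 0.
  by rewrite /clark_num hornerD hornerN hornerZ divfK// subrr.
have lim_b : nt_limit phi tau z.2 b.
  by rewrite z2E; exact: (nt_limit_boundary size_p1 size_p2 stable coprime_pq b1 t1 Nb).
have N_b : N.[tau] = 0 <-> alpha = b.
  split=> [h|->//]; apply: (mulIf v0); rewrite divfK//.
  by have := boundary_q1 h.
have lim_N : nt_limit phi tau z.2 alpha -> N.[tau] = 0.
  by move=> h; apply/N_b; exact: nt_limit_unique h lim_b.
have mE : N.[tau] = 0 -> N^`().[tau] != 0.
  by move=> N0; have [] := clark_massE size_p1 size_p2 stable coprime_pq alpha1
    clark_inner0 clark_den_neq t1 N0.
split.
  split=> [m0|/lim_N N0].
    have N0 : N.[tau] = 0.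
      by apply/eqP; apply: contraTT m0 => N0; rewrite /clark_mass (negbTE N0) ltxx.
    by rewrite (N_b.1 N0).
  by rewrite /clark_mass N0 eqxx divr_gt0 ?cmod_gt0// mE.
move=> /lim_N N0; exists (N^`().[tau] / p2.[tau]).
split; first by rewrite mulf_neq0 ?mE ?invr_eq0.
split.
  move=> z2 _; rewrite z2E.
  exact: (is_derive_phi_boundary size_p1 size_p2 stable coprime_pq alpha1 t1 N0).
by rewrite /clark_mass N0 eqxx cmod_div div1r invf_div.
Qed.

End ClarkMeasure.

Theorem theorem1p1 (R : realType) (n : nat) (p1 p2 : {poly R[i]})
  (zs : seq (R[i] * R[i])) (alpha : R[i])
  (sigma : {measure set (R * R)%type -> \bar R}) :
  (0 < n)%N ->
  (size p1 <= n.+1)%N -> (size p2 <= n.+1)%N ->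
  (forall z1 z2 : R[i], cmod z1 < 1 -> cmod z2 < 1 -> peval p1 p2 z1 z2 != 0) ->
  refl n p1 != 0 ->
  (size (refl n p1) == n.+1) || (size (refl n p2) == n.+1) ->
  no_common_factor (poly2 p1 p2) (poly2 (refl n p2) (refl n p1)) ->
  uniq zs ->
  (forall z : R[i] * R[i],
      z \in zs <-> [/\ cmod z.1 = 1, cmod z.2 = 1 & peval p1 p2 z.1 z.2 = 0]) ->
  cmod alpha = 1 ->
  (forall z1 z2 : R[i], cmod z1 < 1 -> cmod z2 < 1 ->
     ((1 - cmod (phi n p1 p2 z1 z2) ^+ 2) / cmod (alpha - phi n p1 p2 z1 z2) ^+ 2)%:E
     = (\int[sigma]_(x in (@unit_sq R)) (poisson z1 z2 (expi x.1) (expi x.2))%:E)%E) ->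
  exists c : R[i] * R[i] -> R,
    (forall z, z \in zs -> 0 <= c z) /\
    (forall f : R[i] -> R[i] -> R[i],
       cintegrable sigma (@unit_sq R) (fun x => f (expi x.1) (expi x.2)) ->
       cintegrable (@lebesgue_measure R) (@unit_int R)
         (fun t => f (expi t) (Balpha n p1 p2 alpha (expi t))^* * (Walpha n p1 p2 alpha (expi t))%:C) /\
       cint sigma (@unit_sq R) (fun x => f (expi x.1) (expi x.2))
       = cint (@lebesgue_measure R) (@unit_int R)
           (fun t => f (expi t) (Balpha n p1 p2 alpha (expi t))^* * (Walpha n p1 p2 alpha (expi t))%:C)
         + \sum_(z <- zs) (c z)%:C * cint (@lebesgue_measure R) (@unit_int R) (fun t => f z.1 (expi t))) /\
    (forall z, z \in zs ->
       (0 < c z <-> nt_limit (phi n p1 p2) z.1 z.2 alpha) /\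
       (nt_limit (phi n p1 p2) z.1 z.2 alpha ->
          exists Ck : R[i], Ck != 0 /\
            (forall z2 : R[i], cmod z2 <= 1 -> z2 != z.2 ->
               is_derive (z.1 : R[i]^o) 1 (fun w : R[i]^o => (phi n p1 p2 w z2 : R[i]^o)) Ck) /\
            c z = 1 / cmod Ck)).
Proof.
move=> _ s1 s2 st q0 _ cop uz mz a1 clark.
exists (fun z => clark_mass n p1 p2 alpha z.1); split; first by move=> z _; exact: clark_mass_ge0.
split; last exact: (clark_boundary s1 s2 st q0 cop a1 mz clark).
move=> f [iRe iIm].
have form := clark_formula s1 s2 st q0 cop a1 uz mz clark.
have [jRe eRe] := form (fun z w => complex.Re (f z w)) iRe.
have [jIm eIm] := form (fun z w => complex.Im (f z w)) iIm.
split.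
  split; [move: jRe|move: jIm]; congr (integrable _ _ _); apply/funext => t /=.
    by rewrite ReMr.
  by rewrite ImMr.
apply/eqP; rewrite eq_complex; apply/andP; split; apply/eqP.
  rewrite ReD Re_sum [LHS]/= eRe; congr (_ + _); last by apply: eq_bigr => z _; rewrite ReMl.
  by rewrite /cint /=; apply: eq_int01 => t; rewrite ReMr.
rewrite ImD Im_sum [LHS]/= eIm; congr (_ + _); last first.
  by apply: eq_bigr => z _; rewrite mulrC [_%:C * _]mulrC ImMr.
by rewrite /cint /=; apply: eq_int01 => t; rewrite ImMr.
Qed.
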